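(* Let $G$ be a rational Carnot group with Carnot metric $d$ and Hausdorff dimension $Q$, and let $\alpha(G)=(Q+1)/Q$. There exists a constant $C>0$ such that for almost every $g\in G$ the following holds for all sufficiently large $q_0$ (how large may depend on $g$): the number of solutions $(p,q)$ to $$d(g,\delta_q^{-1}p)<q^{-\alpha(G)},\qquad q\in\mathbb{N},\ q<q_0,\ p\in G(\mathbb{Z}),$$ lies between $C^{-1}\log q_0$ and $C\log q_0$.
   Context: A connected, simply connected Lie group $G$ with Lie algebra $\mathfrak g$ is a Carnot group if $\mathfrak g=\mathfrak g_1\oplus\cdots\oplus\mathfrak g_s$ with $[\mathfrak g_1,\mathfrak g_i]=\mathfrak g_{i+1}$ for all $i$ (with $\mathfrak g_{s+1}:=0$). Let $n_i=\dim\mathfrak g_i$. Via the exponential map (a bijection) and a choice of basis of each $\mathfrak g_i$, $G$ is given coordinates in $\mathbb{R}^{n_1}\times\cdots\times\mathbb{R}^{n_s}$, and the group law has the form $(x_1,\dots,x_s)*(x_1',\dots,x_s')=(x_1+x_1',x_2+x_2'+p_2,\dots,x_s+x_s'+p_s)$, where $p_i$ is a vector of polynomials in the coordinates of $x_1,\dots,x_{i-1},x_1',\dots,x_{i-1}'$. $G$ is rational if these coordinates can be chosen so that all the polynomials $p_i$ have integer coefficients; such coordinates are fixed. $G(\mathbb{Z})$ is the set of points of $G$ with integer coordinates (it is then a co-compact lattice). For $r>0$ the dilation is $\delta_r(x_1,\dots,x_s)=(rx_1,r^2x_2,\dots,r^sx_s)$. The Carnot metric $d$ is the left-invariant sub-Riemannian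 path metric determined by an inner product on $\mathfrak g_1$. The Hausdorff dimension of $(G,d)$ is $Q=\sum_i i\,n_i$. ''Almost every'' refers to Lebesgue measure in the coordinates (a Haar measure). Solutions are counted as pairs $(p,q)$; no lowest-terms condition is imposed. *)

(* Defs.v *)
(* The notations of mpoly clash with those of MathComp-Analysis. *)
From HB Require Import structures.
From mathcomp Require Import all_boot all_order all_algebra.
From mathcomp Require Import all_classical all_reals all_analysis.
From mathcomp Require Import -(notations) mpoly.
Import Order.TTheory GRing.Theory Num.Theory.
Import numFieldNormedType.Exports.

Set Implicit Arguments.
Unset Strict Implicit.
Unset Printing Implicit Defensive.

Local Open Scope classical_set_scope.
Local Open Scope ring_scope.

(* The data of a group law on 'rV[R]_n: coordinate j lies in layer deg j >= 1,
   and pol j is a polynomial in the 2n coordinates of the two factors, those of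
   the first factor coming first. *)
Section GroupLaw.
Context {R : realType} {n : nat}.
Variables (deg : 'I_n -> nat) (pol : 'I_n -> mpoly (n + n) R).
Implicit Types (x y v w : 'rV[R]_n) (A : set 'rV[R]_n).

Definition gmul x y : 'rV[R]_n :=
  \row_j (x 0 j + y 0 j
          + meval (fun k => (row_mx x y : 'rV[R]_(n + n)) 0 k) (pol j)).

Definition layer (i : nat) : set 'rV[R]_n :=
  [set v | forall j, deg j != i -> v 0 j = 0].

Definition lspan A : set 'rV[R]_n :=
  [set v | exists (k : nat) (a : 'I_k -> R) (u : 'I_k -> 'rV[R]_n),
             (forall i, A (u i)) /\ v = \sum_i a i *: u i].

(* The left-invariant vector field with value v at the identity 0. *)
Definition left_field v x : 'rV[R]_n := 'D_v (gmul x) 0.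

(* The commutator of the vector fields left_field v and left_field w, taken at
   the identity (where their values are v and w). *)
Definition lie v w : 'rV[R]_n :=
  'D_v (left_field w) 0 - 'D_w (left_field v) 0.

Definition lower_coordinates (j : 'I_n) : Prop :=
  forall m, m \in msupp (pol j) ->
  forall k : 'I_n, (deg j <= deg k)%N ->
    m (lshift n k) = 0%N /\ m (rshift n k) = 0%N.

(* carnot_lines says that t |-> t *: v is a one-parameter subgroup for every v,
   i.e. that exp is the identity map in these coordinates.  It also makes 0 the
   identity and - v the inverse of v, so that together with carnot_mulA it
   makes gmul a Lie group law. *)
Record carnot (s : nat) : Prop := Carnot {
  carnot_deg : forall j, (1 <= deg j <= s)%N;
  carnot_lower : forall j, lower_coordinates j;
  carnot_mulA : associative gmul;
  carnot_lines : forall v (a b : R), gmul (a *: v) (b *: v) = (a + b) *: v;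
  carnot_strat : forall i, (1 <= i <= s)%N ->
    lspan [set lie v w | v in layer 1 & w in layer i] = layer i.+1
}.

Definition integral_coefficients : Prop :=
  forall j m, mcoeff m (pol j) \is a Num.int.

Definition layer_dim (i : nat) : nat := #|[set j | deg j == i]%SET|.

(* The Hausdorff dimension of a Carnot group for its Carnot metric, given by its
   value. *)
Definition hausdorff_dim (s : nat) : nat :=
  (\sum_(1 <= i < s.+1) i * layer_dim i)%N.

Definition dilation (r : R) x : 'rV[R]_n := \row_j (r ^+ deg j * x 0 j).

Definition integer_points : set 'rV[R]_n :=
  [set x | forall j, x 0 j \is a Num.int].

Definition inner_product_on A (ip : 'rV[R]_n -> 'rV[R]_n -> R) : Prop :=
  [/\ forall u v, A u -> A v -> ip u v = ip v u,
      forall (a : R) u v w, A u -> A v -> A w ->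
        ip (a *: u + v) w = a * ip u w + ip v w
    & forall u, A u -> u != 0 -> 0 < ip u u].

Variable ip : 'rV[R]_n -> 'rV[R]_n -> R.

(* A C^1 horizontal arc from x to y of length l.  A C^1 curve on [0, 1] is taken
   as the restriction of a C^1 curve on the line, which need not be horizontal
   outside [0, 1]; u t is the velocity left-translated to the identity. *)
Definition horizontal_arc x y (l : R) : Prop :=
  exists gamma u : R -> 'rV[R]_n,
    [/\ (forall t, derivable gamma t 1) /\ continuous (derive1 gamma),
        gamma 0 = x /\ gamma 1 = y,
        forall t, 0 <= t <= 1 ->
          layer 1 (u t) /\ derive1 gamma t = left_field (u t) (gamma t)
      & l = \int[lebesgue_measure]_(t in `[0, 1]) Num.sqrt (ip (u t) (u t))].

(* Piecewise C^1 horizontal paths, as finite chains of arcs. *)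
Inductive horizontal_path : 'rV[R]_n -> 'rV[R]_n -> R -> Prop :=
| horizontal_path_nil x : horizontal_path x x 0
| horizontal_path_cons x y z l l' :
    horizontal_arc x y l -> horizontal_path y z l' ->
    horizontal_path x z (l + l').

Definition carnot_dist x y : \bar R :=
  ereal_inf [set l%:E | l in horizontal_path x y].

End GroupLaw.

Section Lebesgue.
Context {R : realType} {n : nat}.

Definition box (a b : 'rV[R]_n) : set 'rV[R]_n :=
  [set x | forall j, a 0 j <= x 0 j <= b 0 j].

Definition box_volume (a b : 'rV[R]_n) : R :=
  \prod_j Num.max 0 (b 0 j - a 0 j).

Definition lebesgue_outer (A : set 'rV[R]_n) : \bar R :=
  ereal_inf [set v | exists a b : nat -> 'rV[R]_n,
    A `<=` \bigcup_k box (a k) (b k) /\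
    v = (\sum_(0 <= k <oo) (box_volume (a k) (b k))%:E)%E].

Definition almost_every (P : 'rV[R]_n -> Prop) : Prop :=
  lebesgue_outer [set x | ~ P x] = 0%E.

End Lebesgue.

(* The pairs (p, q) with q a positive integer, as q^{-alpha} and the inverse of
   delta_q require. *)
Definition solutions {R : realType} {n : nat} (deg : 'I_n -> nat)
    (d : 'rV[R]_n -> 'rV[R]_n -> \bar R) (alpha : R) (g : 'rV[R]_n) (q0 : R) :
    set ('rV[R]_n * nat) :=
  [set pq | [/\ integer_points pq.1, (0 < pq.2)%N, pq.2%:R < q0
    & (d g (dilation deg (pq.2%:R^-1) pq.1) < (pq.2%:R `^ (- alpha))%:E)%E]].

(* Main.v *)
(* For a natural number L divisible by all q < T, the group is sampled at the
   points delta_{1/L} x, x in Z^n.  After applying delta_L, the ball-box estimates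
   turn d(g, delta_q^{-1} p) < q^{-alpha} into: x is congruent, modulo the
   dilated lattice delta_{L/q}(Z^n), to an integer point b of a box of volume
   about (L/q)^Q / q.  Every box with sides (L/q)^{deg j} contains exactly one
   point of each class modulo delta_{L/q}(Z^n), so the mean number of solutions
   is a sum of 1/q, hence comparable to log T.  The classes modulo delta_{L/q}
   and delta_{L/k} meet in at most one class modulo delta_{lcm(L/q, L/k)}, which
   makes the counts for q and k almost uncorrelated once the repetitions (p, q),
   (delta_m p, m q) with large m are removed, and Chebyshev's inequality applies.
   Along T = 2^(16^i) the exceptional sets are covered by boxes of summable
   volume, and Borel-Cantelli concludes.

   That dilations are automorphisms is not part of the definition of carnot: by
   Eichler's argument the defect of homogeneity of the group law, an additive
   cocycle in its lowest degree, vanishes. *)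
Require Import Defs.
From mathcomp Require Import all_boot all_order all_algebra.
From mathcomp Require Import all_classical all_reals all_analysis.
From mathcomp Require Import finmap.
From mathcomp Require Import -(notations) mpoly.
From mathcomp Require Import ring lra zify.
Import Order.TTheory GRing.Theory Num.Theory.
Import numFieldNormedType.Exports.

Set Implicit Arguments.
Unset Strict Implicit.
Unset Printing Implicit Defensive.

Local Open Scope classical_set_scope.
Local Open Scope ring_scope.

(** * Second moment of the counting function *)

(** The definition of almost every point only knows covers by boxes, so measures are replaced by
    exact counts on a grid: a box whose sides are multiples of those of the cells contains every
    class equally often. Passing from a grid point to the points of its cell costs a factor 2 in the
    radii, hence two countings, one with a small constant bounding the solutions from below and one
    with a large constant bounding them from above.

    With [v q = q^(-1/Q)] and [k' = k / gcd(q, k)], the correlation of q <= k exceeds the product of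
    the means by terms of order [v q / (k k')], and since the sum of [v e / e] converges they add up
    to O(log T). Keeping the repetitions by factors up to M0 costs M0 log T in the second moment,
    and discarding the others changes the mean by log T / M0. After division by (log T)^2 and log T
    these are M0 / log T and 1 / M0, balanced by M0 = sqrt(log T): with log T of order 16^i the
    choice M0 = 4^i leaves a bad proportion O(4^-i). From one stage to the next log T grows by the
    factor 16, so monotonicity in q0 fills the gaps at the cost of a constant. *)

Lemma cell_index_uniq (d a b z : int) : 0 < d ->
  a * d <= z < a * d + d -> b * d <= z < b * d + d -> a = b.
Proof.
move=> d0 /andP[a1 a2] /andP[b1 b2].
have ab : a < b + 1 by rewrite -(ltr_pM2r d0) mulrDl mul1r; apply: le_lt_trans b2.
have ba : b < a + 1 by rewrite -(ltr_pM2r d0) mulrDl mul1r; apply: le_lt_trans a2.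
by lia.
Qed.

(* The properties used of the relations "x and y lie in the same coset of
   delta_m(Z^n)", on the integer points of the group. *)
Record congruence_family n (deg : 'I_n -> nat) (E : nat -> rel 'rV[int]_n) : Prop := CongruenceFamily {
  congr_refl : forall m x, (0 < m)%N -> E m x x;
  congr_sym : forall m x y, (0 < m)%N -> E m x y -> E m y x;
  congr_trans : forall m x y z, (0 < m)%N -> E m x y -> E m y z -> E m x z;
  congr_dvd : forall m m' x y, (0 < m)%N -> (m' %| m)%N -> E m x y -> E m' x y;
  congr_lcm : forall m m' x y, (0 < m)%N -> (0 < m')%N ->
    E m x y -> E m' x y -> E (lcmn m m') x y;
  congr_uniq : forall m x y, (0 < m)%N -> E m x y ->
    (forall j, `|x 0 j - y 0 j| < (m ^ deg j)%:Z) -> x = y;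
  congr_exists : forall m x (lo : 'I_n -> int), (0 < m)%N ->
    exists y, E m y x /\ forall j, lo j <= y 0 j < lo j + (m ^ deg j)%:Z
}.

Arguments congr_sym {n deg E} _ {m x y}.
Arguments congr_trans {n deg E} _ {m x y z}.
Arguments congr_dvd {n deg E} _ {m m' x y}.
Arguments congr_lcm {n deg E} _ {m m' x y}.
Arguments congr_uniq {n deg E} _ {m x y}.
Arguments congr_exists {n deg E} _ {m}.

(** * Congruence classes in boxes of integer points *)

Section IntegerBoxes.
Variables (n : nat) (deg : 'I_n -> nat).
Implicit Types (lo : 'I_n -> int) (K : 'I_n -> nat) (x y b : 'rV[int]_n).

Definition int_box lo K : seq 'rV[int]_n :=
  [seq (\row_j (lo j + Posz (f j)))%R | f : {dffun forall j, 'I_(K j)}].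

Lemma size_int_box lo K : size (int_box lo K) = (\prod_j K j)%N.
Proof.
rewrite size_map -cardE card_dep_ffun foldrE big_map big_enum.
by apply: eq_bigr => j _; rewrite card_ord.
Qed.

Lemma mem_int_box lo K x :
  (x \in int_box lo K) = [forall j, (lo j <= x 0 j) && (x 0 j < lo j + (K j)%:Z)].
Proof.
apply/mapP/forallP => [[f _ ->] j|xP].
  by rewrite mxE lerDl ltrD2l ltz_nat ltn_ord andbT.
have h (j : 'I_n) : (absz (x 0%R j - lo j)%R < K j)%N by have := xP j; lia.
exists [ffun j => Ordinal (h j)]; first by rewrite mem_enum.
by apply/rowP => j; rewrite mxE ffunE /=; have := xP j; lia.
Qed.

Lemma int_box_uniq lo K : uniq (int_box lo K).
Proof.
rewrite map_inj_uniq ?enum_uniq // => f g /rowP fg.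
apply/ffunP => j; apply: val_inj => /=; have := fg j; rewrite !mxE; lia.
Qed.

Variable E : nat -> rel 'rV[int]_n.
Hypothesis HE : congruence_family deg E.

(** Dividing the offsets by [m ^ deg j] sends a point to the index of its cell. Two congruent points
    of one cell differ by less than [m ^ deg j] in every coordinate, so by [congr_uniq] the map is
    injective on [S]. *)
Lemma pack_int_box m lo K (S : seq 'rV[int]_n) : (0 < m)%N -> uniq S ->
  {in S &, forall x y, E m x y} ->
  (forall x, x \in S -> forall j, lo j <= x 0 j < lo j + (K j * m ^ deg j)%:Z) ->
  (size S <= \prod_j K j)%N.
Proof.
move=> m0 uS ES SP.
pose f x : 'rV[int]_n := \row_j divz (x 0 j - lo j) (m ^ deg j)%:Z.
have md0 j : 0 < (m ^ deg j)%:Z by rewrite ltz_nat expn_gt0 m0.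
have f_inj : {in S &, injective f}.
  move=> x y xS yS /rowP fxy; apply: (congr_uniq HE m0 (ES _ _ xS yS)) => j.
  have := fxy j; rewrite !mxE => e.
  have := divz_eq (x 0 j - lo j) (m ^ deg j)%:Z.
  have := divz_eq (y 0 j - lo j) (m ^ deg j)%:Z.
  have := ltz_pmod (x 0 j - lo j) (md0 j).
  have := ltz_pmod (y 0 j - lo j) (md0 j).
  have := modz_ge0 (x 0 j - lo j) (lt0r_neq0 (md0 j)).
  have := modz_ge0 (y 0 j - lo j) (lt0r_neq0 (md0 j)).
  rewrite e; set u := divz _ _ * _; lia.
rewrite -(size_map f) -(size_int_box (fun=> 0)).
apply: uniq_leq_size; first by rewrite map_inj_in_uniq.
move=> _ /mapP[x xS ->]; rewrite mem_int_box; apply/forallP => j.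
rewrite mxE add0r divz_ge0 // ltz_divLR //.
by have := SP x xS j; rewrite PoszM; lia.
Qed.

(** The box is a disjoint union of [\prod_j K j] cells, and [congr_exists] provides a point of the
    class of [b] in each of them. *)
Lemma fill_int_box m lo K b : (0 < m)%N ->
  (\prod_j K j <= count (fun x => E m x b)
     (int_box lo (fun j => K j * m ^ deg j)%N))%N.
Proof.
move=> m0.
have md0 j : 0 < (m ^ deg j)%:Z by rewrite ltz_nat expn_gt0 m0.
have H (i : 'rV[int]_n) := (congr_exists HE) b (fun j => lo j + i 0 j * (m ^ deg j)%:Z) m0.
have [f fP] := choice H.
rewrite -(size_int_box (fun=> 0)) -(size_map f) -size_filter.
apply: uniq_leq_size.
  rewrite map_inj_uniq ?int_box_uniq // => i i' ff.
  apply/rowP => j; have [_ /(_ j)] := fP i; have [_ /(_ j)] := fP i'.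
  rewrite ff => h1 h2; apply: (@cell_index_uniq (m ^ deg j)%:Z _ _ (f i' 0 j - lo j)) => //.
    by rewrite lerBrDl ltrBlDl addrA.
  by rewrite lerBrDl ltrBlDl addrA.
move=> _ /mapP[i iB ->]; rewrite mem_filter; have [-> /= fj] := fP i.
rewrite mem_int_box; apply/forallP => j.
move: iB; rewrite mem_int_box => /forallP /(_ j); have := fj j; have := md0 j.
rewrite PoszM add0r; set d := (m ^ deg j)%:Z => d0 h1 /andP[i0 iK].
have : 0 <= i 0 j * d by rewrite mulr_ge0 // ltW.
have : (i 0 j + 1) * d <= (K j)%:Z * d by rewrite ler_pM2r // lezD1.
rewrite mulrDl mul1r => h3 h4; case/andP: h1 => h5 h6.
by apply/andP; split; [apply: le_trans h5; rewrite lerDl|apply: lt_le_trans h6 _; rewrite -addrA lerD2l].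
Qed.

Lemma count_int_box m lo K b : (0 < m)%N ->
  count (fun x => E m x b) (int_box lo (fun j => K j * m ^ deg j)%N)
  = (\prod_j K j)%N.
Proof.
move=> m0; apply/eqP; rewrite eqn_leq fill_int_box // andbT -size_filter.
apply: (@pack_int_box m lo) => //.
- exact/filter_uniq/int_box_uniq.
- move=> x y; rewrite !mem_filter => /andP[xb _] /andP[yb _].
  exact: (congr_trans HE) xb (congr_sym HE _ yb).
move=> x; rewrite mem_filter mem_int_box => /andP[_ /forallP]; exact.
Qed.

End IntegerBoxes.

(** * Harmonic sums and the convergent series of q^(-1-1/Q) *)

Section Sums.
Variable R : realFieldType.

Lemma ler_sum_inj (I J : finType) (P : pred I) (P' : pred J) (h : I -> J)
    (F : I -> R) (G : J -> R) :
  {in P &, injective h} -> (forall i, P i -> P' (h i)) ->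
  (forall i, P i -> F i <= G (h i)) -> (forall j, P' j -> 0 <= G j) ->
  \sum_(i | P i) F i <= \sum_(j | P' j) G j.
Proof.
move=> h_inj hP FG G0; apply: (le_trans (ler_sum _ FG)).
rewrite -(big_imset _ h_inj) /= [leRHS](bigID (fun j => j \in h @: P)%SET) /=.
rewrite -[leLHS]addr0; apply: lerD; last by apply: sumr_ge0 => j /andP[/G0].
rewrite [leRHS](eq_bigl (fun j => j \in (h @: P)%SET)) // => j.
by apply/andb_idl => /imsetP[i iP ->]; apply: hP.
Qed.

Definition harmonic_sum (T : nat) : R := \sum_(q < T | (0 < q)%N) q%:R^-1.

(** Each of the N dyadic blocks below [2 ^ N] contributes between 1/2 and 1. *)
Lemma harmonic_sum_pow2 N :
  N%:R / 2 <= harmonic_sum (2 ^ N) /\ harmonic_sum (2 ^ N) <= N%:R.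
Proof.
rewrite /harmonic_sum -(big_mkord (fun q => (0 < q)%N) (fun q => q%:R^-1)).
elim: N => [|N [IH1 IH2]].
  by rewrite big_mkcond big_nat1 /= mul0r.
have p0 : (0 < (2 ^ N)%N%:R :> R) by rewrite ltr0n expn_gt0.
have pE : (2 ^ N.+1 = 2 ^ N + 2 ^ N)%N by rewrite expnS mul2n addnn.
rewrite (big_cat_nat (n := 2 ^ N)) ?leq0n ?leq_pexp2l //=.
set S := (X in _ + X).
have S1 : S <= 1.
  apply: (@le_trans _ _ (\sum_(2 ^ N <= q < 2 ^ N.+1) ((2 ^ N)%N%:R)^-1)).
    rewrite /S big_mkcond big_nat [leRHS]big_nat; apply: ler_sum => q /andP[q1 _].
    case: ifP => q0; last by rewrite invr_ge0.
    by rewrite lef_pV2 ?posrE ?ltr0n ?expn_gt0 // ler_nat.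
  by rewrite sumr_const_nat {1}pE addnK -[leLHS]mulr_natr mulVf // gt_eqF.
have S2 : 2^-1 <= S.
  apply: (@le_trans _ _ (\sum_(2 ^ N <= q < 2 ^ N.+1) ((2 ^ N.+1)%N%:R)^-1)).
    rewrite sumr_const_nat; have -> : (2 ^ N.+1 - 2 ^ N = 2 ^ N)%N by rewrite pE addnK.
    rewrite -[leRHS]mulr_natr pE natrD; move: p0; set t := _%:R => t0.
    by rewrite le_eqVlt; apply/orP; left; apply/eqP; field; lra.
  rewrite /S [leRHS]big_mkcond [leLHS]big_nat [leRHS]big_nat; apply: ler_sum => q /andP[q1 q2].
  have q0 : (0 < q)%N by apply: leq_trans q1; rewrite expn_gt0.
  by rewrite q0 lef_pV2 ?posrE ?ltr0n ?expn_gt0 // ler_nat ltnW.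
by rewrite -natr1; split; lra.
Qed.

Lemma harmonic_sum_ge0 T : 0 <= harmonic_sum T.
Proof. by apply: sumr_ge0 => q _; rewrite invr_ge0. Qed.

Lemma sum_inv_sqr T M0 : (0 < M0)%N ->
  \sum_(m < T | (M0 < m)%N) (m%:R ^- 2) <= M0%:R^-1 :> R.
Proof.
move=> M0_gt0.
(* The bound 1/m^2 <= 1/(m-1) - 1/m telescopes; as long as [N <= M0] the sum is empty, and the
   default value of the [if] makes the right side vanish. *)
have telescope (N : nat) : \sum_(m < N | (M0 < m)%N) (m%:R ^- 2) <=
    M0%:R^-1 - (if (M0 < N)%N then (N.-1)%:R^-1 else M0%:R^-1) :> R.
  elim: N => [|N IH]; first by rewrite big_ord0 subrr.
  rewrite big_mkcond big_ord_recr -big_mkcond /=.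
  have [NM|NM] := leqP N M0.
    rewrite addr0; move: IH; rewrite ltnNge NM /= subrr => IH; apply: le_trans IH _.
    rewrite ltnS; case: leqP => [MN|_]; last by rewrite subrr.
    have -> : N = M0 by apply/eqP; rewrite eqn_leq NM MN.
    by rewrite subrr.
  move: IH; rewrite NM ltnS (ltnW NM) /= => IH.
  apply: (le_trans (lerD IH (lexx _))).
  rewrite -addrA lerD2l.
  have N1 : 0 < (N.-1)%:R :> R by rewrite ltr0n; lia.
  have -> : N%:R = (N.-1)%:R + 1 :> R by rewrite natr1 prednK // (leq_trans _ NM).
  move: N1; set t := (N.-1)%:R => t0.
  rewrite -subr_ge0.
  have -> : - (t + 1)^-1 - (- t^-1 + (t + 1) ^- 2) = t^-1 * (t + 1) ^- 2 by field; lra.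
  by rewrite mulr_ge0 ?invr_ge0 ?exprn_ge0; lra.
apply: le_trans (telescope T) _; rewrite gerBl; case: ifP => _; by rewrite invr_ge0.
Qed.

(** [v q] stands for q^(-1/Q); it is known only by its sign and its Q-th power, so that no real
    powers enter these sums. *)
Variables (Q : nat) (v : nat -> R).
Hypothesis Q_gt0 : (0 < Q)%N.
Hypothesis v_gt0 : forall q, (0 < q)%N -> 0 < v q.
Hypothesis vE : forall q, (0 < q)%N -> v q ^+ Q = q%:R^-1.

Let v_ge0 q : (0 < q)%N -> 0 <= v q.
Proof. by move=> q0; apply/ltW/v_gt0. Qed.

Lemma root_inv_decr q k : (0 < q <= k)%N -> v k <= v q.
Proof.
move=> /andP[q0 qk]; have k0 := leq_trans q0 qk.
rewrite -(ler_pXn2r Q_gt0) ?nnegrE ?v_ge0 // !vE //.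
by rewrite lef_pV2 ?posrE ?ltr0n // ler_nat.
Qed.

Lemma root_inv_le1 q : (0 < q)%N -> v q <= 1.
Proof.
move=> q0; rewrite -(ler_pXn2r Q_gt0) ?nnegrE ?v_ge0 // vE // expr1n.
by rewrite invf_le1 ?ltr0n // ler1n.
Qed.

(* w = v_e decreases slowly: w_{e-1}^Q - w_e^Q = 1/(e(e-1)) forces
   w_{e-1} - w_e >= w_e/(Q e), which telescopes. *)
Lemma root_inv_step e : (0 < e)%N -> v e.+1 / e.+1%:R <= Q%:R * (v e - v e.+1).
Proof.
move=> e0.
have a0 := v_gt0 e0; have b0 := v_gt0 (ltn0Sn e).
have ba : v e.+1 <= v e by apply: root_inv_decr; rewrite e0 /=.
have hS : \sum_(i < Q) v e ^+ (Q.-1 - i) * v e.+1 ^+ i <= Q%:R * v e ^+ Q.-1.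
  rewrite mulr_natl -[X in _ *+ X]card_ord -sumr_const; apply: ler_sum => i _.
  have iQ : (i <= Q.-1)%N by rewrite -ltnS prednK.
  rewrite -[X in _ <= _ ^+ X](subnK iQ) exprD ler_wpM2l ?exprn_ge0 ?v_ge0 //.
  by rewrite lerXn2r ?nnegrE ?v_ge0.
have h := subrXX (v e) (v e.+1) Q; rewrite !vE // in h.
have e1 : 0 < e%:R :> R by rewrite ltr0n.
have vQ : v e * v e ^+ Q.-1 = e%:R^-1 by rewrite -exprS prednK // vE.
have h1 : e%:R^-1 - e.+1%:R^-1 = e%:R^-1 * e.+1%:R^-1 :> R.
  by rewrite -natr1; field; apply/andP; split; lra.
have h2 : v e * (e%:R^-1 * e.+1%:R^-1) <= (v e - v e.+1) * (Q%:R * e%:R^-1).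
  rewrite -h1 h mulrCA ler_wpM2l ?subr_ge0 //.
  by apply: (le_trans (ler_wpM2l (ltW a0) hS)); rewrite mulrCA vQ.
have h3 : v e * e.+1%:R^-1 <= (v e - v e.+1) * Q%:R.
  by rewrite -(@ler_pM2r _ e%:R^-1) ?invr_gt0 // -mulrA [_^-1 * _^-1]mulrC -[leRHS]mulrA.
rewrite mulrC [leRHS]mulrC mulrC; apply: le_trans h3.
by rewrite ler_wpM2r // invr_ge0.
Qed.

(** The term e = 1 is at most 1 and [root_inv_step] telescopes the others to at most Q. A bound
    independent of T is what keeps the sum over pairs (q, k) linear in log T. *)
Lemma sum_root_inv T : \sum_(e < T | (0 < e)%N) v e / e%:R <= 1 + Q%:R.
Proof.
have v1 : v 1 <= 1 by apply: root_inv_le1.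
have telescope (N : nat) : \sum_(e < N.+2 | (0 < e)%N) v e / e%:R <=
    1 + Q%:R * (1 - v N.+1).
  elim: N => [|N IH].
    rewrite big_mkcond !big_ord_recr big_ord0 /= !add0r divr1.
    by rewrite -[leLHS]addr0 lerD // mulr_ge0 // subr_ge0.
  rewrite big_mkcond big_ord_recr -big_mkcond /=.
  apply: (le_trans (lerD IH (root_inv_step (ltn0Sn N)))).
  by rewrite le_eqVlt; apply/orP; left; apply/eqP; ring.
case: T => [|[|N]].
- by rewrite big_ord0 addr_ge0.
- by rewrite big_mkcond big_ord1 /= addr_ge0.
by apply: le_trans (telescope N) _; rewrite lerD2l ler_piMr // gerBl v_ge0.
Qed.

End Sums.

(** The product is expanded over the subsets J of coordinates. Removing 1 (J empty) and
    [\prod_j u j] (J full) leaves subsets of total degree D strictly between 0 and the sum of all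
    degrees; each contributes at most [A ^+ n * w ^+ D], and there are at most 2^n of them. *)
Lemma prod_offdiag_le (R : realFieldType) (n : nat) (deg : 'I_n -> nat)
    (u : 'I_n -> R) (A w W : R) :
  (forall j, (0 < deg j)%N) -> (0 < n)%N ->
  1 <= A -> 0 <= w -> (forall j, 0 <= u j <= A * w ^+ deg j) ->
  (forall D, (0 < D < \sum_j deg j)%N -> w ^+ D <= W) -> 0 <= W ->
  \prod_j (1 + u j) - 1 - \prod_j u j <= (2 * A) ^+ n * W.
Proof.
move=> deg0 n0 A1 w0 uw wW W0.
under eq_bigr => j _ do rewrite addrC.
rewrite bigA_distr /= (bigD1 finset.set0) //= [X in X + _ - _ - _]big1; last by move=> j _; rewrite inE.
rewrite (bigD1 [set: 'I_n]%SET) /=; last first.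
  by apply/eqP => /setP /(_ (Ordinal n0)); rewrite !inE.
under [X in _ + (X + _) - _ - _]eq_bigr => j _ do rewrite inE.
set P := \prod_j u j; set S := (X in _ + (_ + X) - _ - _).
have -> : 1 + (P + S) - 1 - P = S by ring.
apply: (@le_trans _ _ (\sum_(J : {set 'I_n}) A ^+ n * W)); last first.
  have card_n : #|{set 'I_n}| = (2 ^ n)%N.
    by rewrite -cardsT -powersetT card_powerset cardsT card_ord.
  by rewrite sumr_const card_n exprMn -mulrA -natrX mulr_natl.
rewrite /S big_mkcond [leRHS]big_mkcond; apply: ler_sum => J _ /=.
have AW : 0 <= A ^+ n * W by rewrite mulr_ge0 // exprn_ge0 // (le_trans ler01).
case: ifP => // /andP[J0 JT].
pose D := (\sum_(j in J) deg j)%N.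
have /wW wD : (0 < D < \sum_j deg j)%N.
  have pos (K : {set 'I_n}) : K != finset.set0 -> (0 < \sum_(j in K) deg j)%N.
    by case/set0Pn => j jK; rewrite (bigD1 j) //= ltn_addr.
  rewrite pos //= [ltnRHS](bigID (fun j => j \in J)) /= -[ltnLHS]addn0 ltn_add2l.
  rewrite (eq_bigl (fun j => j \in ~: J)%SET); last first.
    by move=> j; rewrite !inE.
  by apply: pos; rewrite -finset.setCT (inj_eq (can_inj (@finset.setCK _))).
apply: (@le_trans _ _ (\prod_j (if j \in J then A * w ^+ deg j else 1))).
  apply: ler_prod => j _; by case: ifP => // _; rewrite ler01 lexx.
rewrite -big_mkcond big_split /= prodr_const prodrXr -/D.
apply: ler_pM => //; first by rewrite exprn_ge0 // (le_trans ler01).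
  by rewrite exprn_ge0.
by rewrite ler_weXn2l // -[X in (_ <= X)%N]card_ord max_card.
Qed.

Lemma gcdn_divn L q k : (0 < q)%N -> (0 < k)%N -> (q %| L)%N -> (k %| L)%N ->
  (gcdn (L %/ q) (L %/ k) * (q * k) = L * gcdn q k)%N.
Proof.
move=> q0 k0 qL kL.
by rewrite muln_gcdl mulnA divnK // mulnCA divnK // [(q * L)%N]mulnC -muln_gcdr gcdnC.
Qed.

(** * Means and pair correlations of the hits over the sample box *)

Section SecondMoment.
Variables (R : realFieldType) (n : nat) (deg : 'I_n -> nat).
Variable E : nat -> rel 'rV[int]_n.
Hypothesis HE : congruence_family deg E.

Variables (L T M0 : nat) (rad : nat -> 'I_n -> nat) (a : 'I_n -> int).
Hypothesis L_gt0 : (0 < L)%N.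
Hypothesis L_dvd : forall q, (0 < q < T)%N -> (q %| L)%N.
Hypothesis rad_decr : forall q k j, (0 < q <= k)%N -> (k < T)%N -> (rad k j <= rad q j)%N.

Let Q := (\sum_j deg j)%N.

Definition sample_box := int_box (fun j => a j * (L ^ deg j)%:Z) (fun j => (L ^ deg j)%N).
Definition target_box q := int_box (fun j => - (rad q j)%:Z) (fun j => (2 * rad q j).+1).
(* For g = delta_{1/L} x and E m the congruence modulo delta_m(Z^n), the solutions
   (p, q) with q < T correspond to the pairs (q, b) counted here, through
   delta_{L/q} p = x * (- b). *)
Definition hits (x : 'rV[int]_n) : R :=
  \sum_(q < T | (0 < q)%N) \sum_(b <- target_box q) (E (L %/ q)%N x b)%:R.
(* E (L/q * m) x b means that (q, b) repeats, by a factor m, a hit of denominator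
   q/m; those with m > M0 are discarded, as they inflate the second moment. *)
Definition primitive_hit q x b :=
  E (L %/ q)%N x b && all (fun m => ~~ E (L %/ q * m)%N x b) [seq m <- divisors q | (M0 < m)%N].
Definition primitive_hits (x : 'rV[int]_n) : R :=
  \sum_(q < T | (0 < q)%N) \sum_(b <- target_box q) (primitive_hit q x b)%:R.
(** The mean over the sample box of the contribution of q to [hits]: the number of targets times the
    proportion (L/q)^(-Q) of one class. *)
Definition hit_density q : R :=
  (\prod_j (2 * rad q j).+1)%:R / ((L %/ q) ^ Q)%N%:R.

Let prod_expn m : (\prod_(j < n) m ^ deg j = m ^ Q)%N.
Proof. by rewrite /Q expn_sum. Qed.

Let divL_gt0 m : (m %| L)%N -> (0 < L %/ m)%N.
Proof. by move=> mL; rewrite divn_gt0 ?(dvdn_gt0 L_gt0) // dvdn_leq. Qed.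

Let divLK m : (m %| L)%N -> (L %/ (L %/ m) = m)%N.
Proof. by move=> mL; rewrite divnA // mulKn. Qed.

Let sample_boxE m : (m %| L)%N -> sample_box =
  int_box (fun j => a j * (L ^ deg j)%:Z) (fun j => (L %/ m) ^ deg j * m ^ deg j)%N.
Proof.
move=> mL; rewrite /sample_box; congr int_box; apply/funext => j.
by rewrite -expnMn divnK.
Qed.

Lemma size_sample_box : size sample_box = (L ^ Q)%N.
Proof. by rewrite size_int_box prod_expn. Qed.

Lemma sum_nat_of_bool (I : Type) (r : seq I) (P : pred I) :
  \sum_(i <- r) (P i)%:R = (count P r)%:R :> R.
Proof.
by rewrite -sum1_count natr_sum [RHS]big_mkcond; apply: eq_bigr => i _; case: (P i).
Qed.

Let ler_nat_of_bool (b c : bool) : (b -> c) -> b%:R <= c%:R :> R.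
Proof. by case: b c => [] [] //= /(_ isT). Qed.

Lemma sum_sample_class m b : (m %| L)%N ->
  \sum_(x <- sample_box) (E m x b)%:R = ((L %/ m) ^ Q)%N%:R :> R.
Proof.
move=> mL; have m0 := dvdn_gt0 L_gt0 mL.
by rewrite sum_nat_of_bool (sample_boxE mL) (count_int_box HE) ?prod_expn.
Qed.

(** Points counted here are congruent to each other modulo both numbers, hence modulo their lcm by
    [congr_lcm], so they lie in a single class to which packing applies. *)
Lemma sum_sample_class2 m m' b b' : (m %| L)%N -> (m' %| L)%N ->
  \sum_(x <- sample_box) (E m x b && E m' x b')%:R
  <= ((L %/ lcmn m m') ^ Q)%N%:R :> R.
Proof.
move=> mL mL'; have m0 := dvdn_gt0 L_gt0 mL; have m0' := dvdn_gt0 L_gt0 mL'.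
have lL : (lcmn m m' %| L)%N by rewrite dvdn_lcm mL.
have l0 := dvdn_gt0 L_gt0 lL.
rewrite sum_nat_of_bool ler_nat -size_filter (sample_boxE lL) -prod_expn.
apply: (pack_int_box HE l0 (lo := fun j => a j * (L ^ deg j)%:Z)).
- exact/filter_uniq/int_box_uniq.
- move=> x y; rewrite !mem_filter => /andP[/andP[xb xb'] _] /andP[/andP[yb yb'] _].
  by apply: (congr_lcm HE) => //; [apply: (congr_trans HE) xb (congr_sym HE _ yb)|apply: (congr_trans HE) xb' (congr_sym HE _ yb')].
move=> x; rewrite mem_filter mem_int_box => /andP[_ /forallP]; exact.
Qed.

Let target_size q : size (target_box q) = (\prod_j (2 * rad q j).+1)%N.
Proof. exact: size_int_box. Qed.

Let L_dvd' (q : 'I_T) : (0 < q)%N -> (q %| L)%N.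
Proof. by move=> q0; apply: L_dvd; rewrite q0 /=. Qed.

Let LQ_neq0 m : (m %| L)%N -> ((L %/ m) ^ Q)%N%:R != 0 :> R.
Proof. by move=> mL; rewrite pnatr_eq0 expn_eq0 negb_and -lt0n divL_gt0. Qed.

Lemma hit_densityE q : (q %| L)%N ->
  (L ^ Q)%N%:R * hit_density q = (\prod_j (2 * rad q j).+1)%N%:R * (q ^ Q)%N%:R.
Proof.
move=> qL; rewrite /hit_density mulrCA; congr (_ * _).
apply: (mulIf (LQ_neq0 qL)); rewrite divfK ?LQ_neq0 //.
by rewrite -natrM -expnMn mulnC divnK.
Qed.

Lemma mean_hits : \sum_(x <- sample_box) hits x =
  (L ^ Q)%N%:R * \sum_(q < T | (0 < q)%N) hit_density q.
Proof.
rewrite exchange_big mulr_sumr; apply: eq_bigr => q q0.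
rewrite hit_densityE ?L_dvd' // exchange_big /=.
under eq_bigr => b _.
  rewrite sum_sample_class; last by apply: dvdn_div; rewrite L_dvd'.
  over.
by rewrite big_const_seq count_predT iter_addr_0 target_size divLK ?L_dvd' // mulr_natl.
Qed.

(** A discarded hit satisfies one of the finer congruences modulo [L %/ q * m] with m > M0. A union
    bound over m applies, and each refinement divides the proportion of a class by m^Q. *)
Lemma mean_nonprimitive_hits :
  \sum_(x <- sample_box) (hits x - primitive_hits x) <=
  (L ^ Q)%N%:R * \sum_(q < T | (0 < q)%N) (hit_density q *
     \sum_(m <- divisors q | (M0 < m)%N) ((m ^ Q)%N%:R)^-1).
Proof.
apply: (@le_trans _ _ (\sum_(q < T | (0 < q)%N) \sum_(b <- target_box q)
   \sum_(m <- divisors q | (M0 < m)%N) \sum_(x <- sample_box) (E (L %/ q * m)%N x b)%:R)).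
  under eq_bigr => x _ do rewrite /hits /primitive_hits -sumrB.
  rewrite exchange_big /=; apply: ler_sum => q q0.
  under eq_bigr => x _ do rewrite -sumrB.
  rewrite exchange_big /=; apply: ler_sum => b _.
  rewrite exchange_big /=; apply: ler_sum => x _.
  rewrite -big_filter sum_nat_of_bool /primitive_hit.
  case: (E (L %/ q) x b) => /=; last by rewrite subr0.
  case: allP => [_|]; first by rewrite subrr.
  move=> /allP; rewrite -has_predC has_count subr0 ler1n => h.
  apply: leq_trans h _; rewrite leq_eqVlt; apply/orP; left; apply/eqP.
  by apply: eq_count => m /=; rewrite negbK.
rewrite mulr_sumr; apply: ler_sum => q q0.
have qL := L_dvd' q0.
rewrite mulrA hit_densityE // exchange_big mulr_sumr /=.
rewrite big_seq_cond [leRHS]big_seq_cond; apply: ler_sum => m /andP[mq _].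
have {}mq : (m %| q)%N by rewrite dvdn_divisors.
have m0 := dvdn_gt0 q0 mq.
have qmL : (L %/ q * m %| L)%N.
  by rewrite -[X in (_ %| X)%N](divnK qL) dvdn_pmul2l ?divL_gt0.
under eq_bigr => b _ do rewrite sum_sample_class //.
rewrite big_const_seq count_predT iter_addr_0 target_size -mulrA mulr_natl.
rewrite -[leLHS]mulr_natl -[leRHS]mulr_natl ler_wpM2l //.
rewrite divnMA divLK // ler_pdivlMr ?ltr0n ?expn_gt0 ?m0 //.
by rewrite -natrM -expnMn divnK.
Qed.

Definition hit_pair q k : R := \sum_(x <- sample_box)
  (\sum_(b <- target_box q) (primitive_hit q x b)%:R) *
  (\sum_(b <- target_box k) (primitive_hit k x b)%:R).

Let lcmn_divL q k : (0 < q)%N -> (0 < k)%N -> (q %| L)%N -> (k %| L)%N ->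
  (lcmn (L %/ q) (L %/ k) * gcdn q k = L)%N.
Proof.
move=> q0 k0 qL kL.
have h := muln_lcm_gcd (L %/ q) (L %/ k).
have h1 := gcdn_divn q0 k0 qL kL.
apply/eqP; rewrite -(eqn_pmul2r L_gt0) -mulnA [(gcdn q k * L)%N]mulnC -h1.
by rewrite mulnA h mulnACA !divnK.
Qed.

(** In direction j the target box is covered by at most 1 + 2 rad / g^(deg j) cells, and each cell
    contains at most one point of the class. The subtracted 1 is the point [b'] itself. *)
Let count_target_class g q b' : (0 < g)%N -> b' \in target_box q ->
  (count (fun b => (b != b') && E g b b') (target_box q))%:R
   <= \prod_j (1 + (2 * rad q j)%:R / (g ^ deg j)%:R) - 1 :> R.
Proof.
move=> g0 b'q.
pose K j := (2 * rad q j %/ g ^ deg j).+1.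
have hK : (size [seq b <- target_box q | E g b b'] <= \prod_j K j)%N.
  apply: (pack_int_box HE g0 (lo := fun j => - (rad q j)%:Z)).
  - exact/filter_uniq/int_box_uniq.
  - move=> x y; rewrite !mem_filter => /andP[xb _] /andP[yb _].
    exact: (congr_trans HE) xb (congr_sym HE _ yb).
  move=> x; rewrite mem_filter mem_int_box => /andP[_ /forallP xq] j.
  have /andP[-> /= x2] := xq j; apply: lt_le_trans x2 _; rewrite lerD2l lez_nat.
  by rewrite ltn_ceil // expn_gt0 g0.
have h1 : (count (fun b => (b != b') && E g b b') (target_box q) < \prod_j K j)%N.
  have b'E : b' \in [seq b <- target_box q | E g b b'] by rewrite mem_filter (congr_refl HE).
  apply: leq_trans hK; rewrite -size_filter (@filter_predI _ (predC1 b')).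
  rewrite -rem_filter ?filter_uniq ?int_box_uniq // size_rem // prednK //.
  by case: [seq _ <- _ | _] b'E.
rewrite lerBrDr natr1; apply: (@le_trans _ _ (\prod_j K j)%N%:R).
  by rewrite ler_nat.
rewrite natr_prod; apply: ler_prod => j _; rewrite ler0n /K -natr1 addrC lerD2l /=.
by rewrite ler_pdivlMr ?ltr0n ?expn_gt0 ?g0 // -natrM ler_nat leq_divM.
Qed.

(** If x hits b for q and b' for k, then b and b' are congruent modulo g = gcd(L/q, L/k), and each
    such pair is hit by at most e^Q sample points, e = gcd(q, k). It remains to count the pairs:
    those with b <> b' by [count_target_class], those with b = b' through primitivity. The full
    product of the [u j] is the uncorrelated main term. *)
Lemma hit_pair_le (q k : 'I_T) : (0 < q <= k)%N ->
  let k' := (k %/ gcdn q k)%N in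
  let u j : R := (2 * rad q j)%:R / (gcdn (L %/ q) (L %/ k) ^ deg j)%:R in
  hit_pair q k <= (L ^ Q)%N%:R * (hit_density q * hit_density k +
    hit_density k / (k' ^ Q)%N%:R *
      (\prod_j (1 + u j) - 1 - \prod_j u j + (k' <= M0)%N%:R)).
Proof.
move=> /andP[q0 qk]; lazy zeta.
set k' := (k %/ gcdn q k)%N.
set u := fun j => _ / (gcdn _ _ ^ _)%:R.
have k0 : (0 < k)%N by apply: leq_trans qk.
have [qL kL] := (L_dvd' q0, L_dvd' k0).
set g := gcdn _ _ in u *; set e := gcdn q k in k' *.
have g0 : (0 < g)%N by rewrite gcdn_gt0 divL_gt0.
have e0 : (0 < e)%N by rewrite gcdn_gt0 q0.
have ke : (k' * e = k)%N by rewrite divnK // dvdn_gcdr.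
have k'0 : (0 < k')%N by rewrite -(@ltn_pmul2r e) // ke mul0n.
have k'k : (k' %| k)%N by apply/dvdnP; exists e; rewrite mulnC ke.
have gE := gcdn_divn q0 k0 qL kL; rewrite -/g -/e in gE.
have lE := lcmn_divL q0 k0 qL kL; rewrite -/e in lE.
(* The radii decrease with the denominator, so a target for k can serve as the centre b' when
   targets for q are counted. *)
have sub_kq b : b \in target_box k -> b \in target_box q.
  rewrite !mem_int_box => /forallP bk; apply/forallP => j; have := bk j.
  have : (rad k j <= rad q j)%N by apply: rad_decr; rewrite ?q0.
  lia.
have pos_e : (L %/ lcmn (L %/ q) (L %/ k) = e)%N.
  by rewrite -[X in (X %/ _)%N]lE mulKn // lcmn_gt0 !divL_gt0.
have off b b' : \sum_(x <- sample_box) (E (L %/ q) x b && E (L %/ k) x b')%:R <=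
    (E g b b')%:R * (e ^ Q)%N%:R :> R.
  have [bb|/negP bb] := boolP (E g b b').
    by rewrite mul1r -pos_e sum_sample_class2 // dvdn_div.
  rewrite mul0r big1 // => x _; case: andP => // -[xb xb']; case: bb.
  apply: (congr_trans HE g0 (congr_sym HE g0 _) (congr_dvd HE _ (dvdn_gcdr _ _) xb')); rewrite ?divL_gt0 //.
  by apply: (congr_dvd HE _ (dvdn_gcdl _ _) xb); rewrite divL_gt0.
(* If the same b is hit for q and k, then x is congruent to b modulo the lcm, which equals
   [L %/ k * k']. So (k, b) repeats by the factor k', which primitivity excludes when k' > M0. *)
have diag b : \sum_(x <- sample_box) (primitive_hit q x b && primitive_hit k x b)%:R
   <= (k' <= M0)%N%:R * (e ^ Q)%N%:R :> R.
  case: leqP => k'M.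
    rewrite mul1r -pos_e.
    apply: le_trans (sum_sample_class2 b b (dvdn_div qL) (dvdn_div kL)).
    by apply: ler_sum => x _; apply: ler_nat_of_bool => /andP[/andP[-> _] /andP[-> _]].
  rewrite mul0r big1 // => x _.
  case: andP => // -[/andP[xq _] /andP[xk /allP /(_ k')]].
  rewrite mem_filter k'M -dvdn_divisors // k'k => /(_ isT) /negP[].
  have -> : (L %/ k * k' = lcmn (L %/ q) (L %/ k))%N.
    by apply/eqP; rewrite -(eqn_pmul2r e0) -mulnA ke lE divnK.
  by apply: (congr_lcm HE); rewrite ?divL_gt0.
have hk : (L ^ Q)%N%:R * (hit_density k / (k' ^ Q)%N%:R) =
   (\prod_j (2 * rad k j).+1)%N%:R * (e ^ Q)%N%:R.
  rewrite mulrA hit_densityE // -mulrA; congr (_ * _).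
  by rewrite -ke expnMn natrM mulrAC mulfV ?mul1r // pnatr_eq0 expn_eq0 negb_and -lt0n k'0.
(* The full product is absorbed by the product of the densities, up to replacing [2 * rad q j] by
   its successor. *)
have hqk : (L ^ Q)%N%:R * (hit_density k / (k' ^ Q)%N%:R) * \prod_j u j <=
  (L ^ Q)%N%:R * (hit_density q * hit_density k).
  rewrite hk [X in _ <= _ * X]mulrC mulrA hit_densityE // /u.
  rewrite big_split /= -natr_prod prodfV -natr_prod prod_expn.
  rewrite -!mulrA ler_wpM2l // /hit_density.
  have -> : (e ^ Q)%:R = (k ^ Q)%N%:R / ((L %/ q) ^ Q)%N%:R * (g ^ Q)%N%:R :> R.
    apply: (mulIf (LQ_neq0 qL)); rewrite mulrAC divfK ?LQ_neq0 //.
    rewrite -!natrM -!expnMn; congr (_ ^ _)%N%:R.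
    apply/eqP; rewrite -(eqn_pmul2r q0) -mulnA divnK // mulnC -gE.
    by apply/eqP; ring.
  rewrite mulrACA mulfV ?pnatr_eq0 ?expn_eq0 ?negb_and -?lt0n ?g0 // mulr1.
  rewrite -mulrA ler_wpM2l // mulrC ler_wpM2r ?invr_ge0 //.
  by rewrite ler_nat leq_prod.
apply: (@le_trans _ _ ((L ^ Q)%N%:R * (hit_density k / (k' ^ Q)%N%:R) *
      (\prod_j (1 + u j) - 1 + (k' <= M0)%N%:R))); last first.
  rewrite [leRHS]mulrDr [X in _ <= _ + X]mulrA.
  have -> : \prod_j (1 + u j) - 1 - \prod_j u j + (k' <= M0)%N%:R =
    \prod_j (1 + u j) - 1 + (k' <= M0)%N%:R - \prod_j u j by ring.
  by rewrite [X in _ <= _ + X]mulrBr addrCA lerDl subr_ge0.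
rewrite hk -mulrA mulr_natl.
rewrite -target_size -(@iter_addr_0 R) -(count_predT (target_box k)) -big_const_seq.
under [X in X <= _]eq_bigr => x _ do rewrite mulr_sumr.
rewrite exchange_big big_seq [leRHS]big_seq; apply: ler_sum => b' b'k.
under eq_bigr => x _ do rewrite mulr_suml.
rewrite exchange_big /=.
apply: (@le_trans _ _ (\sum_(b <- target_box q)
  (((b != b') && E g b b')%:R * (e ^ Q)%N%:R + (b == b')%:R * ((k' <= M0)%N%:R * (e ^ Q)%N%:R)))).
  apply: ler_sum => b _; have [->|bb] := eqVneq b b'.
    rewrite /= mul0r add0r mul1r; apply: le_trans (diag b').
    by apply: ler_sum => x _; rewrite -natrM mulnb.
  rewrite mul0r addr0 andTb; apply: le_trans (off b b').
  apply: ler_sum => x _; rewrite -natrM mulnb.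
  by apply: ler_nat_of_bool => /andP[/andP[-> _] /andP[-> _]].
rewrite big_split -!mulr_suml /= mulrDr; apply: lerD.
  by rewrite mulrC ler_wpM2l // sum_nat_of_bool count_target_class // sub_kq.
rewrite [leRHS]mulrC ler_piMl ?mulr_ge0 //.
by rewrite sum_nat_of_bool count_uniq_mem ?int_box_uniq // lern1 leq_b1.
Qed.

End SecondMoment.

Section PairSums.
Variables (R : realFieldType) (T : nat).

(** Capping at k yields an ordinal for every m without a side condition; it is used only for m <= k,
    where it has value m. *)
Definition ord_min (k : 'I_T) (m : nat) : 'I_T :=
  Ordinal (leq_ltn_trans (geq_minr m k) (ltn_ord k)).

Lemma ord_minE (k : 'I_T) m : (m <= k)%N -> ord_min k m = m :> nat.
Proof. by move=> mk; apply/minn_idPl. Qed.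

Lemma card_ord_le (M : nat) : (#|[pred k : 'I_T | (0 < k <= M)%N]| <= M)%N.
Proof.
rewrite cardE -(size_map val) -[X in (_ <= X)%N](size_iota 1).
apply: uniq_leq_size; first by rewrite (map_inj_uniq val_inj) enum_uniq.
by move=> _ /mapP[q qP ->]; move: qP; rewrite mem_enum mem_iota add1n ltnS.
Qed.

(* A pair q <= k is determined by e = gcd(q, k), k' = k / e and q' = q / e <= k'. *)
Lemma sum_gcd_pairs (F : 'I_T -> 'I_T -> R) (g : nat -> nat -> R) :
  (forall e k, 0 <= g e k) ->
  (forall q k : 'I_T, (0 < q <= k)%N -> F q k <= g (gcdn q k) (k %/ gcdn q k)%N) ->
  \sum_(q < T) \sum_(k < T | (0 < q <= k)%N) F q k <=
  \sum_(e < T | (0 < e)%N) \sum_(k < T | (0 < k)%N) k%:R * g e k.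
Proof.
move=> g0 Fg; rewrite pair_big_dep /=.
(* The triples are ((e, k'), q'). As [g] does not depend on q', summing over the at most k' values
   of q' produces the weight k'. *)
pose P' (p : 'I_T * 'I_T * 'I_T) := [&& (0 < p.1.1)%N, (0 < p.1.2)%N & (0 < p.2 <= p.1.2)%N].
have [h hE] : exists h : 'I_T * 'I_T -> 'I_T * 'I_T * 'I_T, forall p : 'I_T * 'I_T, (0 < p.1 <= p.2)%N ->
    [/\ (h p).1.1 = gcdn p.1 p.2 :> nat, (h p).1.2 = (p.2 %/ gcdn p.1 p.2)%N :> nat
      & (h p).2 = (p.1 %/ gcdn p.1 p.2)%N :> nat].
  exists (fun p : 'I_T * 'I_T => let e := gcdn p.1 p.2 in
    (ord_min p.2 e, ord_min p.2 (p.2 %/ e)%N, ord_min p.2 (p.1 %/ e)%N)) => p.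
  move=> /andP[q0 qk]; split; apply: ord_minE.
  - by apply: (leq_trans _ qk); rewrite dvdn_leq // dvdn_gcdl.
  - exact: leq_div.
  - exact: leq_trans (leq_div _ _) qk.
apply: (@le_trans _ _ (\sum_(p | P' p) g p.1.1 p.1.2)).
  apply: (ler_sum_inj (h := h)) => [p p' pP p'P hpp|p pP|p pP|p _]; last exact: g0.
  - have [e1 e2 e3] := hE _ pP; have [f1 f2 f3] := hE _ p'P.
    move: f1 f2 f3; rewrite -hpp e1 e2 e3 => f1 f2 f3.
    rewrite [p]surjective_pairing [p']surjective_pairing; congr pair; apply: val_inj.
      by rewrite /= -(divnK (dvdn_gcdl p.1 p.2)) -(divnK (dvdn_gcdl p'.1 p'.2)) f3 f1.
    by rewrite /= -(divnK (dvdn_gcdr p.1 p.2)) -(divnK (dvdn_gcdr p'.1 p'.2)) f2 f1.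
  - have [e1 e2 e3] := hE _ pP; move: pP => /andP[q0 qk].
    rewrite /P' e1 e2 e3; have e0 : (0 < gcdn p.1 p.2)%N by rewrite gcdn_gt0 q0.
    have le1 := dvdn_leq q0 (dvdn_gcdl p.1 p.2).
    by rewrite e0 !divn_gt0 // le1 (leq_trans le1 qk) leq_div2r.
  - have [e1 e2 _] := hE _ pP; rewrite e1 e2; apply: Fg => //.
rewrite [leRHS]pair_big /=.
have -> : \sum_(p | P' p) g p.1.1 p.1.2 =
    \sum_(p : 'I_T * 'I_T | (0 < p.1)%N && (0 < p.2)%N)
      \sum_(q : 'I_T | (0 < q <= p.2)%N) g p.1 p.2.
  by rewrite pair_big_dep; apply: eq_bigl => p; rewrite /P' andbA.
apply: ler_sum => p _; rewrite sumr_const -[leLHS]mulr_natl ler_wpM2r // ler_nat.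
exact: card_ord_le.
Qed.
End PairSums.

(** * Few sample points have a hit count far from the mean *)

Section Deviation.
Variables (R : realFieldType) (n : nat) (deg : 'I_n -> nat).
Hypotheses (n_gt0 : (0 < n)%N) (deg_gt0 : forall j, (0 < deg j)%N).
Let Q := (\sum_j deg j)%N.
Variable v : nat -> R.
Hypothesis v_gt0 : forall q, (0 < q)%N -> 0 < v q.
Hypothesis vE : forall q, (0 < q)%N -> v q ^+ Q = q%:R^-1.

Variable E : nat -> rel 'rV[int]_n.
Hypothesis HE : congruence_family deg E.

Variables (L T M0 : nat) (rad : nat -> 'I_n -> nat) (a : 'I_n -> int).
Hypothesis L_gt0 : (0 < L)%N.
Hypothesis M0_gt0 : (0 < M0)%N.
Hypothesis T_gt1 : (1 < T)%N.
Hypothesis L_dvd : forall q, (0 < q < T)%N -> (q %| L)%N.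
Hypothesis rad_decr : forall q k j, (0 < q <= k)%N -> (k < T)%N -> (rad k j <= rad q j)%N.
Variables (c1 c2 A : R).
Hypotheses (c1_gt0 : 0 < c1) (A_ge1 : 1 <= A).
Hypothesis rad_le : forall q j, (0 < q < T)%N ->
  (rad q j)%:R <= A * ((L %/ q)%N%:R * v q) ^+ deg j.
Hypothesis density_ge : forall q, (0 < q < T)%N -> c1 / q%:R <= hit_density R deg L rad q.
Hypothesis density_le : forall q, (0 < q < T)%N -> hit_density R deg L rad q <= c2 / q%:R.

Notation mu := (hit_density R deg L rad).
Notation H := (harmonic_sum R T).
Let LQ : R := (L ^ Q)%N%:R.
(** The constant of [prod_offdiag_le] with 2A in place of A, because [u j] involves
    [2 * rad q j]. *)
Let C := (2 * (2 * A)) ^+ n.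

Let Q_gt0 : (0 < Q)%N.
Proof. by rewrite /Q (bigD1 (Ordinal n_gt0)) //= ltn_addr. Qed.

Let C_ge0 : 0 <= C.
Proof. by rewrite exprn_ge0 // !mulr_ge0 // (le_trans ler01). Qed.

Let c2_ge0 : 0 <= c2.
Proof.
have := le_trans (density_ge (q := 1) T_gt1) (density_le (q := 1) T_gt1).
by rewrite !divr1; apply: le_trans; apply: ltW.
Qed.

(** Since L/q = g k', the [u j] are at most 2A (k' v_q)^(deg j). For 0 < D < Q one has (k' v_q)^D <=
    k'^(Q-1) v_q, because k' >= 1 and v_q <= 1; division by k'^Q leaves v_q / k'. *)
Lemma hit_pair_bound (q k : 'I_T) : (0 < q <= k)%N ->
  let k' := (k %/ gcdn q k)%N in
  hit_pair R deg E L M0 rad a q k <= LQ * (mu q * mu k +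
    (c2 * C * (v q / (k%:R * k'%:R)) + c2 * ((k' <= M0)%N%:R / (k%:R * k'%:R)))).
Proof.
move=> qk; lazy zeta; have /andP[q0 qk'] := qk; have k0 := leq_trans q0 qk'.
have [qT kT] : (0 < q < T)%N /\ (0 < k < T)%N by rewrite q0 k0 /=.
set k' := (k %/ gcdn q k)%N.
apply: le_trans (hit_pair_le R HE M0 a L_gt0 L_dvd rad_decr qk) _.
pose u j : R := (2 * rad q j)%N%:R / (gcdn (L %/ q) (L %/ k) ^ deg j)%N%:R.
rewrite -[leLHS]/(LQ * (mu q * mu k + mu k / (k' ^ Q)%N%:R *
  (\prod_j (1 + u j) - 1 - \prod_j u j + (k' <= M0)%N%:R))) ler_wpM2l // lerD2l.
have e0 : (0 < gcdn q k)%N by rewrite gcdn_gt0 q0.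
have k'0 : (0 < k')%N by rewrite divn_gt0 // dvdn_leq // dvdn_gcdr.
have [qL kL] := (L_dvd qT, L_dvd kT).
have g0 : (0 < gcdn (L %/ q) (L %/ k))%N.
  by rewrite gcdn_gt0 divn_gt0 // dvdn_leq.
have gk' : (gcdn (L %/ q) (L %/ k) * k' = L %/ q)%N.
  apply/eqP; rewrite -(eqn_pmul2r q0) -(eqn_pmul2r e0) divnK // -(gcdn_divn q0 k0 qL kL).
  by rewrite -!mulnA; apply/eqP; congr (_ * _)%N; rewrite mulnCA divnK ?dvdn_gcdr.
have vq0 := ltW (v_gt0 q0); have vq1 := root_inv_le1 Q_gt0 v_gt0 vE q0.
have k'1 : 1 <= k'%:R :> R by rewrite ler1n.
have k'R : 0 < k'%:R :> R by rewrite ltr0n.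
have kR : 0 < k%:R :> R by rewrite ltr0n.
have off : \prod_j (1 + u j) - 1 - \prod_j u j <= C * (k'%:R ^+ Q.-1 * v q).
  apply: (prod_offdiag_le deg_gt0 n_gt0 (w := k'%:R * v q)).
  - by apply: le_trans A_ge1 _; rewrite ler_peMl ?ler1n // (le_trans ler01).
  - by rewrite mulr_ge0.
  - move=> j; rewrite divr_ge0 //= /u natrM -!mulrA ler_wpM2l // natrX.
    rewrite ler_pdivrMr ?exprn_gt0 ?ltr0n // -mulrA -exprMn.
    apply: le_trans (rad_le j qT) _; rewrite le_eqVlt; apply/orP; left; apply/eqP.
    by rewrite -[in LHS]gk' natrM; congr (_ * _ ^+ _); ring.
  - move=> D /andP[D0 DQ]; rewrite exprMn ler_pM ?exprn_ge0 //.
      by rewrite ler_weXn2l // -ltnS prednK.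
    by rewrite -[leRHS]expr1 ler_wiXn2l.
  - by rewrite mulr_ge0 ?exprn_ge0.
apply: (@le_trans _ _ (c2 / k%:R / (k' ^ Q)%N%:R *
   (C * (k'%:R ^+ Q.-1 * v q) + (k' <= M0)%N%:R))).
  apply: (@le_trans _ _ (mu k / (k' ^ Q)%N%:R *
     (C * (k'%:R ^+ Q.-1 * v q) + (k' <= M0)%N%:R))).
    rewrite ler_wpM2l ?lerD2r // divr_ge0 //.
    by apply: le_trans (density_ge kT); rewrite divr_ge0 // ltW.
  apply: ler_wpM2r.
    by apply: addr_ge0 => //; apply: mulr_ge0 => //; apply: mulr_ge0 => //; apply: exprn_ge0.
  by apply: ler_wpM2r; [rewrite invr_ge0|apply: density_le].
have QE : (k' ^ Q)%N%:R = k'%:R * k'%:R ^+ Q.-1 :> R by rewrite natrX -exprS prednK.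
rewrite mulrDr; apply: lerD.
  rewrite QE le_eqVlt; apply/orP; left; apply/eqP.
  by field; rewrite ?expf_neq0 ?gt_eqF.
rewrite -!mulrA ler_wpM2l // invfM; set c := (k' <= M0)%N%:R.
rewrite mulrA mulrC ler_wpM2l // ler_wpM2l ?invr_ge0 //.
by rewrite lef_pV2 ?posrE ?ltr0n ?expn_gt0 ?k'0 // ler_nat -[X in (X <= _)%N]expn1 leq_pexp2l.
Qed.

Notation Y := (primitive_hits R E L T M0 rad).
Notation X := (hits R E L T rad).
Notation Z := (sample_box deg L a).
Let m := \sum_(q < T | (0 < q)%N) mu q.

Let H_ge0 : 0 <= H. Proof. exact: harmonic_sum_ge0. Qed.

Let gcdn_sqr q k :
  (gcdn q k)%:R * (k %/ gcdn q k)%N%:R ^+ 2 = k%:R * (k %/ gcdn q k)%N%:R :> R.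
Proof. by rewrite expr2 mulrA -natrM [X in X%:R * _]mulnC divnK ?dvdn_gcdr. Qed.

(** With e = gcd(q, k) the bounds v_q <= v_e and k k' = e k'^2 reduce the term to a function of (e,
    k'). The weight k' coming from q' leaves the product of the sums of v_e / e, which is bounded,
    and of 1 / k'. *)
Lemma sum_pair_main :
  \sum_(q < T) \sum_(k < T | (0 < q <= k)%N)
    v q / (k%:R * (k %/ gcdn q k)%N%:R) <= (1 + Q%:R) * H.
Proof.
pose g (e k : nat) : R := if (0 < e)%N then v e / (e%:R * k%:R ^+ 2) else 0.
apply: le_trans (sum_gcd_pairs (g := g) _ _) _.
- move=> e k; rewrite /g; case: ifP => // e0; rewrite divr_ge0 ?mulr_ge0 ?exprn_ge0 //.
  exact/ltW/v_gt0.
- move=> q k /andP[q0 qk]; have k0 := leq_trans q0 qk.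
  have e0 : (0 < gcdn q k)%N by rewrite gcdn_gt0 q0.
  have eq : (gcdn q k <= q)%N by rewrite dvdn_leq // dvdn_gcdl.
  rewrite /g e0 gcdn_sqr.
  by rewrite ler_wpM2r ?invr_ge0 ?mulr_ge0 // (root_inv_decr Q_gt0 v_gt0 vE) // e0.
apply: (@le_trans _ _ (\sum_(e < T | (0 < e)%N) \sum_(k < T | (0 < k)%N)
   v e / e%:R * k%:R^-1)).
  apply: ler_sum => e e0; apply: ler_sum => k k0; rewrite /g e0.
  rewrite le_eqVlt; apply/orP; left; apply/eqP; field.
  by rewrite !pnatr_eq0 -!lt0n e0 k0.
under eq_bigr => e _ do rewrite -mulr_sumr.
rewrite -mulr_suml ler_wpM2r //.
exact: (sum_root_inv Q_gt0 v_gt0 vE).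
Qed.

(** In the variables (e, k') the weighted term is at most 1/e, and k' takes at most M0 values. *)
Lemma sum_pair_diag :
  \sum_(q < T) \sum_(k < T | (0 < q <= k)%N)
    ((k %/ gcdn q k <= M0)%N%:R / (k%:R * (k %/ gcdn q k)%N%:R)) <= H * M0%:R.
Proof.
pose g (e k : nat) : R := (0 < k <= M0)%N%:R / (e%:R * k%:R ^+ 2).
apply: le_trans (sum_gcd_pairs (g := g) _ _) _.
- by move=> e k; rewrite /g divr_ge0 ?mulr_ge0 ?exprn_ge0.
- move=> q k /andP[q0 qk]; have k0 := leq_trans q0 qk.
  have e0 : (0 < gcdn q k)%N by rewrite gcdn_gt0 q0.
  rewrite /g gcdn_sqr.
  by rewrite divn_gt0 // [(gcdn q k <= k)%N]dvdn_leq // dvdn_gcdr.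
apply: (@le_trans _ _ (\sum_(e < T | (0 < e)%N) \sum_(k < T | (0 < k)%N)
   e%:R^-1 * (0 < k <= M0)%N%:R)).
  apply: ler_sum => e e0; apply: ler_sum => k k0; rewrite /g.
  have -> : k%:R * ((0 < k <= M0)%N%:R / (e%:R * k%:R ^+ 2)) =
     e%:R^-1 * (0 < k <= M0)%N%:R * k%:R^-1 :> R.
    by field; rewrite !pnatr_eq0 -!lt0n e0 k0.
  by rewrite ler_piMr ?mulr_ge0 ?invr_ge0 // invf_le1 ?ltr0n // ler1n.
under eq_bigr => e _ do rewrite -mulr_sumr.
rewrite -mulr_suml ler_wpM2l // -natr_sum ler_nat.
apply: leq_trans (card_ord_le T M0); rewrite -sum1_card big_mkcond [leqRHS]big_mkcond.
by apply: leq_sum => k _; rewrite inE; case: (0 < k)%N; case: (k <= M0)%N.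
Qed.

(** For q = r m the crude bound m^(-Q) <= 1/m already gives 1/(q m) = 1/(r m^2), so the double sum
    is bounded by a harmonic sum over r times a tail of the series of 1/m^2. *)
Lemma sum_nonprimitive : \sum_(q < T | (0 < q)%N) (mu q *
     \sum_(k <- divisors q | (M0 < k)%N) ((k ^ Q)%N%:R)^-1) <= c2 * (H / M0%:R).
Proof.
apply: (@le_trans _ _ (\sum_(q < T | (0 < q)%N) \sum_(k < T | (k %| q)%N && (M0 < k)%N)
   (c2 * ((q %/ k)%N%:R^-1 * k%:R ^- 2)))).
  apply: ler_sum => q q0; rewrite mulr_sumr.
  rewrite -(big_mkord (fun k => (k %| q)%N && (M0 < k)%N)
    (fun k => c2 * ((q %/ k)%N%:R^-1 * k%:R ^- 2))).
  rewrite -[leLHS]big_filter -[leRHS]big_filter.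
  rewrite (perm_big [seq k <- index_iota 0 T | (k %| q)%N && (M0 < k)%N]) /=; last first.
    apply: uniq_perm; rewrite ?filter_uniq ?divisors_uniq ?iota_uniq // => k.
    rewrite !mem_filter -dvdn_divisors // mem_index_iota leq0n /= andbC.
    case kq: (k %| q)%N; case: (M0 < k)%N; rewrite ?andbF //=; apply/esym.
    by rewrite ?andbT; apply: leq_ltn_trans (dvdn_leq q0 kq) (ltn_ord q).
  rewrite !big_filter; apply: ler_sum => k /andP[kq Mk].
  have k0 : (0 < k)%N by apply: leq_ltn_trans Mk.
  have qT : (0 < q < T)%N by rewrite q0 /=.
  apply: (@le_trans _ _ (c2 / q%:R * k%:R^-1)).
    apply: ler_pM; rewrite ?invr_ge0 //; last 2 first.
    - exact: density_le.
    - rewrite lef_pV2 ?posrE ?ltr0n ?expn_gt0 ?k0 //.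
      by rewrite ler_nat -[X in (X <= _)%N]expn1 leq_pexp2l.
    by apply: le_trans (density_ge qT); rewrite divr_ge0 // ltW.
  rewrite -mulrA ler_wpM2l // -{1}(divnK kq) natrM.
  rewrite le_eqVlt; apply/orP; left; apply/eqP; field.
  by rewrite !pnatr_eq0 -!lt0n k0 divn_gt0 // dvdn_leq.
rewrite pair_big_dep /=.
apply: (@le_trans _ _ (\sum_(p : 'I_T * 'I_T | (0 < p.1)%N && (M0 < p.2)%N)
   c2 * (p.1%:R^-1 * p.2%:R ^- 2))).
  have h_lt (p : 'I_T * 'I_T) : (p.1 %/ p.2 < T)%N by apply: leq_ltn_trans (leq_div _ _) (ltn_ord _).
  apply: (ler_sum_inj (h := fun p => (Ordinal (h_lt p), p.2))) => /=.
  - move=> p p' /andP[_ /andP[kq _]] /andP[_ /andP[kq' _]] hpp.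
    have e1 : (p.1 %/ p.2 = p'.1 %/ p'.2)%N := congr1 (fun x => val x.1) hpp.
    have e2 : p.2 = p'.2 := congr1 snd hpp.
    rewrite [p]surjective_pairing [p']surjective_pairing; congr pair; apply: val_inj => //=.
      by rewrite -(divnK kq) -(divnK kq') e1 e2.
    by rewrite e2.
  - move=> p /andP[q0 /andP[kq ->]]; rewrite andbT divn_gt0 ?(dvdn_gt0 _ kq) //.
    exact: dvdn_leq.
  - by [].
  - by move=> p _; rewrite !mulr_ge0 ?invr_ge0 ?exprn_ge0.
have -> : \sum_(p : 'I_T * 'I_T | (0 < p.1)%N && (M0 < p.2)%N)
   c2 * (p.1%:R^-1 * p.2%:R ^- 2) =
   \sum_(q : 'I_T | (0 < q)%N) \sum_(k : 'I_T | (M0 < k)%N) c2 * (q%:R^-1 * k%:R ^- 2).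
  by rewrite pair_big_dep.
under eq_bigr => q _ do rewrite -!mulr_sumr.
rewrite -mulr_sumr ler_wpM2l // -mulr_suml ler_wpM2l //.
exact: sum_inv_sqr.
Qed.

Lemma sum_primitive_sqr : \sum_(x <- Z) Y x ^+ 2 <=
  LQ * (m ^+ 2 + 2 * (c2 * C * ((1 + Q%:R) * H) + c2 * (H * M0%:R))).
Proof.
pose B (q k : nat) : R := c2 * C * (v q / (k%:R * (k %/ gcdn q k)%N%:R)) +
   c2 * ((k %/ gcdn q k <= M0)%N%:R / (k%:R * (k %/ gcdn q k)%N%:R)).
have B_ge0 q k : (0 < q)%N -> 0 <= B q k.
  by move=> q0; rewrite addr_ge0 // mulr_ge0 // ?mulr_ge0 // ?divr_ge0 // ?mulr_ge0 // ltW // v_gt0.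
have SB : \sum_(q < T) \sum_(k < T | (0 < q <= k)%N) B q k <=
   c2 * C * ((1 + Q%:R) * H) + c2 * (H * M0%:R).
  apply: le_trans (lerD (ler_wpM2l (mulr_ge0 c2_ge0 C_ge0) sum_pair_main)
    (ler_wpM2l c2_ge0 sum_pair_diag)).
  rewrite !mulr_sumr -big_split /=; apply: ler_sum => q _.
  by rewrite !mulr_sumr -big_split.
have YE : \sum_(x <- Z) Y x ^+ 2 = \sum_(q < T | (0 < q)%N) \sum_(k < T | (0 < k)%N)
    hit_pair R deg E L M0 rad a q k.
  under eq_bigr => x _.
    rewrite expr2 mulr_suml; under eq_bigr do rewrite mulr_sumr.
    over.
  rewrite exchange_big; apply: eq_bigr => q _; rewrite exchange_big; exact: eq_bigr.
have hit_sym q k : hit_pair R deg E L M0 rad a q k = hit_pair R deg E L M0 rad a k q.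
  by apply: eq_bigr => x _; rewrite mulrC.
rewrite YE.
(* Both indicators contain the diagonal q = k. This only counts nonnegative terms twice and makes
   the two halves equal by symmetry. *)
apply: (@le_trans _ _ (LQ * \sum_(q < T | (0 < q)%N) \sum_(k < T | (0 < k)%N)
   (mu q * mu k + ((q <= k)%N%:R * B q k + (k <= q)%N%:R * B k q)))).
  rewrite mulr_sumr; apply: ler_sum => q q0; rewrite mulr_sumr; apply: ler_sum => k k0.
  have [qk|kq] := leqP q k.
    have qk' : (0 < q <= k)%N by rewrite q0.
    apply: (le_trans (hit_pair_bound qk')).
    rewrite ler_wpM2l // lerD2l mul1r lerDl mulr_ge0 // B_ge0 //.
  have kq' : (0 < k <= q)%N by rewrite k0 ltnW.
  rewrite hit_sym; apply: (le_trans (hit_pair_bound kq')).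
  by rewrite ler_wpM2l // (ltnW kq) mulrC lerD2l mul1r mul0r add0r.
rewrite ler_wpM2l //.
under eq_bigr => q _ do rewrite big_split -mulr_sumr big_split /=.
rewrite big_split -mulr_suml -expr2 lerD2l big_split mulr_natl mulr2n /= lerD //.
  apply: le_trans SB; rewrite big_mkcond; apply: ler_sum => q _.
  case: ifP => q0; last by apply: sumr_ge0 => k /andP[].
  rewrite big_mkcond [leRHS]big_mkcond; apply: ler_sum => k _.
  rewrite /=; case: (leqP q k) => qk; rewrite ?mul1r ?mul0r; last by rewrite ?if_same ?lexx.
  by rewrite (leq_trans _ qk).
apply: le_trans SB; rewrite exchange_big big_mkcond; apply: ler_sum => k _.
case: ifP => k0; last by apply: sumr_ge0 => q /andP[].
rewrite big_mkcond [leRHS]big_mkcond; apply: ler_sum => q _.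
rewrite /=; case: (leqP k q) => qk; rewrite ?mul1r ?mul0r; last by rewrite ?if_same ?lexx.
by rewrite (leq_trans _ qk).
Qed.

Lemma hits_mean_bounds : c1 * H <= m <= c2 * H.
Proof.
by apply/andP; split; rewrite mulr_sumr; apply: ler_sum => q q0;
  [apply: density_ge | apply: density_le]; rewrite q0 /=.
Qed.

Lemma hits_deviation :
  (count (fun x => ~~ (m / 2 <= X x <= 3 * m)) Z)%:R <=
  LQ * ((8 * c2 * (C * (1 + Q%:R) + 1) / c1 ^+ 2 + 9 * c2 / c1) * (M0%:R / H + M0%:R^-1)).
Proof.
have H0 : 0 < H.
  rewrite /harmonic_sum (bigD1 (Ordinal T_gt1)) //= ltr_wpDr ?invr1 //.
  by apply: sumr_ge0 => q _; rewrite invr_ge0.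
have /andP[mH Hm] := hits_mean_bounds.
have m0 : 0 < m by apply: lt_le_trans mH; rewrite mulr_gt0.
have M0R : 0 < M0%:R :> R by rewrite ltr0n.
have LQ0 : 0 <= LQ by [].
have YX x : Y x <= X x.
  apply: ler_sum => q _; apply: ler_sum => b _; rewrite /primitive_hit.
  by case: (E _ _ _) => //=; case: all.
have SX : \sum_(x <- Z) X x = LQ * m.
  exact: (mean_hits R HE rad a L_gt0 L_dvd).
have SXY : \sum_(x <- Z) (X x - Y x) <= LQ * (c2 * (H / M0%:R)).
  apply: le_trans (mean_nonprimitive_hits R HE M0 rad a L_gt0 L_dvd) _.
  by rewrite ler_wpM2l // sum_nonprimitive.
have SY : LQ * m - LQ * (c2 * (H / M0%:R)) <= \sum_(x <- Z) Y x.
  by rewrite lerBlDl -SX -lerBlDr -sumrB.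
(* The deviation of Y is measured from the mean m of X; the difference of the two means costs the
   second term. *)
have S2 : \sum_(x <- Z) (Y x - m) ^+ 2 <=
    LQ * (2 * c2 * (C * (1 + Q%:R) + 1) * (H * M0%:R) + 2 * m * (c2 * (H / M0%:R))).
  have -> : \sum_(x <- Z) (Y x - m) ^+ 2 =
      \sum_(x <- Z) Y x ^+ 2 - 2 * m * \sum_(x <- Z) Y x + LQ * m ^+ 2.
    rewrite mulr_sumr -sumrB.
    have -> : LQ * m ^+ 2 = \sum_(x <- Z) m ^+ 2.
      by rewrite big_const_seq count_predT iter_addr_0 size_sample_box mulr_natl.
    by rewrite -big_split /=; apply: eq_bigr => x _; ring.
  have := sum_primitive_sqr; have M1 : 1 <= M0%:R :> R by rewrite ler1n.
  have : LQ * (2 * c2 * C * (1 + Q%:R) * H) <= LQ * (2 * c2 * C * (1 + Q%:R) * (H * M0%:R)).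
    rewrite ler_wpM2l // ler_wpM2l ?mulr_ge0 ?addr_ge0 //.
    by rewrite ler_peMr.
  have : 2 * m * (LQ * m - LQ * (c2 * (H / M0%:R))) <= 2 * m * \sum_(x <- Z) Y x.
    by rewrite ler_wpM2l // mulr_ge0 // ltW.
  by lra.
(* Y <= X. If X < m/2, then Y is further than m/2 from m. If X > 3m, then either Y > 2m, again far
   from m, or X - Y > m. Chebyshev handles Y, Markov handles X - Y. *)
have cheb : (count (fun x => ~~ (m / 2 <= X x <= 3 * m)) Z)%:R <=
    4 / m ^+ 2 * \sum_(x <- Z) (Y x - m) ^+ 2 + m^-1 * \sum_(x <- Z) (X x - Y x).
  rewrite -sum_nat_of_bool [X in _ <= X + _]mulr_sumr [X in _ <= _ + X]mulr_sumr.
  rewrite -big_split /=; apply: ler_sum => x _.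
  have yx := YX x; set y := Y x in yx *; set z := X x in yx *.
  have t1 : 0 <= 4 / m ^+ 2 * (y - m) ^+ 2 by rewrite mulr_ge0 ?sqr_ge0 // divr_ge0 ?sqr_ge0.
  have t2 : 0 <= m^-1 * (z - y) by rewrite mulr_ge0 ?subr_ge0 // invr_ge0 ltW.
  have [_|] := boolP (m / 2 <= z <= 3 * m); first by rewrite /= mulr0n addr_ge0.
  have far : m / 2 <= `|y - m| -> 1 <= 4 / m ^+ 2 * (y - m) ^+ 2.
    move=> hy; rewrite mulrAC ler_pdivlMr ?exprn_gt0 // mul1r.
    rewrite -(@real_normK _ (y - m)) ?num_real //.
    have : (m / 2) ^+ 2 <= `|y - m| ^+ 2 by rewrite lerXn2r ?nnegrE // divr_ge0 // ltW.
    lra.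
  rewrite negb_and -!ltNge => /orP[zm|zm].
    rewrite -[leLHS]addr0 lerD // far // distrC ger0_norm; lra.
  have [ym|ym] := leP y (2 * m).
    by rewrite -[leLHS]add0r lerD // mulrC ler_pdivlMr // mul1r; lra.
  by rewrite -[leLHS]addr0 lerD // far // ger0_norm; lra.
apply: (le_trans cheb).
have m20 : 0 <= 4 / m ^+ 2 by rewrite divr_ge0 // sqr_ge0.
have mi0 : 0 <= m^-1 by rewrite invr_ge0 ltW.
apply: (le_trans (lerD (ler_wpM2l m20 S2) (ler_wpM2l mi0 SXY))).
rewrite mulrCA [m^-1 * _]mulrCA -mulrDr ler_wpM2l //.
have K1 : 0 <= 8 * c2 * (C * (1 + Q%:R) + 1) by rewrite !mulr_ge0 ?addr_ge0 ?mulr_ge0 ?addr_ge0.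
have -> : 4 / m ^+ 2 * (2 * c2 * (C * (1 + Q%:R) + 1) * (H * M0%:R) + 2 * m * (c2 * (H / M0%:R)))
  + m^-1 * (c2 * (H / M0%:R)) =
  8 * c2 * (C * (1 + Q%:R) + 1) * (M0%:R / H) * (H / m) ^+ 2 + 9 * c2 * M0%:R^-1 * (H / m).
  by field; rewrite !gt_eqF.
have q1 : 0 <= M0%:R / H by rewrite divr_ge0.
have q2 : 0 <= M0%:R^-1 :> R by rewrite invr_ge0.
have Hm1 : H / m <= c1^-1 by rewrite ler_pdivrMr // mulrC ler_pdivlMr // mulrC.
have Hm0 : 0 <= H / m by rewrite divr_ge0 // ltW.
apply: (@le_trans _ _ (8 * c2 * (C * (1 + Q%:R) + 1) * (M0%:R / H) * c1^-1 ^+ 2 + 9 * c2 * M0%:R^-1 * c1^-1)).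
  apply: lerD; apply: ler_wpM2l => //.
  - exact: mulr_ge0.
  - by rewrite lerXn2r ?nnegrE ?invr_ge0 // ltW.
  - by apply: mulr_ge0 => //; apply: mulr_ge0.
have q3 : 0 <= 8 * c2 * (C * (1 + Q%:R) + 1) * c1^-1 ^+ 2 by rewrite mulr_ge0 // exprn_ge0 // invr_ge0 ltW.
have q4 : 0 <= 9 * c2 * c1^-1 by rewrite mulr_ge0 ?mulr_ge0 // invr_ge0 ltW.
have := mulr_ge0 q3 q2; have := mulr_ge0 q4 q1; rewrite exprVn; lra.
Qed.

End Deviation.

(** * Polynomial functions *)

Section PolynomialFunctions.
Variable R : realType.
Implicit Types F G : R -> R.

Definition poly_fun F := exists p : {poly R}, forall t, F t = p.[t].

Lemma poly_fun_cst c : poly_fun (fun=> c).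
Proof. by exists c%:P => t; rewrite hornerC. Qed.

Lemma poly_fun_id : poly_fun id.
Proof. by exists 'X => t; rewrite hornerX. Qed.

Lemma poly_funD F G : poly_fun F -> poly_fun G -> poly_fun (fun t => F t + G t).
Proof. by move=> [p pP] [q qP]; exists (p + q) => t; rewrite hornerD pP qP. Qed.

Lemma poly_funM F G : poly_fun F -> poly_fun G -> poly_fun (fun t => F t * G t).
Proof. by move=> [p pP] [q qP]; exists (p * q) => t; rewrite hornerM pP qP. Qed.

Lemma poly_funN F : poly_fun F -> poly_fun (fun t => - F t).
Proof. by move=> [p pP]; exists (- p) => t; rewrite hornerN pP. Qed.

Lemma poly_funX F k : poly_fun F -> poly_fun (fun t => F t ^+ k).
Proof. by move=> [p pP]; exists (p ^+ k) => t; rewrite horner_exp pP. Qed.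

Lemma poly_fun_sum (I : Type) (r : seq I) (P : pred I) (F : I -> R -> R) :
  (forall i, P i -> poly_fun (F i)) -> poly_fun (fun t => \sum_(i <- r | P i) F i t).
Proof.
move=> FP; elim: r => [|i r [p pP]].
  by exists 0 => t; rewrite big_nil horner0.
case Pi: (P i); last by exists p => t; rewrite big_cons Pi.
have [q qP] := FP i Pi; exists (q + p) => t.
by rewrite big_cons Pi hornerD qP pP.
Qed.

Lemma poly_fun0 (p : {poly R}) : (forall t, p.[t] = 0) -> p = 0.
Proof.
move=> p0; apply/eqP; apply: contraT => pn0.
have := max_poly_roots pn0 (rs := [seq k%:R | k <- iota 0 (size p)]).
rewrite size_map size_iota ltnn => -> //.
  by apply/allP => x _; rewrite /root p0.
by rewrite map_inj_uniq ?iota_uniq // => i j /eqP; rewrite eqr_nat => /eqP.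
Qed.

(** As polynomials, X^m (p - X q) = 0 forces p = X q. This extracts the lowest order term of an
    identity along a curve through the origin. *)
Lemma poly_fun_cancel F G m : poly_fun F -> poly_fun G ->
  (forall t, t ^+ m * F t = t ^+ m.+1 * G t) -> F 0 = 0.
Proof.
move=> [p pP] [q qP] h.
have /poly_fun0 : forall t, ('X^m * (p - 'X * q)).[t] = 0.
  by move=> t; rewrite !hornerE -pP -qP mulrBr h exprSr mulrA subrr.
move/eqP; rewrite mulf_eq0 expf_eq0 polyX_eq0 andbF subr_eq0 => /eqP pE.
by rewrite pP pE !hornerE.
Qed.

Lemma coef_eq0 K (c : nat -> R) : (forall t, \sum_(k < K) c k * t ^+ k = 0) ->
  forall k, (k < K)%N -> c k = 0.
Proof.
move=> h k kK; have /poly_fun0 /polyP /(_ k) : forall t, (\poly_(i < K) c i).[t] = 0.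
  by move=> t; rewrite horner_poly h.
by rewrite coef_poly kK coef0.
Qed.

Lemma coef2_eq0 K (c : nat -> nat -> R) :
  (forall s t, \sum_(a < K) \sum_(b < K) c a b * (s ^+ a * t ^+ b) = 0) ->
  forall a b, (a < K)%N -> (b < K)%N -> c a b = 0.
Proof.
move=> h a b aK bK; apply: (@coef_eq0 K (c a)) => // t.
apply: (@coef_eq0 K (fun a => \sum_(k < K) c a k * t ^+ k)) => // s.
rewrite -[RHS](h s t); apply: eq_bigr => i _; rewrite mulr_suml.
by apply: eq_bigr => j _; rewrite -mulrA [t ^+ _ * _]mulrC.
Qed.

Variable N : nat.
Implicit Types f g : ('I_N -> R) -> R.

(** The bound on [f] itself is carried along because the Lipschitz constant of a product depends on
    it. *)
Definition loc_lipschitz f := forall M : R, exists K : R, forall x y D,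
  (forall i, `|x i| <= M) -> (forall i, `|y i| <= M) -> 0 <= D ->
  (forall i, `|x i - y i| <= D) -> `|f x| <= K /\ `|f x - f y| <= K * D.

Lemma loc_lipschitz_cst c : loc_lipschitz (fun=> c).
Proof. by move=> M; exists `|c| => x y D _ _ D0 _; rewrite subrr normr0 mulr_ge0. Qed.

Lemma loc_lipschitz_coord i : loc_lipschitz (fun x => x i).
Proof.
move=> M; exists (Num.max M 1) => x y D xM _ D0 xy; split.
  by apply: le_trans (xM i) _; rewrite le_max lexx.
by apply: le_trans (xy i) _; rewrite ler_peMl // le_max lexx orbT.
Qed.

Lemma loc_lipschitzD f g : loc_lipschitz f -> loc_lipschitz g ->
  loc_lipschitz (fun x => f x + g x).
Proof.
move=> fL gL M; have [K KP] := fL M; have [K' K'P] := gL M; exists (K + K') => x y D xM yM D0 xy.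
have [a1 a2] := KP x y D xM yM D0 xy; have [b1 b2] := K'P x y D xM yM D0 xy; split.
  exact: le_trans (ler_normD _ _) (lerD a1 b1).
by rewrite opprD addrACA mulrDl; apply: le_trans (ler_normD _ _) (lerD a2 b2).
Qed.

Lemma loc_lipschitzM f g : loc_lipschitz f -> loc_lipschitz g ->
  loc_lipschitz (fun x => f x * g x).
Proof.
move=> fL gL M; have [K KP] := fL M; have [K' K'P] := gL M.
exists (K * K' *+ 2) => x y D xM yM D0 xy.
have [a1 a2] := KP x y D xM yM D0 xy; have [b1 b2] := K'P x y D xM yM D0 xy.
have yy i : `|y i - y i| <= D by rewrite subrr normr0.
have [c1 _] := KP y y D yM yM D0 yy.
have K0 : 0 <= K by apply: le_trans a1; rewrite normr_ge0.
have K'0 : 0 <= K' by apply: le_trans b1; rewrite normr_ge0.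
split.
  rewrite normrM; apply: le_trans (ler_pM _ _ a1 b1) _; rewrite ?normr_ge0 //.
  by rewrite mulr2n lerDl mulr_ge0.
have -> : f x * g x - f y * g y = (f x - f y) * g x + f y * (g x - g y) by ring.
apply: le_trans (ler_normD _ _) _; rewrite !normrM mulr2n mulrDl.
apply: lerD; [apply: le_trans (ler_pM _ _ a2 b1) _|apply: le_trans (ler_pM _ _ c1 b2) _];
  rewrite ?normr_ge0 // ?mulrA //.
by rewrite mulrAC.
Qed.

Lemma loc_lipschitz_sum (I : Type) (r : seq I) (P : pred I) (F : I -> ('I_N -> R) -> R) :
  (forall i, P i -> loc_lipschitz (F i)) ->
  loc_lipschitz (fun x => \sum_(i <- r | P i) F i x).
Proof.
move=> FP; elim: r => [|i r IH].
  by under eq_fun do rewrite big_nil; apply: loc_lipschitz_cst.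
under eq_fun do rewrite big_cons.
by case Pi: (P i) => //; apply: loc_lipschitzD => //; apply: FP.
Qed.

Variable p : mpoly N R.

(** Selecting monomials by a predicate lets a polynomial and its bihomogeneous parts share the same
    regularity lemmas. *)
Definition mono_sum (P : pred (multinom N)) (z : 'I_N -> R) : R :=
  \sum_(m <- msupp p | P m) mcoeff m p * \prod_i z i ^+ m i.

Lemma meval_mono_sum z : meval z p = mono_sum xpredT z.
Proof. exact: mevalE. Qed.

Lemma mono_sum_ind (Pf : (('I_N -> R) -> R) -> Prop) P :
  (forall c, Pf (fun=> c)) -> (forall i, Pf (fun x => x i)) ->
  (forall f g, Pf f -> Pf g -> Pf (fun x => f x + g x)) ->
  (forall f g, Pf f -> Pf g -> Pf (fun x => f x * g x)) -> Pf (mono_sum P).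
Proof.
move=> Pc Pi PD PM; rewrite /mono_sum; elim: (msupp p) => [|m r IH].
  by under eq_fun do rewrite big_nil.
under eq_fun do rewrite big_cons.
case: (P m) => //; apply: PD => //; apply: (PM) => //.
elim: (index_enum _) => [|i l IHl]; first by under eq_fun do rewrite big_nil.
under eq_fun do rewrite big_cons.
apply: (PM) => //; elim: (m i) => [|k IHk]; first by under eq_fun do rewrite expr0.
by under eq_fun do rewrite exprS; apply: PM.
Qed.

Lemma loc_lipschitz_mono_sum P : loc_lipschitz (mono_sum P).
Proof.
apply: mono_sum_ind => [c|i|f g|f g].
- exact: loc_lipschitz_cst.
- exact: loc_lipschitz_coord.
- exact: loc_lipschitzD.
- exact: loc_lipschitzM.
Qed.

Lemma poly_fun_mono_sum P (z : R -> 'I_N -> R) : (forall i, poly_fun (fun t => z t i)) ->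
  poly_fun (fun t => mono_sum P (z t)).
Proof.
move=> zP; apply: (@mono_sum_ind (fun f => poly_fun (fun t => f (z t)))) => [c|i|f g|f g] //.
- exact: poly_fun_cst.
- exact: poly_funD.
- exact: poly_funM.
Qed.

End PolynomialFunctions.

Section BihomogeneousParts.
Variables (R : realType) (n : nat) (p : mpoly (n + n) R).
Implicit Types x y : 'rV[R]_n.

Definition left_degree (m : multinom (n + n)) := (\sum_(k < n) m (lshift n k))%N.
Definition right_degree (m : multinom (n + n)) := (\sum_(k < n) m (rshift n k))%N.

Definition pair_eval x y : R := meval (fun k => (row_mx x y : 'rV[R]_(n + n)) 0 k) p.
Definition bipart a b x y : R :=
  mono_sum p (fun m => (left_degree m == a) && (right_degree m == b))
    (fun k => (row_mx x y : 'rV[R]_(n + n)) 0 k).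

Lemma bipart_split a b x y : bipart a b x y =
  \sum_(m <- msupp p | (left_degree m == a) && (right_degree m == b))
    mcoeff m p * ((\prod_(k < n) x 0 k ^+ m (lshift n k)) *
                  \prod_(k < n) y 0 k ^+ m (rshift n k)).
Proof.
apply: eq_bigr => m _; rewrite big_split_ord /=; congr (_ * (_ * _)).
  by apply: eq_bigr => k _; rewrite row_mxEl.
by apply: eq_bigr => k _; rewrite row_mxEr.
Qed.

Lemma mdeg_left_right m : mdeg m = (left_degree m + right_degree m)%N.
Proof. by rewrite mdegE big_split_ord. Qed.

Lemma pair_eval_bipart x y :
  pair_eval x y = \sum_(a < msize p) \sum_(b < msize p) bipart a b x y.
Proof.
rewrite /pair_eval meval_mono_sum.
under eq_bigr do rewrite (exchange_big_dep xpredT) //=.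
rewrite (exchange_big_dep xpredT) //=; rewrite /mono_sum big_seq [RHS]big_seq.
apply: eq_bigr => m /msize_mdeg_lt; rewrite mdeg_left_right => mp.
have lp : (left_degree m < msize p)%N by apply: leq_ltn_trans mp; apply: leq_addr.
have rp : (right_degree m < msize p)%N by apply: leq_ltn_trans mp; apply: leq_addl.
rewrite (bigD1 (Ordinal lp)) //= [X in _ = _ + X]big1 ?addr0 => [|a aP].
  rewrite (bigD1 (Ordinal rp)) ?eqxx //= [X in _ = _ + X]big1 ?addr0 // => b /andP[/eqP bE /eqP]; case.
  exact/val_inj.
rewrite big1 // => b /andP[/eqP aE _]; case/eqP: aP; exact/val_inj.
Qed.

Lemma bipartZ a b s t x y : bipart a b (s *: x) (t *: y) = s ^+ a * t ^+ b * bipart a b x y.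
Proof.
rewrite !bipart_split mulr_sumr; apply: eq_bigr => m /andP[/eqP <- /eqP <-].
have h (c : R) (z : 'rV[R]_n) (e : 'I_n -> nat) : \prod_(k < n) (c *: z) 0 k ^+ e k =
    c ^+ (\sum_(k < n) e k) * \prod_(k < n) z 0 k ^+ e k.
  under eq_bigr do rewrite mxE exprMn.
  by rewrite big_split /= prodrXr.
rewrite !h -/(left_degree m) -/(right_degree m); ring.
Qed.

Let deg1_prod (e : 'I_n -> nat) : (\sum_(k < n) e k == 1)%N ->
  exists k0, forall z : 'rV[R]_n, \prod_(k < n) z 0 k ^+ e k = z 0 k0.
Proof.
move=> /eqP e1; have /existsP[k0 ek0] : [exists k, e k != 0%N].
  rewrite -[X in is_true X]negbK negb_exists; apply/negP => /forallP h.
  by move: e1; rewrite big1 // => k _; apply/eqP; have := h k; rewrite negbK.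
move: e1; rewrite (bigD1 k0) //= => e1; exists k0 => z.
have e01 : e k0 = 1%N by move: ek0 e1; lia.
move: e1; rewrite e01 => /eqP; rewrite eqSS sum_nat_eq0 => /forallP h.
rewrite (bigD1 k0) //= e01 expr1 big1 ?mulr1 // => k kk0.
by have := h k; rewrite kk0 => /eqP ->.
Qed.

Lemma bipart_linear_r a c x y y' :
  bipart a 1 x (c *: y + y') = c * bipart a 1 x y + bipart a 1 x y'.
Proof.
rewrite !bipart_split mulr_sumr -big_split; apply: eq_bigr => m /andP[_ m1] /=.
by have [k0 h] := deg1_prod m1; rewrite !h !mxE; ring.
Qed.

Lemma bipart_linear_l b c x x' y :
  bipart 1 b (c *: x + x') y = c * bipart 1 b x y + bipart 1 b x' y.
Proof.
rewrite !bipart_split mulr_sumr -big_split; apply: eq_bigr => m /andP[m1 _] /=.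
by have [k0 h] := deg1_prod m1; rewrite !h !mxE; ring.
Qed.

Lemma poly_fun_bipart a b (X Y : R -> 'rV[R]_n) :
  (forall k, poly_fun (fun t => X t 0 k)) -> (forall k, poly_fun (fun t => Y t 0 k)) ->
  poly_fun (fun t => bipart a b (X t) (Y t)).
Proof.
move=> XP YP; apply: poly_fun_mono_sum => i.
case: (split_ordP i) => k ->; under eq_fun do rewrite ?row_mxEl ?row_mxEr; done.
Qed.

End BihomogeneousParts.

(** * Algebra of the group law *)

(* Eichler's argument for the Baker-Campbell-Hausdorff theorem: an additive
   2-cocycle that is homogeneous of degree m >= 3 and vanishes on lines is zero. *)
Lemma eichler_cocycle (R : realFieldType) (V : lmodType R) (f : V -> V -> R) (m : nat) :
  (forall x y z, f x y + f (x + y) z = f y z + f x (y + z)) ->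
  (forall x a b, f (a *: x) (b *: x) = 0) ->
  (forall t x y, f (t *: x) (t *: y) = t ^+ m * f x y) ->
  (2 < m)%N -> forall x y, f x y = 0.
Proof.
move=> coc line hom m3.
have f0r x : f x 0 = 0 by rewrite -{1}[x]scale1r -(scale0r x) line.
have f0l x : f 0 x = 0 by rewrite -{1}[x]scale1r -(scale0r x) line.
have fN x a : f x (a *: x) = 0 by rewrite -{1}[x]scale1r line.
have fN' x a : f (a *: x) x = 0 by rewrite -{2}[x]scale1r line.
have e1 x y : f x y = - f (x + y) (- y).
  have := coc x y (- y); rewrite subrr f0r -scaleN1r fN; lra.
have e2 x y : f x y = - f (- x) (x + y).
  have := coc (- x) x y; rewrite addNr f0l -scaleN1r fN'; lra.
pose c : R := 2^-1 ^+ m.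
pose h (x : V) := 2^-1 *: x.
have hh x : h x + h x = x by rewrite -scalerDl -[RHS]scale1r; congr (_ *: _); lra.
have hD x y : h (x + y) = h x + h y by rewrite /h scalerDr.
have hN x : h (- x) = - h x by rewrite /h scalerN.
have fh x y : f (h x) (h y) = c * f x y by rewrite hom.
have e3 x y : f x y = f x (h y) - f (x + y) (- h y).
  have := coc x y (- h y).
  have -> : y - h y = h y by rewrite -{1}(hh y) addrK.
  have -> : - h y = (- 2^-1) *: y by rewrite scaleNr.
  rewrite fN; lra.
have e4 x y : f x y = f (h x) y - f (- h x) (x + y).
  have := coc (- h x) x y.
  have -> : - h x + x = h x by rewrite -{2}(hh x) addKr.
  have -> : - h x = (- 2^-1) *: x by rewrite scaleNr.
  rewrite fN'; lra.
(* By [e2], [e1], [e2] in turn: f(x, y) = -f(-x, x + y) = f(y, -(x + y)) = -f(-y, -x). *)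
have anti x y : f x y = - (-1) ^+ m * f y x.
  rewrite (e2 x y) (e1 (- x)) opprK addKr (e2 y (- (x + y))).
  have -> : y + - (x + y) = - x by rewrite opprD addrCA subrr addr0.
  by rewrite -(scaleN1r x) -(scaleN1r y) hom mulNr.
(* Halving the first argument by [e4] and then the second by [e3] leaves only values at pairs of
   half vectors, which homogeneity turns into the factor c = 2^(-m). *)
have key x y : (1 - 2 * c) * f x y = c * (1 + (-1) ^+ m) * f (x + y) y.
  have t1 : f (h x) y = c * f x y + c * f (x + y) y.
    rewrite e3 fh (e1 _ (- h y)) opprK opprK.
    have -> : h x + y - h y = h (x + y) by rewrite hD -{1}(hh y) -addrA addrK.
    by rewrite fh.
  have t2 : f (- h x) (x + y) = - (c * f x y) + c * f y (x + y).
    rewrite e3 (e2 (- h x)) opprK.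
    have -> : - h x + h (x + y) = h y by rewrite hD addKr.
    rewrite fh (e1 _ (- h (x + y))) !opprK.
    have xy : - h x + (x + y) = h x + y by rewrite -{2}(hh x) -addrA addKr.
    rewrite xy.
    have -> : h x + y - h (x + y) = h y by rewrite hD opprD addrA [h x + y]addrC addrK -{1}(hh y) addrK.
    by rewrite fh.
  have := e4 x y; rewrite t1 t2 (anti y (x + y)); lra.
(* Here m >= 3 enters: it makes 1 - 2c and 1 - 4c nonzero. For m = 2 one has 1 - 4c = 0, which
   leaves room for the Lie bracket. *)
have c8 : 0 < c <= 8^-1.
  rewrite exprn_gt0 ?invr_gt0 //=.
  have -> : 8^-1 = 2^-1 ^+ 3 :> R by rewrite exprVn; congr (_ ^-1); ring.
  by rewrite ler_wiXn2l // invf_le1 ?ltr0n // ler1n.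
move=> x y; have := key x y; rewrite -signr_odd; case odd_m: (odd m) => /=.
  rewrite expr1 subrr mulr0 mul0r => /eqP; rewrite mulf_eq0 => /orP[/eqP|/eqP //]; lra.
rewrite expr0 => _.
(* For even m, applying this relation twice gives (1 - 2c)^2 f = 4 c^2 f, that is (1 - 4c) f = 0. *)
have k2 z w : (1 - 2 * c) * f z (- w) = - (2 * c) * f z w.
  have := key (z - w) w; rewrite -signr_odd odd_m expr0 subrK (e1 (z - w)) subrK; lra.
have a1 := k2 x y; have := k2 x (- y); rewrite opprK => a2.
have : (1 - 4 * c) * f x y = 0.
  have : (1 - 2 * c) * ((1 - 2 * c) * f x y) = - (2 * c) * ((1 - 2 * c) * f x (- y)).
    by rewrite a2; ring.
  rewrite a1; lra.
by move/eqP; rewrite mulf_eq0 => /orP[/eqP|/eqP //]; lra.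
Qed.

Section GroupAlgebra.
Variables (R : realType) (n s : nat) (deg : 'I_n -> nat) (pol : 'I_n -> mpoly (n + n) R).
Hypothesis G : carnot deg pol s.
Implicit Types x y z : 'rV[R]_n.
Local Notation "x ** y" := (gmul pol x y) (at level 40, left associativity).
Local Notation P j := (pair_eval (pol j)).

Lemma gmulE x y j : (x ** y) 0 j = x 0 j + y 0 j + P j x y.
Proof. by rewrite mxE. Qed.

Lemma gmulA x y z : x ** (y ** z) = x ** y ** z.
Proof. exact: (carnot_mulA G). Qed.

Lemma gmul0r x : x ** 0 = x.
Proof. by have := carnot_lines G x 1 0; rewrite scale0r scale1r addr0 scale1r. Qed.

Lemma gmul0l x : 0 ** x = x.
Proof. by have := carnot_lines G x 0 1; rewrite scale0r scale1r add0r scale1r. Qed.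

Lemma gmulrN x : x ** (- x) = 0.
Proof. by have := carnot_lines G x 1 (-1); rewrite scale1r scaleN1r subrr scale0r. Qed.

Lemma gmulNr x : (- x) ** x = 0.
Proof. by have := carnot_lines G x (-1) 1; rewrite scale1r scaleN1r addNr scale0r. Qed.

Lemma gmulKN x y : (- x) ** (x ** y) = y.
Proof. by rewrite gmulA gmulNr gmul0l. Qed.

Lemma gmulNK x y : x ** ((- x) ** y) = y.
Proof. by rewrite gmulA gmulrN gmul0l. Qed.

Lemma gmulK x y : x ** y ** (- y) = x.
Proof. by rewrite -gmulA gmulrN gmul0r. Qed.

Lemma gmulVK x y : x ** (- y) ** y = x.
Proof. by rewrite -gmulA gmulNr gmul0r. Qed.

Lemma gmulN x y : - (x ** y) = (- y) ** (- x).
Proof.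
have h : (x ** y) ** ((- y) ** (- x)) = 0 by rewrite gmulA gmulK gmulrN.
by rewrite -[RHS](gmulKN (x ** y)) h gmul0r.
Qed.

(** By [carnot_lower] the exponents of all coordinates of degree at least [deg j] vanish. This
    triangularity underlies every induction on the degree below. *)
Lemma mono_lower Pd j x x' y y' :
  (forall k, (deg k < deg j)%N -> x 0 k = x' 0 k) ->
  (forall k, (deg k < deg j)%N -> y 0 k = y' 0 k) ->
  mono_sum (pol j) Pd (fun k => (row_mx x y : 'rV[R]_(n + n)) 0 k) =
  mono_sum (pol j) Pd (fun k => (row_mx x' y' : 'rV[R]_(n + n)) 0 k).
Proof.
move=> xx' yy'; rewrite /mono_sum big_seq_cond [RHS]big_seq_cond.
apply: eq_bigr => m /andP[mj _].
congr (_ * _); rewrite !big_split_ord /=; congr (_ * _); apply: eq_bigr => k _;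
  rewrite ?row_mxEl ?row_mxEr.
  have [jk|kj] := leqP (deg j) (deg k); last by rewrite xx'.
  by have [-> _] := carnot_lower G mj jk; rewrite !expr0.
have [jk|kj] := leqP (deg j) (deg k); last by rewrite yy'.
by have [_ ->] := carnot_lower G mj jk; rewrite !expr0.
Qed.

Lemma P_lower j x x' y y' :
  (forall k, (deg k < deg j)%N -> x 0 k = x' 0 k) ->
  (forall k, (deg k < deg j)%N -> y 0 k = y' 0 k) -> P j x y = P j x' y'.
Proof. by move=> xx' yy'; rewrite /pair_eval !meval_mono_sum; apply: mono_lower. Qed.

Lemma P0r j x : P j x 0 = 0.
Proof.
have := gmulE x 0 j; rewrite gmul0r [X in _ + X + _]mxE; lra.
Qed.

Lemma P0l j x : P j 0 x = 0.
Proof.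
have := gmulE 0 x j; rewrite gmul0l [X in X + _ + _]mxE; lra.
Qed.

Lemma P_line j x a b : P j (a *: x) (b *: x) = 0.
Proof.
have := gmulE (a *: x) (b *: x) j; rewrite (carnot_lines G) scalerDl [LHS]mxE; lra.
Qed.

Lemma P_cocycle j x y z : P j x y + P j (x ** y) z = P j y z + P j x (y ** z).
Proof.
have : (x ** y ** z) 0 j = (x ** (y ** z)) 0 j by rewrite gmulA.
rewrite !gmulE; lra.
Qed.

(** A common strict bound on the degrees; the added 4 keeps degrees 0 to 3 in range, so that low
    order terms can be split off. *)
Definition hom_bound := (\max_j msize (pol j)).+4.
Local Notation K := hom_bound.
Local Notation bip j := (bipart (pol j)).

Lemma P_bip j x y : P j x y = \sum_(a < K) \sum_(b < K) bip j a b x y.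
Proof.
have jK : (msize (pol j) <= K)%N.
  by apply: (@leq_trans (\max_j msize (pol j))); [apply: leq_bigmax|rewrite /hom_bound; lia].
have big0 a b : ((msize (pol j) <= a) || (msize (pol j) <= b))%N -> bip j a b x y = 0.
  move=> ab; rewrite /bipart /mono_sum big_seq_cond big1 // => m /andP[/msize_mdeg_lt].
  rewrite mdeg_left_right => lt /andP[/eqP e1 /eqP e2]; lia.
rewrite pair_eval_bipart (big_ord_widen _ (fun a => \sum_(b < msize (pol j)) bip j a b x y) jK).
rewrite big_mkcond; apply: eq_bigr => a _; case: ltnP => aj; last first.
  by rewrite big1 // => b _; rewrite big0 // aj.
rewrite (big_ord_widen _ (fun b => bip j a b x y) jK) big_mkcond.
by apply: eq_bigr => b _; case: ltnP => // bj; rewrite big0 // bj orbT.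
Qed.

Lemma P_bipZ j s' t x y :
  P j (s' *: x) (t *: y) = \sum_(a < K) \sum_(b < K) bip j a b x y * (s' ^+ a * t ^+ b).
Proof.
by rewrite P_bip; apply: eq_bigr => a _; apply: eq_bigr => b _; rewrite bipartZ mulrC.
Qed.

Lemma bip_ge j a b x y : ((K <= a) || (K <= b))%N -> bip j a b x y = 0.
Proof.
have jK : (msize (pol j) <= K)%N.
  by apply: (@leq_trans (\max_j msize (pol j))); [apply: leq_bigmax|rewrite /hom_bound; lia].
move=> ab; rewrite /bipart /mono_sum big_seq_cond big1 // => m /andP[/msize_mdeg_lt].
rewrite mdeg_left_right => lt /andP[/eqP e1 /eqP e2]; lia.
Qed.

Lemma bip_r0 j a x y : bip j a 0 x y = 0.
Proof.
have [Ka|aK] := leqP K a; first by rewrite bip_ge // Ka.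
apply: (@coef_eq0 _ K (fun a => bip j a 0 x y)) => // t.
rewrite -[RHS](P0r j (t *: x)) -(scale0r y) P_bipZ; apply: eq_bigr => b _.
rewrite big_ord_recl /= expr0 mulr1 [X in _ = _ + X]big1 ?addr0 // => i _.
by rewrite /bump /= add1n expr0n /= !mulr0.
Qed.

Lemma bip_l0 j b x y : bip j 0 b x y = 0.
Proof.
have [Kb|bK] := leqP K b; first by rewrite bip_ge // Kb orbT.
apply: (@coef_eq0 _ K (fun b => bip j 0 b x y)) => // t.
rewrite -[RHS](P0l j (t *: y)) -(scale0r x) P_bipZ [RHS]big_ord_recl /=.
rewrite [X in _ = _ + X]big1 ?addr0; last first.
  by move=> i _; apply: big1 => b' _; rewrite /bump /= add1n expr0n /= mul0r mulr0.
by apply: eq_bigr => i _; rewrite expr0 mul1r.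
Qed.

Lemma bip_diag j a b x : bip j a b x x = 0.
Proof.
have [Ka|aK] := leqP K a; first by rewrite bip_ge // Ka.
have [Kb|bK] := leqP K b; first by rewrite bip_ge // Kb orbT.
by apply: (@coef2_eq0 _ K (fun a b => bip j a b x x)) => // u t; rewrite -P_bipZ P_line.
Qed.

(** Half of the Lie bracket: in exponential coordinates the product begins with x + y + [x, y]/2.
    The identification with the bracket of vector fields is [lieE]. *)
Definition half_lie x y : 'rV[R]_n := \row_j bip j 1 1 x y.

Lemma half_lie_linear_l c x x' y : half_lie (c *: x + x') y = c *: half_lie x y + half_lie x' y.
Proof. by apply/rowP => j; rewrite !mxE bipart_linear_l. Qed.

Lemma half_lie_linear_r c x y y' : half_lie x (c *: y + y') = c *: half_lie x y + half_lie x y'.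
Proof. by apply/rowP => j; rewrite !mxE bipart_linear_r. Qed.

Lemma half_lieDl x x' y : half_lie (x + x') y = half_lie x y + half_lie x' y.
Proof. by have := half_lie_linear_l 1 x x' y; rewrite !scale1r. Qed.

Lemma half_lieDr x y y' : half_lie x (y + y') = half_lie x y + half_lie x y'.
Proof. by have := half_lie_linear_r 1 x y y'; rewrite !scale1r. Qed.

Lemma half_lie0l y : half_lie 0 y = 0.
Proof. by apply: (addIr (half_lie 0 y)); rewrite -half_lieDl addr0 add0r. Qed.

Lemma half_lie0r x : half_lie x 0 = 0.
Proof. by apply: (addIr (half_lie x 0)); rewrite -half_lieDr addr0 add0r. Qed.

Lemma half_lieZl c x y : half_lie (c *: x) y = c *: half_lie x y.
Proof. by have := half_lie_linear_l c x 0 y; rewrite addr0 half_lie0l addr0. Qed.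

Lemma half_lieZr c x y : half_lie x (c *: y) = c *: half_lie x y.
Proof. by have := half_lie_linear_r c x y 0; rewrite addr0 half_lie0r addr0. Qed.

Lemma half_liexx x : half_lie x x = 0.
Proof. by apply/rowP => j; rewrite !mxE bip_diag. Qed.

Lemma half_lieC x y : half_lie x y = - half_lie y x.
Proof.
have := half_liexx (x + y); rewrite half_lieDl !half_lieDr !half_liexx add0r addr0.
by move/eqP; rewrite addr_eq0 => /eqP.
Qed.

Definition hom_part j k x y : R :=
  \sum_(a < K) \sum_(b < K | (a + b == k)%N) bip j a b x y.

Lemma hom_partZ j k t x y : hom_part j k (t *: x) (t *: y) = t ^+ k * hom_part j k x y.
Proof.
rewrite /hom_part mulr_sumr; apply: eq_bigr => a _; rewrite mulr_sumr.
by apply: eq_bigr => b /eqP <-; rewrite bipartZ exprD.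
Qed.

Lemma hom_part_line j k a b x : hom_part j k (a *: x) (b *: x) = 0.
Proof.
apply: big1 => i _; apply: big1 => i' _.
by rewrite bipartZ bip_diag mulr0.
Qed.

Lemma P_hom j x y : P j x y = \sum_(k < K + K) hom_part j k x y.
Proof.
rewrite P_bip /hom_part [RHS]exchange_big; apply: eq_bigr => a _ /=.
rewrite [RHS](exchange_big_dep xpredT) //=; apply: eq_bigr => b _.
have abK : (a + b < K + K)%N by have := ltn_ord a; have := ltn_ord b; lia.
by rewrite (big_pred1 (Ordinal abK)) // => i; rewrite eq_sym.
Qed.

Lemma hom_part_lt2 j k x y : (k < 2)%N -> hom_part j k x y = 0.
Proof.
move=> k2; apply: big1 => a _; apply: big1 => b /eqP ab.
have : (a == 0 :> nat)%N || (b == 0 :> nat)%N by lia.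
by case/orP => /eqP ->; rewrite ?bip_l0 ?bip_r0.
Qed.

Lemma hom_part2 j x y : hom_part j 2 x y = half_lie x y 0 j.
Proof.
have K1 : (1 < K)%N by [].
rewrite /hom_part (bigD1 (Ordinal K1)) //= [X in _ + X]big1 ?addr0.
  by rewrite (big_pred1 (Ordinal K1)) ?mxE.
move=> a a1; apply: big1 => b /eqP ab.
have {}a1 : a <> 1%N :> nat by move=> a1'; case/eqP: a1; apply: val_inj.
have : (a == 0 :> nat)%N || (b == 0 :> nat)%N by lia.
by case/orP => /eqP ->; rewrite ?bip_l0 ?bip_r0.
Qed.

Lemma poly_fun_hom_part j k (X Y : R -> 'rV[R]_n) :
  (forall i, poly_fun (fun t => X t 0 i)) -> (forall i, poly_fun (fun t => Y t 0 i)) ->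
  poly_fun (fun t => hom_part j k (X t) (Y t)).
Proof.
move=> XP YP; apply: poly_fun_sum => a _; apply: poly_fun_sum => b _.
exact: poly_fun_bipart.
Qed.

(** The arguments may themselves depend on t, since in the cocycle identity one of them is a product
    already divided by t. *)
Lemma P_expand j (X Y : R -> 'rV[R]_n) :
  (forall i, poly_fun (fun t => X t 0 i)) -> (forall i, poly_fun (fun t => Y t 0 i)) ->
  exists E, poly_fun E /\ forall t, P j (t *: X t) (t *: Y t) =
    t ^+ 2 * half_lie (X t) (Y t) 0 j + t ^+ 3 * hom_part j 3 (X t) (Y t) + t ^+ 4 * E t.
Proof.
move=> XP YP; exists (fun t => \sum_(k < K - 4 + K) t ^+ k * hom_part j (k + 4)%N (X t) (Y t)).
split.
  apply: poly_fun_sum => k _; apply: poly_funM; last exact: poly_fun_hom_part.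
  by apply: poly_funX; apply: poly_fun_id.
move=> t; rewrite P_hom.
under eq_bigr do rewrite hom_partZ.
have KE : (K + K = (K - 4 + K).+4)%N by rewrite /hom_bound; lia.
rewrite KE; do 4! rewrite big_ord_recl.
rewrite /= /bump /= !add1n (@hom_part_lt2 _ 0) // (@hom_part_lt2 _ 1) // !mulr0 !add0r hom_part2.
rewrite -addrA; congr (_ + (_ + _)); rewrite mulr_sumr; apply: eq_bigr => k _.
by rewrite !add1n addn4 mulrA -exprD.
Qed.

Lemma gmul_expand x y : exists V : R -> 'rV[R]_n, (forall i, poly_fun (fun t => V t 0 i)) /\
  forall t, (t *: x) ** (t *: y) = t *: (x + y + t *: half_lie x y + t ^+ 2 *: V t).
Proof.
have cst (z : 'rV[R]_n) i : poly_fun (fun t : R => z 0 i) by exact: poly_fun_cst.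
have [E EP] := choice (fun j => @P_expand j (fun=> x) (fun=> y) (cst x) (cst y)).
exists (fun t => \row_j (hom_part j 3 x y + t * E j t)); split.
  move=> i; under eq_fun do rewrite mxE.
  by apply: poly_funD; [exact: poly_fun_cst|apply: poly_funM; [exact: poly_fun_id|have [] := EP i]].
move=> t; apply/rowP => j; rewrite gmulE; have [_ ->] := EP j; rewrite !mxE; ring.
Qed.

(** Associativity, compared in order t^3 along t x, t y, t z, says that the iterated brackets
    measure the failure of the cubic part to be an additive cocycle. Alternating over the six
    permutations cancels the cubic part. *)
Lemma jacobi x y z :
  half_lie (half_lie x y) z + half_lie (half_lie y z) x + half_lie (half_lie z x) y = 0.
Proof.
apply/rowP => j.
have cubic x' y' z' : hom_part j 3 x' y' + hom_part j 3 (x' + y') z' +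
    half_lie (half_lie x' y') z' 0 j =
    hom_part j 3 y' z' + hom_part j 3 x' (y' + z') + half_lie x' (half_lie y' z') 0 j.
  have [V [VP VE]] := gmul_expand x' y'; have [W [WP WE]] := gmul_expand y' z'.
  pose U t := x' + y' + t *: half_lie x' y' + t ^+ 2 *: V t.
  pose U' t := y' + z' + t *: half_lie y' z' + t ^+ 2 *: W t.
  have cst (w : 'rV[R]_n) i : poly_fun (fun t : R => w 0 i) by exact: poly_fun_cst.
  have UP i : poly_fun (fun t => U t 0 i).
    under eq_fun do rewrite !mxE; repeat apply: poly_funD; try exact: poly_fun_cst.
      by apply: poly_funM; [exact: poly_fun_id|exact: poly_fun_cst].
    by apply: poly_funM => //; apply: poly_funX; exact: poly_fun_id.
  have UP' i : poly_fun (fun t => U' t 0 i).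
    under eq_fun do rewrite !mxE; repeat apply: poly_funD; try exact: poly_fun_cst.
      by apply: poly_funM; [exact: poly_fun_id|exact: poly_fun_cst].
    by apply: poly_funM => //; apply: poly_funX; exact: poly_fun_id.
  have [E1 [E1P E1E]] := @P_expand j _ _ (cst x') (cst y').
  have [E2 [E2P E2E]] := @P_expand j _ _ UP (cst z').
  have [E3 [E3P E3E]] := @P_expand j _ _ (cst y') (cst z').
  have [E4 [E4P E4E]] := @P_expand j _ _ (cst x') UP'.
  pose F t := hom_part j 3 x' y' + hom_part j 3 (U t) z' + half_lie (half_lie x' y') z' 0 j
    - (hom_part j 3 y' z' + hom_part j 3 x' (U' t) + half_lie x' (half_lie y' z') 0 j).
  pose H t := E3 t + E4 t + half_lie x' (W t) 0 j - (E1 t + E2 t + half_lie (V t) z' 0 j).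
  have hP (X Y : R -> 'rV[R]_n) : (forall i, poly_fun (fun t => X t 0 i)) ->
      (forall i, poly_fun (fun t => Y t 0 i)) -> poly_fun (fun t => half_lie (X t) (Y t) 0 j).
    by move=> XP YP; under eq_fun do rewrite mxE; apply: poly_fun_bipart.
  have FP : poly_fun F.
    apply: poly_funD; last apply: poly_funN; repeat apply: poly_funD;
      try exact: poly_fun_cst; exact: poly_fun_hom_part.
  have HP : poly_fun H.
    by apply: poly_funD; last apply: poly_funN; repeat apply: poly_funD => //; exact: hP.
  (* The quadratic terms cancel by bilinearity of [half_lie]; [F] collects what is left in order 3
     and [H] the remainders. *)
  have /(poly_fun_cancel FP HP) : forall t, t ^+ 3 * F t = t ^+ 4 * H t.
    move=> t; have := P_cocycle j (t *: x') (t *: y') (t *: z').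
    rewrite VE WE -/(U t) -/(U' t) E1E E2E E3E E4E.
    rewrite /U !half_lieDl /U' !half_lieDr !half_lieZl !half_lieZr -/(U t) -/(U' t).
    rewrite /F /H !mxE.
    set a1 := bipart _ _ _ x' y'; set a2 := bipart _ _ _ x' z'; set a3 := bipart _ _ _ y' z'.
    set b1 := bipart _ _ _ _ z'; set b2 := bipart _ _ _ _ z'.
    set b3 := bipart _ _ _ x' _; set b4 := bipart _ _ _ x' _.
    lra.
  rewrite /F /U /U' !scale0r expr0n /= !scale0r !addr0; lra.
have l0 w a b : half_lie w (half_lie a b) 0 j = - half_lie (half_lie a b) w 0 j.
  by rewrite half_lieC mxE.
have anti a b w : half_lie (half_lie b a) w 0 j = - half_lie (half_lie a b) w 0 j.
  by rewrite (half_lieC b a) -scaleN1r half_lieZl mxE mulN1r.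
have c1 := cubic x y z; have c2 := cubic y z x; have c3 := cubic z x y.
have d1 := cubic y x z; have d2 := cubic z y x; have d3 := cubic x z y.
rewrite !l0 in c1 c2 c3 d1 d2 d3.
rewrite ?(addrC y x) ?(addrC z y) ?(addrC x z) in d1 d2 d3.
have a1 := anti x y z; have a2 := anti y z x; have a3 := anti z x y.
rewrite [RHS]mxE [LHS]mxE [X in X + _]mxE.
set T1 := half_lie (half_lie x y) z 0 j in a1 c1 c3 d1 *.
set T2 := half_lie (half_lie y z) x 0 j in a2 c1 c2 d1 *.
set T3 := half_lie (half_lie z x) y 0 j in a3 c2 c3 *.
lra.
Qed.

(** Since (t x) ** (t y) = t (x + y) + O(t^2), a cocycle [D] for the group law has a lowest
    homogeneous part that is a cocycle for addition. It is stated for abstract [D] and [h] in order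
    to apply to the defect of homogeneity. *)
Lemma hom_part_cocycle (h : nat -> 'rV[R]_n -> 'rV[R]_n -> R) (D : 'rV[R]_n -> 'rV[R]_n -> R) N m :
  (forall k t x y, h k (t *: x) (t *: y) = t ^+ k * h k x y) ->
  (forall k (X Y : R -> 'rV[R]_n), (forall i, poly_fun (fun t => X t 0 i)) ->
     (forall i, poly_fun (fun t => Y t 0 i)) -> poly_fun (fun t => h k (X t) (Y t))) ->
  (forall x y, D x y = \sum_(k < N) h k x y) ->
  (forall x y z, D x y + D (x ** y) z = D y z + D x (y ** z)) ->
  (forall k x y, (k < m)%N -> h k x y = 0) -> (m < N)%N ->
  forall x y z, h m x y + h m (x + y) z = h m y z + h m x (y + z).
Proof.
move=> hZ hP Dh Dc h0 mN x y z.
have expand (X Y : R -> 'rV[R]_n) : (forall i, poly_fun (fun t => X t 0 i)) ->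
    (forall i, poly_fun (fun t => Y t 0 i)) -> exists E, poly_fun E /\
    forall t, D (t *: X t) (t *: Y t) = t ^+ m * h m (X t) (Y t) + t ^+ m.+1 * E t.
  move=> XP YP; exists (fun t => \sum_(k < N | (m < k)%N) t ^+ (k - m.+1) * h k (X t) (Y t)).
  split.
    apply: poly_fun_sum => k _; apply: poly_funM; last exact: hP.
    by apply: poly_funX; apply: poly_fun_id.
  move=> t; rewrite Dh (bigD1 (Ordinal mN)) //= hZ; congr (_ + _).
  rewrite mulr_sumr big_mkcond [RHS]big_mkcond; apply: eq_bigr => k _.
  rewrite hZ; case: ltngtP => [km|km|km].
  - have -> : k != Ordinal mN by apply/eqP => kE; move: km; rewrite kE ltnn.
    by rewrite mulrA -exprD subnKC.
  - by rewrite h0 // mulr0 if_same.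
  - by have -> : k == Ordinal mN by apply/eqP/val_inj; rewrite /= km.
have [V [VP VE]] := gmul_expand x y; have [W [WP WE]] := gmul_expand y z.
pose U t := x + y + t *: half_lie x y + t ^+ 2 *: V t.
pose U' t := y + z + t *: half_lie y z + t ^+ 2 *: W t.
have cst (w : 'rV[R]_n) i : poly_fun (fun t : R => w 0 i) by exact: poly_fun_cst.
have UP i : poly_fun (fun t => U t 0 i).
  under eq_fun do rewrite !mxE; repeat apply: poly_funD; try exact: poly_fun_cst.
    by apply: poly_funM; [exact: poly_fun_id|exact: poly_fun_cst].
  by apply: poly_funM => //; apply: poly_funX; exact: poly_fun_id.
have UP' i : poly_fun (fun t => U' t 0 i).
  under eq_fun do rewrite !mxE; repeat apply: poly_funD; try exact: poly_fun_cst.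
    by apply: poly_funM; [exact: poly_fun_id|exact: poly_fun_cst].
  by apply: poly_funM => //; apply: poly_funX; exact: poly_fun_id.
have [E1 [E1P E1E]] := expand _ _ (cst x) (cst y).
have [E2 [E2P E2E]] := expand _ _ UP (cst z).
have [E3 [E3P E3E]] := expand _ _ (cst y) (cst z).
have [E4 [E4P E4E]] := expand _ _ (cst x) UP'.
pose F t := h m x y + h m (U t) z - (h m y z + h m x (U' t)).
pose H t := E3 t + E4 t - (E1 t + E2 t).
have FP : poly_fun F.
  by apply: poly_funD; last apply: poly_funN; apply: poly_funD;
    try exact: poly_fun_cst; apply: hP.
have HP : poly_fun H.
  by apply: poly_funD; last apply: poly_funN; apply: poly_funD.
have /(poly_fun_cancel FP HP) : forall t, t ^+ m * F t = t ^+ m.+1 * H t.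
  move=> t; have := Dc (t *: x) (t *: y) (t *: z).
  by rewrite VE WE -/(U t) -/(U' t) E1E E2E E3E E4E /F /H; lra.
rewrite /F /U /U' !scale0r expr0n /= !scale0r !addr0; lra.
Qed.

End GroupAlgebra.

Section RowLimits.
Variables (R : realType) (n : nat).

Lemma cvg_sum_seq (V : normedModType R) (T I : Type) (F : set_system T) (FF : Filter F)
    (r : seq I) (f : I -> T -> V) (l : I -> V) :
  (forall i, f i @ F --> l i) -> (fun x => \sum_(i <- r) f i x) @ F --> \sum_(i <- r) l i.
Proof.
move=> fl; elim: r => [|i r IH].
  by under eq_fun do rewrite big_nil; rewrite big_nil; apply: cvg_cst.
by under eq_fun do rewrite big_cons; rewrite big_cons; apply: cvgD.
Qed.

Lemma row_cvg (T : Type) (F : set_system T) (FF : Filter F) (u : T -> 'rV[R]_n) (l : 'rV[R]_n) :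
  (forall j, (fun x => u x 0 j) @ F --> l 0 j) -> u @ F --> l.
Proof.
move=> ul; rewrite [l]row_sum_delta (_ : u = fun x => \sum_j u x 0 j *: delta_mx 0 j); last first.
  by apply/funext => x; rewrite -row_sum_delta.
by apply: cvg_sum_seq => j; apply: cvgZr_tmp; apply: ul.
Qed.

Lemma derive_row_poly (f : 'rV[R]_n -> 'rV[R]_n) a v (q : 'I_n -> {poly R}) :
  (forall h, f (h *: v + a) = \row_j (q j).[h]) ->
  derivable f a v /\ 'D_v f a = \row_j (q j)`_1.
Proof.
move=> fq.
have lim : (fun h => h^-1 *: ((f \o shift a) (h *: v) - f a)) @ 0^' --> \row_j (q j)`_1.
  have f0 : f a = \row_j (q j).[0] by rewrite -fq scale0r add0r.
  apply: row_cvg => j; rewrite mxE.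
  pose r := \poly_(i < size (q j)) (q j)`_i.+1.
  have qE : q j = r * 'X + ((q j)`_0)%:P.
    apply/polyP => -[|i]; rewrite coefD coefMX coefC /= ?add0r ?addr0 // coef_poly.
    by case: ltnP => // h; rewrite nth_default // ltnW // ltnS.
  have -> : (q j)`_1 = r.[0] by rewrite {1}qE coefD coefMX coefC /= addr0 horner_coef0.
  apply: (@cvg_trans _ (horner r @ 0^')); last first.
    apply: cvg_within_filter; apply: continuous_horner.
  apply: near_eq_cvg; near=> h.
  have h0 : h != 0 by near: h; exact: nbhs_dnbhs_neq.
  have qh t : (q j).[t] = r.[t] * t + (q j)`_0 by rewrite {1}qE !hornerE.
  by rewrite /= fq f0 !mxE !qh mulr0 add0r addrK [_ * h]mulrC mulKf.
split; first by apply/cvg_ex; exists (\row_j (q j)`_1).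
exact: cvg_lim lim.
Unshelve. all: by end_near. Qed.
End RowLimits.

(** * The grading of the Lie bracket and the dilations as automorphisms *)

Section LieBracket.
Variables (R : realType) (n s : nat) (deg : 'I_n -> nat) (pol : 'I_n -> mpoly (n + n) R).
Hypothesis G : carnot deg pol s.
Implicit Types x y z v w : 'rV[R]_n.
Local Notation "x ** y" := (gmul pol x y) (at level 40, left associativity).
Local Notation P j := (pair_eval (pol j)).
Local Notation bip j := (bipart (pol j)).
Local Notation K := (hom_bound pol).

(** The part of the correction term linear in the second factor, that is, its differential at 0 in
    direction w. *)
Definition left_field_part j x w := \sum_(a < K) bip j a 1 x w.

Lemma gmul_derive w x : derivable (gmul pol x) 0 w /\
  left_field pol w x = \row_j (w 0 j + left_field_part j x w).
Proof.
pose q j : {poly R} := \poly_(b < K) (\sum_(a < K) bip j a b x w +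
   ((b == 0)%N%:R * x 0 j + (b == 1)%N%:R * w 0 j)).
have [|dG] := @derive_row_poly _ _ (gmul pol x) 0 w q.
  move=> h; apply/rowP => i; rewrite addr0 gmulE [RHS]mxE /q horner_poly.
  under [RHS]eq_bigr do rewrite mulrDl mulr_suml.
  rewrite big_split /= [X in _ = _ + X](_ : _ = x 0 i + h * w 0 i); last first.
    have -> : K = (K.-2).+2 by [].
    do 2! rewrite big_ord_recl; rewrite /= /bump /= [X in _ + (_ + X)]big1 ?addr0; last first.
      by move=> k _; rewrite !mul0r addr0 mul0r.
    by rewrite expr0 expr1 !mul1r !mul0r addr0 add0r mulr1 mulrC.
  rewrite addrC mxE; congr (_ + _).
  rewrite -[x in P i x]scale1r P_bipZ exchange_big; apply: eq_bigr => b _.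
  by apply: eq_bigr => a _; rewrite expr1n mul1r.
rewrite /left_field => ->; split=> //; apply/rowP => j; rewrite !mxE coef_poly /=.
by rewrite mul0r add0r mul1r addrC.
Qed.

Lemma left_fieldE w x j : left_field pol w x 0 j = w 0 j + left_field_part j x w.
Proof. by have [_ ->] := gmul_derive w x; rewrite mxE. Qed.

Lemma left_field_partZ j x c w w' :
  left_field_part j x (c *: w + w') = c * left_field_part j x w + left_field_part j x w'.
Proof. by rewrite mulr_sumr -big_split; apply: eq_bigr => a _; rewrite bipart_linear_r. Qed.

Lemma lieE v w : lie pol v w = 2 *: half_lie pol v w.
Proof.
have h u u' : 'D_u (left_field pol u') 0 = half_lie pol u u'.
  have [|_ ->] := @derive_row_poly _ _ (left_field pol u') 0 u
    (fun j => \poly_(a < K) (bip j a 1 u u' + (a == 0)%N%:R * u' 0 j)).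
    move=> t; apply/rowP => j; rewrite addr0 left_fieldE [RHS]mxE horner_poly.
    under [RHS]eq_bigr do rewrite mulrDl.
    rewrite big_split /= [LHS]addrC; congr (_ + _).
      rewrite /left_field_part; apply: eq_bigr => a _.
      by rewrite -[u' in LHS]scale1r bipartZ expr1n mulr1 mulrC.
    have -> : K = (K.-1).+1 by [].
    rewrite big_ord_recl /= /bump /= big1 ?addr0; last by move=> k _; rewrite !mul0r.
    by rewrite expr0 mul1r mulr1.
  by apply/rowP => j; rewrite !mxE coef_poly /= mul0r addr0.
have e : lie pol v w = half_lie pol v w - half_lie pol w v.
  by rewrite -(h v w) -(h w v).
rewrite e.
have -> : half_lie pol w v = - half_lie pol v w by exact: half_lieC G w v.
rewrite opprK.
have -> : 2 = 1 + 1 :> R by [].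
by rewrite scalerDl scale1r.
Qed.

Lemma deg_ge1 j : (1 <= deg j)%N.
Proof. by have /andP[] := carnot_deg G j. Qed.

Lemma layer_gt i v : (s < i)%N -> layer deg i v -> v = 0.
Proof.
move=> si vi; apply/rowP => j; rewrite mxE vi //.
by have /andP[_] := carnot_deg G j; apply: contraTneq => ->; rewrite -ltnNge.
Qed.

Lemma layer_lin i c v w : layer deg i v -> layer deg i w -> layer deg i (c *: v + w).
Proof. by move=> vi wi j ji; rewrite !mxE vi // wi // mulr0 addr0. Qed.

Lemma layer0 i : layer deg i (0 : 'rV[R]_n).
Proof. by move=> j _; rewrite mxE. Qed.

Lemma layerZ i c v : layer deg i v -> layer deg i (c *: v).
Proof. by move=> vi j ji; rewrite mxE vi // mulr0. Qed.

Lemma layerD i v w : layer deg i v -> layer deg i w -> layer deg i (v + w).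
Proof. by move=> vi wi; rewrite -[v]scale1r; apply: layer_lin. Qed.

Lemma layer_sum i (I : Type) (r : seq I) (F : I -> 'rV[R]_n) :
  (forall k, layer deg i (F k)) -> layer deg i (\sum_(k <- r) F k).
Proof. by move=> FP; apply: big_ind => //; [exact: layer0|exact: layerD]. Qed.

Lemma half_lie_layer1 i v w : (0 < i)%N -> layer deg 1 v -> layer deg i w ->
  layer deg i.+1 (half_lie pol v w).
Proof.
move=> i0 v1 wi; have [is_|si] := leqP i s; last first.
  by rewrite (layer_gt si wi) half_lie0r; apply: layer0.
have -> : half_lie pol v w = 2^-1 *: lie pol v w.
  by rewrite lieE scalerA mulVf ?scale1r // pnatr_eq0.
apply: layerZ; rewrite -(carnot_strat G (i := i)) ?i0 //.
exists 1%N, (fun=> 1), (fun=> lie pol v w); split; last by rewrite big_ord1 scale1r.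
by move=> _; exists v => //; exists w.
Qed.

Lemma half_lie_suml (I : Type) (r : seq I) (F : I -> 'rV[R]_n) w :
  half_lie pol (\sum_(k <- r) F k) w = \sum_(k <- r) half_lie pol (F k) w.
Proof.
elim: r => [|k r IH]; first by rewrite !big_nil half_lie0l.
by rewrite !big_cons half_lieDl IH.
Qed.

Lemma half_lie_sumr (I : Type) (r : seq I) (F : I -> 'rV[R]_n) w :
  half_lie pol w (\sum_(k <- r) F k) = \sum_(k <- r) half_lie pol w (F k).
Proof.
elim: r => [|k r IH]; first by rewrite !big_nil half_lie0r.
by rewrite !big_cons half_lieDr IH.
Qed.

(** The stratification only controls brackets with the first layer. A vector of layer i + 1 is a
    combination of brackets [v1, v2] with v1 in layer 1, and the Jacobi identity reduces [[v1, v2],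
    w] to brackets covered by the induction on i, uniformly in k. *)
Lemma half_lie_layer i k v w : (0 < i)%N -> (0 < k)%N -> layer deg i v -> layer deg k w ->
  layer deg (i + k) (half_lie pol v w).
Proof.
case: i => // i _; elim: i k v w => [|i IH] k v w k0; first exact: half_lie_layer1.
have [is_|si] := leqP i.+1 s; last first.
  by move=> vi _; rewrite (layer_gt _ vi) ?half_lie0l; [apply: layer0|apply: ltnW].
rewrite -(carnot_strat G (i := i.+1)) // => -[m [a [u [uP ->]]]] wk.
rewrite half_lie_suml; apply: layer_sum => l; rewrite half_lieZl; apply: layerZ.
have [v1 v1P [v2 v2P <-]] := uP l.
rewrite lieE half_lieZl; apply: layerZ.
have := jacobi G v1 v2 w; move/eqP; rewrite -addrA addr_eq0 => /eqP ->.
rewrite -scaleN1r; apply: layerZ; apply: layerD.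
  rewrite (half_lieC G) -scaleN1r; apply: layerZ.
  by rewrite addSn; apply: half_lie_layer1 => //; apply: IH.
rewrite (half_lieC G) -scaleN1r; apply: layerZ; rewrite addSnnS.
apply: IH => //; rewrite (half_lieC G) -scaleN1r; apply: layerZ.
exact: half_lie_layer1.
Qed.

Definition layer_proj i x : 'rV[R]_n := \row_j (if deg j == i then x 0 j else 0).

Lemma layer_projP i x : layer deg i (layer_proj i x).
Proof. by move=> j /negbTE ji; rewrite mxE ji. Qed.

Lemma layer_proj_sum x : x = \sum_(i < s.+1) layer_proj i x.
Proof.
apply/rowP => j; rewrite summxE; have /andP[_ js] := carnot_deg G j.
rewrite (bigD1 (Ordinal (js : (deg j < s.+1)%N))) //= mxE eqxx big1 ?addr0 // => i ij.
by rewrite mxE; case: eqP => // ji; case/eqP: ij; apply: val_inj.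
Qed.

Lemma dilation_layer i r v : layer deg i v -> dilation deg r v = r ^+ i *: v.
Proof.
move=> vi; apply/rowP => j; rewrite !mxE; have [->//|ji] := eqVneq (deg j) i.
by rewrite vi // !mulr0.
Qed.

Lemma dilationD r x y : dilation deg r (x + y) = dilation deg r x + dilation deg r y.
Proof. by apply/rowP => j; rewrite !mxE mulrDr. Qed.

Lemma dilationZ r c x : dilation deg r (c *: x) = c *: dilation deg r x.
Proof. by apply/rowP => j; rewrite !mxE mulrCA. Qed.

Lemma dilationM r t x : dilation deg (r * t) x = dilation deg r (dilation deg t x).
Proof. by apply/rowP => j; rewrite !mxE exprMn mulrA. Qed.

Lemma dilation1 x : dilation deg 1 x = x.
Proof. by apply/rowP => j; rewrite !mxE expr1n mul1r. Qed.

Lemma dilation_sum r (I : Type) (l : seq I) (F : I -> 'rV[R]_n) :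
  dilation deg r (\sum_(k <- l) F k) = \sum_(k <- l) dilation deg r (F k).
Proof.
elim: l => [|k l IH]; last by rewrite !big_cons dilationD IH.
by rewrite !big_nil; apply/rowP => j; rewrite !mxE mulr0.
Qed.

Lemma half_lie_dilation r x y :
  half_lie pol (dilation deg r x) (dilation deg r y) = dilation deg r (half_lie pol x y).
Proof.
have l0 v : layer deg 0 v -> v = 0.
  by move=> v0; apply/rowP => j; rewrite mxE v0 // -lt0n deg_ge1.
rewrite [x]layer_proj_sum [y]layer_proj_sum !dilation_sum !half_lie_suml dilation_sum.
apply: eq_bigr => i _; rewrite !half_lie_sumr dilation_sum; apply: eq_bigr => k _.
have [xi yk] := (@layer_projP i x, @layer_projP k y).
rewrite (dilation_layer r xi) (dilation_layer r yk) half_lieZl half_lieZr scalerA -exprD.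
have [i0|i0] := posnP i.
  by rewrite i0 in xi *; rewrite (l0 _ xi) half_lie0l scaler0 (dilation_layer r (@layer0 0)) scaler0.
have [k0|k0] := posnP k.
  by rewrite k0 in yk *; rewrite (l0 _ yk) half_lie0r scaler0 (dilation_layer r (@layer0 0)) scaler0.
by rewrite (dilation_layer r (half_lie_layer i0 k0 xi yk)).
Qed.

(** Induction on the degree is needed because the defect [D] is a cocycle only once the coordinates
    of lower degree are known to be homogeneous. Its parts [h m] then vanish in turn: trivially for
    m < 2, by the grading of the bracket for m = 2, and by [eichler_cocycle] beyond. *)
Lemma P_dilation r j x y : r != 0 ->
  P j (dilation deg r x) (dilation deg r y) = r ^+ deg j * P j x y.
Proof.
move=> r0; have [d] := ubnP (deg j); elim: d j x y => // d IH j x y jd.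
have rd : r ^+ deg j != 0 by rewrite expf_neq0.
pose D u v := (r ^+ deg j)^-1 * P j (dilation deg r u) (dilation deg r v) - P j u v.
pose h k u v := (r ^+ deg j)^-1 * hom_part pol j k (dilation deg r u) (dilation deg r v)
  - hom_part pol j k u v.
have hZ k t u v : h k (t *: u) (t *: v) = t ^+ k * h k u v.
  by rewrite /h !dilationZ !hom_partZ; ring.
have hline k u a b : h k (a *: u) (b *: u) = 0.
  by rewrite /h !dilationZ !(hom_part_line G) mulr0 subrr.
have hP k (X Y : R -> 'rV[R]_n) : (forall i, poly_fun (fun t => X t 0 i)) ->
    (forall i, poly_fun (fun t => Y t 0 i)) -> poly_fun (fun t => h k (X t) (Y t)).
  have dP (Z : R -> 'rV[R]_n) : (forall i, poly_fun (fun t => Z t 0 i)) ->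
      forall i, poly_fun (fun t => dilation deg r (Z t) 0 i).
    by move=> ZP i; under eq_fun do rewrite mxE; apply: poly_funM => //; apply: poly_fun_cst.
  move=> XP YP; apply: poly_funD; last by apply: poly_funN; apply: poly_fun_hom_part.
  by apply: poly_funM; [exact: poly_fun_cst|apply: poly_fun_hom_part; apply: dP].
have Dh u v : D u v = \sum_(k < K + K) h k u v.
  by rewrite /D !P_hom mulr_sumr -sumrB.
have Dc u v w : D u v + D (u ** v) w = D v w + D u (v ** w).
  have low a b : P j (dilation deg r (a ** b)) (dilation deg r w) =
      P j (dilation deg r a ** dilation deg r b) (dilation deg r w).
    apply: (P_lower G) => // k kj; rewrite mxE !gmulE mulrDr IH ?(leq_trans kj) //.
    by rewrite mulrDr !mxE.
  have low' a b : P j (dilation deg r u) (dilation deg r (a ** b)) =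
      P j (dilation deg r u) (dilation deg r a ** dilation deg r b).
    apply: (P_lower G) => // k kj; rewrite mxE !gmulE mulrDr IH ?(leq_trans kj) //.
    by rewrite mulrDr !mxE.
  rewrite /D low low'.
  have := P_cocycle G j u v w.
  have := congr1 ( *%R (r ^+ deg j)^-1)
    (P_cocycle G j (dilation deg r u) (dilation deg r v) (dilation deg r w)).
  rewrite !mulrDr; lra.
have h0 m u v : (m < K + K)%N -> h m u v = 0.
  elim/ltn_ind: m u v => m IHm u v mK.
  have [m2|m2] := ltnP m 2; first by rewrite /h !(hom_part_lt2 G) // mulr0 subrr.
  have [->|m3] : m = 2%N \/ (2 < m)%N by lia.
    rewrite /h !(hom_part2 G) half_lie_dilation [dilation _ _ _ _ _]mxE.
    by rewrite mulrA mulVf // mul1r subrr.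
  apply: (eichler_cocycle _ (hline m) (hZ m) m3).
  apply: (hom_part_cocycle G hZ hP Dh Dc) => // k u' v' km.
  by apply: IHm => //; apply: ltn_trans mK.
have : D x y = 0 by rewrite Dh big1 // => k _; rewrite h0.
by move/eqP; rewrite subr_eq0 => /eqP <-; rewrite mulrA mulfV // mul1r.
Qed.

Lemma gmul_dilation r x y : r != 0 ->
  dilation deg r (x ** y) = dilation deg r x ** dilation deg r y.
Proof.
move=> r0; apply/rowP => j; rewrite gmulE mxE gmulE P_dilation // !mulrDr.
by rewrite [in RHS]mxE [X in _ = _ + X + _]mxE.
Qed.

End LieBracket.

(** * Ball-box estimates *)

Section Reachability.
Variables (R : realType) (n s : nat) (deg : 'I_n -> nat) (pol : 'I_n -> mpoly (n + n) R).
Hypothesis G : carnot deg pol s.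
Implicit Types x y z u v w g h : 'rV[R]_n.
Local Notation "x ** y" := (gmul pol x y) (at level 40, left associativity).
Local Notation P j := (pair_eval (pol j)).
Local Notation bip j := (bipart (pol j)).
Local Notation K := (hom_bound pol).

Definition bounded_by (M : R) x := forall j, `|x 0 j| <= M.
Definition filtration i x := forall j, (deg j < i)%N -> x 0 j = 0.

Lemma gmul_lipschitz (M : R) : exists C, 0 <= C /\ forall x y x' y' D,
  bounded_by M x -> bounded_by M y -> bounded_by M x' -> bounded_by M y' -> 0 <= D ->
  bounded_by D (x - x') -> bounded_by D (y - y') ->
  bounded_by C (x ** y) /\ bounded_by (C * D) (x ** y - x' ** y').
Proof.
have [C CP] := choice (fun j => loc_lipschitz_mono_sum (pol j) xpredT M).
(* The sum handles the polynomial parts; [2 * |M|] bounds x + y, and 2 is the Lipschitz constant of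
   addition. *)
exists (\sum_j `|C j| + (2 * `|M| + 2)); split.
  by rewrite addr_ge0 ?sumr_ge0 ?addr_ge0 ?mulr_ge0.
move=> x y x' y' D xM yM xM' yM' D0 xD yD.
have rM (a b : 'rV[R]_n) B : bounded_by B a -> bounded_by B b ->
    forall i, `|(row_mx a b : 'rV[R]_(n + n)) 0 i| <= B.
  by move=> aB bB i; case: (split_ordP i) => k ->; rewrite ?row_mxEl ?row_mxEr.
have hP j : `|P j x y| <= `|C j| /\ `|P j x y - P j x' y'| <= `|C j| * D.
  have [|h1 h2] := CP j _ _ D (rM _ _ _ xM yM) (rM _ _ _ xM' yM') D0.
    by move=> i; have := rM _ _ _ xD yD i; case: (split_ordP i) => k ->;
      rewrite ?row_mxEl ?row_mxEr !mxE.
  rewrite /pair_eval !meval_mono_sum; split; first exact: le_trans h1 (ler_norm _).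
  by apply: le_trans h2 _; rewrite ler_wpM2r // ler_norm.
have Cj j : `|C j| <= \sum_j `|C j|.
  by rewrite [leRHS](bigD1 j) //= lerDl sumr_ge0.
split=> j.
  rewrite gmulE; apply: le_trans (ler_normD _ _) _; rewrite addrC lerD //.
    by apply: le_trans (Cj j); have [] := hP j.
  apply: le_trans (ler_normD _ _) _.
  by have := xM j; have := yM j; have := ler_norm M; lra.
have -> : (x ** y - x' ** y') 0 j = (x ** y) 0 j - (x' ** y') 0 j by rewrite mxE [X in _ + X]mxE.
rewrite !gmulE; set p := pair_eval (pol j) x y; set p' := pair_eval (pol j) x' y'.
have -> : x 0 j + y 0 j + p - (x' 0 j + y' 0 j + p') =
   (x - x') 0 j + (y - y') 0 j + (p - p') by rewrite !mxE; ring.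
apply: le_trans (ler_normD _ _) _; rewrite mulrDl [leLHS]addrC lerD //.
  by apply: le_trans (ler_wpM2r D0 (Cj j)); exact: (hP j).2.
apply: le_trans (ler_normD _ _) _; apply: le_trans (lerD (xD j) (yD j)) _.
rewrite mulrDl; have : 0 <= 2 * `|M| * D by rewrite !mulr_ge0.
lra.
Qed.

Lemma gmul_bounded (M : R) : exists C, 0 <= C /\ forall x y,
  bounded_by M x -> bounded_by M y -> bounded_by C (x ** y).
Proof.
have [C [C0 CP]] := gmul_lipschitz M; exists C; split=> // x y xM yM.
have z0 x' : bounded_by 0 (x' - x') by move=> j; rewrite subrr mxE normr0.
by have [] := CP x y x y 0 xM yM xM yM (lexx _) (z0 x) (z0 y).
Qed.

Lemma bounded_byN M x : bounded_by M x -> bounded_by M (- x).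
Proof. by move=> xM j; rewrite mxE normrN. Qed.

Lemma bounded_by_le M M' x : M <= M' -> bounded_by M x -> bounded_by M' x.
Proof. by move=> MM xM j; apply: le_trans (xM j) MM. Qed.

Definition gprod (us : seq 'rV[R]_n) := foldr (gmul pol) 0 us.

Lemma gprod_cat us vs : gprod (us ++ vs) = gprod us ** gprod vs.
Proof. by elim: us => [|u us IH] /=; rewrite ?(gmul0l G) // IH (gmulA G). Qed.

(** A single number bounds both how many factors there are and their size, so that it bounds the
    length of the corresponding path. *)
Definition reachable (B : R) x := exists us : seq 'rV[R]_n,
  [/\ (size us)%:R <= B, forall u, u \in us -> layer deg 1 u /\ bounded_by B u & x = gprod us].

Lemma reachable_ge0 B x : reachable B x -> 0 <= B.
Proof. by move=> [us [sB _ _]]; apply: le_trans sB. Qed.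

Lemma reachable_mul B B' x y : reachable B x -> reachable B' y -> reachable (B + B') (x ** y).
Proof.
move=> rx ry; have [B0 B'0] := (reachable_ge0 rx, reachable_ge0 ry).
move: rx ry => [us [usB usP ->]] [vs [vsB vsP ->]]; exists (us ++ vs); split.
- by rewrite size_cat natrD lerD.
- move=> u; rewrite mem_cat => /orP[/usP|/vsP] [u1 uB]; split=> //.
    by apply: bounded_by_le uB; rewrite lerDl.
  by apply: bounded_by_le uB; rewrite lerDr.
- by rewrite gprod_cat.
Qed.

Lemma reachableN B x : reachable B x -> reachable B (- x).
Proof.
move=> [us [usB usP ->]]; exists (rev (map -%R us)); split.
- by rewrite size_rev size_map.
- move=> u; rewrite mem_rev => /mapP[v vu ->]; have [v1 vB] := usP v vu.
  by split; [rewrite -scaleN1r; apply: layerZ|apply: bounded_byN].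
elim: us {usB usP} => [|u us IH] /=; first by rewrite oppr0.
by rewrite (gmulN G) IH rev_cons -cats1 gprod_cat /= (gmul0r G).
Qed.

Lemma reachable0 : reachable 0 0.
Proof. by exists [::]. Qed.

Lemma reachable_horizontal B u : 1 <= B -> layer deg 1 u -> bounded_by B u -> reachable B u.
Proof.
by move=> B1 u1 uB; exists [:: u]; split=> //= [v|]; rewrite ?(gmul0r G) // inE => /eqP ->.
Qed.

Lemma reachable_bounded B : exists M, forall x, reachable B x -> bounded_by M x.
Proof.
have h (N : nat) : exists M, 0 <= M /\ forall us : seq 'rV[R]_n, (size us <= N)%N ->
    (forall u, u \in us -> bounded_by B u) -> bounded_by M (gprod us).
  elim: N => [|N [M [M0 IH]]].
    by exists 0; split=> // -[|//] _ _ j; rewrite mxE normr0.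
  have [C [C0 CP]] := gmul_bounded (M + `|B|); exists (C + M); split; first exact: addr_ge0.
  case=> [|u us] /=; first by move=> _ _ j; rewrite mxE normr0 addr_ge0.
  rewrite ltnS => sN usB; apply: (@bounded_by_le C); first by rewrite lerDl.
  apply: CP.
    apply: (@bounded_by_le B); last by apply: usB; rewrite mem_head.
    by apply: le_trans (ler_norm _) _; rewrite lerDr.
  apply: (@bounded_by_le M); first by rewrite lerDl.
  by apply: IH => // v vus; apply: usB; rewrite in_cons vus orbT.
have [M [_ MP]] := h (Num.bound B).
exists M => x rx; have B0 := reachable_ge0 rx; move: rx => [us [usB usP ->]].
apply: MP => [|u /usP[] //].
by rewrite ltnW // -(ltr_nat R) (le_lt_trans usB) // archi_boundP.
Qed.

(** The dilation by 2 multiplies the part of bidegree (a, b) by 2^(a i + b k), whereas coordinate j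
    requires 2^(i + k). Both a and b are positive in the nonzero parts, so only a = b = 1
    survives. *)
Lemma P_layers i k j v w : (0 < i)%N -> (0 < k)%N -> layer deg i v -> layer deg k w ->
  deg j = (i + k)%N -> P j v w = half_lie pol v w 0 j.
Proof.
move=> i0 k0 vi wk jE.
have p20 m : 2 ^+ m != 0 :> R by rewrite expf_neq0 // pnatr_eq0.
have c0 a b : (a < K)%N -> (b < K)%N ->
    bip j a b v w * (2 ^+ (a * i + b * k) - 2 ^+ (i + k)) = 0.
  apply: (@coef2_eq0 _ K (fun a b => bip j a b v w * (2 ^+ (a * i + b * k) - 2 ^+ (i + k)))).
  move=> c t; have := P_dilation G j (c *: v) (t *: w) (r := 2) ltac:(by rewrite pnatr_eq0).
  rewrite jE !dilationZ (dilation_layer 2 vi) (dilation_layer 2 wk) !scalerA !P_bipZ.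
  move/eqP; rewrite -subr_eq0 => /eqP e0; rewrite -[RHS]e0 mulr_sumr -sumrB; apply: eq_bigr => a' _.
  rewrite mulr_sumr -sumrB; apply: eq_bigr => b' _.
  rewrite !exprMn -!exprM exprD [(i * a')%N]mulnC [(k * b')%N]mulnC exprD; ring.
have bip0 a b : (1 < a + b)%N -> ((a, b) != (1, 1))%N -> bip j a b v w = 0.
  move=> ab2 ab1.
  have [Ka|aK] := leqP K a; first by rewrite bip_ge // Ka.
  have [Kb|bK] := leqP K b; first by rewrite bip_ge // Kb orbT.
  case: a ab2 ab1 aK => [|a] ab2 ab1 aK; first exact: bip_l0 G _ _ _ _.
  case: b ab2 ab1 bK => [|b] ab2 ab1 bK; first exact: bip_r0 G _ _ _ _.
  have /eqP := c0 _ _ aK bK; rewrite mulf_eq0 => /orP[/eqP //|].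
  rewrite subr_eq0 -!natrX eqr_nat eqn_exp2l // => /eqP e; exfalso.
  have : (a * i + b * k = 0)%N by lia.
  move/eqP; rewrite addn_eq0 !muln_eq0 (gtn_eqF i0) (gtn_eqF k0) !orbF => /andP[/eqP a0 /eqP b0].
  by move: ab1; rewrite a0 b0.
rewrite P_hom -/K.
have K2 : (2 < K + K)%N by [].
rewrite (bigD1 (Ordinal K2)) //= (hom_part2 G) big1 ?addr0 // => m m2.
have {}m2 : m <> 2%N :> nat by move=> m2'; case/eqP: m2; apply: val_inj.
have [ml|mg] := ltnP m 2; first exact: hom_part_lt2 G _ _ _ _ ml.
apply: big1 => a _; apply: big1 => b /eqP ab; apply: bip0; first by rewrite ab.
by apply/eqP => -[a1 b1]; apply: m2; rewrite -ab a1 b1.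
Qed.

(** To leading order the group commutator is the Lie bracket. Writing it as c ** (h ** u) = u ** h
    avoids expanding inverses: the first nonzero coordinates of c are differences of correction
    terms, given by [P_layers]. *)
Lemma commutator_filtration i u w h : (0 < i)%N -> layer deg 1 u -> layer deg i w ->
  filtration i h -> (forall j, deg j = i -> h 0 j = w 0 j) ->
  let c := u ** h ** (- u) ** (- h) in
  filtration i.+1 c /\ forall j, deg j = i.+1 -> c 0 j = lie pol u w 0 j.
Proof.
move=> i0 u1 wi hi hw; set c := _ ** _ ** _ ** _; lazy zeta.
have cE : c ** (h ** u) = u ** h by rewrite /c (gmulA G) (gmulVK G) (gmulVK G).
clearbody c.
have low j : (deg j <= i)%N -> P j u h = 0 /\ P j h u = 0.
  move=> ji; have h0 k : (deg k < deg j)%N -> h 0 k = (0 : 'rV[R]_n) 0 k.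
    by move=> kj; rewrite hi ?mxE // (leq_trans kj).
  split; first by rewrite (P_lower G (x' := u) (y' := 0)) // (P0r G).
  by rewrite (P_lower G (x' := 0) (y' := u)) // (P0l G).
have cj j : filtration (deg j) c -> c 0 j = P j u h - P j h u.
  move=> cl; have := congr1 (fun z => z 0 j) cE; rewrite !gmulE.
  rewrite (P_lower G (x := c) (x' := 0) (y := h ** u) (y' := h ** u)) ?(P0l G) //; first lra.
  by move=> k kj; rewrite cl // mxE.
have c0 : filtration i.+1 c.
  move=> j; have [d] := ubnP (deg j); elim: d j => // d IH j jd ji.
  rewrite cj; last by move=> k kj; apply: IH; [apply: leq_trans kj _|apply: ltn_trans kj _].
  by have [-> ->] := low j ji; rewrite subrr.
split=> // j ji; rewrite cj; last by rewrite ji.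
have hE k : (deg k < deg j)%N -> h 0 k = w 0 k.
  rewrite ji ltnS leq_eqVlt => /orP[/eqP|ki]; first exact: hw.
  by rewrite hi // wi // neq_ltn ki.
rewrite (P_lower G (x := u) (x' := u) (y := h) (y' := w)) //.
rewrite (P_lower G (x := h) (x' := w) (y := u) (y' := u)) //.
rewrite (P_layers (i := 1) (k := i)) // (P_layers (i := i) (k := 1)) ?addn1 //.
rewrite (half_lieC G w u) (lieE G) [X in _ - X]mxE [RHS]mxE; ring.
Qed.

(** [F] is realised in degree i by reachable elements, modulo higher degrees and uniformly on
    bounded sets. *)
Definition leading i (F : 'rV[R]_n -> 'rV[R]_n) := forall M : R, exists B, forall v,
  bounded_by M v -> exists g, [/\ reachable B g, filtration i g &
  forall j, deg j = i -> g 0 j = F v 0 j].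

Lemma filtration_mul i x y : filtration i x -> filtration i y ->
  filtration i (x ** y) /\ forall j, deg j = i -> (x ** y) 0 j = x 0 j + y 0 j.
Proof.
move=> xi yi.
have P0 j : (deg j <= i)%N -> P j x y = 0.
  move=> ji; rewrite (P_lower G (x' := 0) (y' := y)) ?(P0l G) // => k kj.
  by rewrite xi ?mxE // (leq_trans kj).
split=> j ji; rewrite gmulE P0 ?ji ?leqnn ?addr0 //; last exact: ltnW.
by rewrite xi // yi // addr0.
Qed.

Lemma leadingD i F F' : leading i F -> leading i F' -> leading i (fun v => F v + F' v).
Proof.
move=> FP F'P M; have [B BP] := FP M; have [B' B'P] := F'P M; exists (B + B') => v vM.
have [g [gB gi gF]] := BP v vM; have [g' [gB' gi' gF']] := B'P v vM.
have [h1 h2] := filtration_mul gi gi'; exists (g ** g'); split=> //.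
  exact: reachable_mul.
by move=> j ji; rewrite h2 // gF // gF' // mxE.
Qed.

Lemma leading0 i : leading i (fun=> 0).
Proof.
by move=> M; exists 0 => v _; exists 0; split=> //; [exact: reachable0|move=> j _; rewrite mxE].
Qed.

Lemma leading_sum i (I : Type) (r : seq I) (P : pred I) (F : I -> 'rV[R]_n -> 'rV[R]_n) :
  (forall k, P k -> leading i (F k)) -> leading i (fun v => \sum_(k <- r | P k) F k v).
Proof.
move=> FP; elim: r => [|k r IH].
  by under eq_fun do rewrite big_nil; apply: leading0.
under eq_fun do rewrite big_cons.
by case Pk: (P k) => //; apply: leadingD => //; apply: FP.
Qed.

Lemma leading_ext i (F F' : 'rV[R]_n -> 'rV[R]_n) : (forall v j, deg j = i -> F v 0 j = F' v 0 j) ->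
  leading i F -> leading i F'.
Proof.
move=> FF FP M; have [B BP] := FP M; exists B => v /BP[g [gB gi gF]].
by exists g; split=> // j ji; rewrite gF // FF.
Qed.

Lemma bounded_by_max x : exists M, 0 <= M /\ bounded_by M x.
Proof.
exists (\sum_j `|x 0 j|); split; first exact: sumr_ge0.
by move=> j; rewrite [leRHS](bigD1 j) //= lerDl sumr_ge0.
Qed.

(** Each basis vector of layer i + 1 is a combination of brackets with the first layer, and each
    bracket is realised by a group commutator. *)
Lemma leading_proj i : (0 < i)%N -> leading i (layer_proj deg i).
Proof.
case: i => // i _; elim: i => [|i IH].
  move=> M; exists (`|M| + 1) => v vM; exists (layer_proj deg 1 v); split=> //.
    apply: reachable_horizontal; first by rewrite lerDr.
      exact: layer_projP.
    move=> j; rewrite mxE; case: ifP => _; last by rewrite normr0 addr_ge0.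
    by apply: le_trans (vM j) (le_trans (ler_norm _) _); rewrite lerDl.
  by move=> j j1; rewrite mxE ifF //; apply/eqP => j1'; rewrite j1' in j1.
have [is_|si] := leqP i.+1 s; last first.
  apply: leading_ext (@leading0 i.+2) => v j ji; exfalso.
  by have /andP[_] := carnot_deg G j; lia.
(* The variable coefficient is put on the horizontal entry only, so the element h realising w is
   chosen once, independently of v. *)
have comm k u w : layer deg 1 u -> layer deg i.+1 w ->
    leading i.+2 (fun v => v 0 k *: lie pol u w).
  move=> u1 wi M.
  have [Mw [_ wM]] := bounded_by_max w; have [Mu [Mu0 uM]] := bounded_by_max u.
  have [B BP] := IH Mw; have [h [hB hi hw]] := BP w wM.
  pose B' := `|M| * Mu + 1; exists (B' + B + B' + B) => v vM.
  have vu1 : layer deg 1 (v 0 k *: u) by apply: layerZ.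
  have hw' j : deg j = i.+1 -> h 0 j = w 0 j by move=> ji; rewrite hw // mxE ji eqxx.
  have [c0 c1] := commutator_filtration (ltn0Sn i) vu1 wi hi hw'.
  have ru : reachable B' (v 0 k *: u).
    apply: reachable_horizontal => //; first by rewrite lerDr mulr_ge0.
    move=> j; rewrite mxE normrM; apply: (@le_trans _ _ (`|M| * Mu)); last by rewrite lerDl.
    by apply: ler_pM => //; apply: le_trans (vM k) (ler_norm _).
  exists (v 0 k *: u ** h ** - (v 0 k *: u) ** - h); split=> //.
    apply: reachable_mul; last exact: reachableN.
    by apply: reachable_mul; [exact: reachable_mul|exact: reachableN].
  move=> j ji; rewrite c1 //; congr (fun_of_matrix _ _ _).
  by rewrite !(lieE G) half_lieZl scalerA mulrC -scalerA.
have ej k : deg k = i.+2 -> leading i.+2 (fun v => v 0 k *: delta_mx 0 k).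
  move=> ki; have : layer deg i.+2 (delta_mx 0 k : 'rV[R]_n).
    by move=> j ji; rewrite mxE eqxx /=; case: eqP => // jk; rewrite jk ki eqxx in ji.
  rewrite -(carnot_strat G (i := i.+1)) // => -[m [a [u [uP ->]]]].
  apply: (@leading_ext _ (fun v => \sum_l v 0 k *: (a l *: u l))).
    by move=> v j _; rewrite scaler_sumr.
  apply: leading_sum => l _; have [v1 v1P [v2 v2P <-]] := uP l.
  apply: (@leading_ext _ (fun v => v 0 k *: lie pol (a l *: v1) v2)).
    by move=> v j _; rewrite !(lieE G) half_lieZl !scalerA; congr (fun_of_matrix (_ *: _) _ _); ring.
  by apply: comm => //; apply: layerZ.
apply: (@leading_ext _ (fun v => \sum_(k | deg k == i.+2) v 0 k *: delta_mx 0 k)).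
  move=> v j ji; rewrite summxE (bigD1 j) ?ji //= !mxE !eqxx mulr1 ji eqxx.
  by rewrite big1 ?addr0 // => k /andP[_ kj]; rewrite !mxE eqxx eq_sym (negbTE kj) mulr0.
by apply: leading_sum => k /eqP; apply: ej.
Qed.

(** Descending induction on i: dividing x on the left by a reachable element with the same
    coordinates of degree i gives a bounded element of the next filtration step. *)
Lemma reachable_filtration i : (0 < i)%N -> forall M : R, exists B, forall x,
  filtration i x -> bounded_by M x -> reachable B x.
Proof.
have [d] := ubnP (s.+1 - i)%N; elim: d i => // d IH i di i0 M.
have [is_|si] := leqP i s; last first.
  exists 0 => x xi _; have -> : x = 0; last exact: reachable0.
  apply/rowP => j; rewrite xi ?mxE //.
  by have /andP[_ js] := carnot_deg G j; apply: leq_ltn_trans js si.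
have [B BP] := leading_proj i0 M.
have [Mh hM] := reachable_bounded B.
have [C [C0 CP]] := gmul_bounded (Num.max M Mh).
have [|B' B'P] := IH i.+1 _ isT C; first by move: di is_; lia.
exists (B + B') => x xi xM; have [h [hB hi hx]] := BP x xM.
have -> : x = h ** (- h ** x) by rewrite (gmulNK G).
apply: reachable_mul => //; apply: B'P; last first.
  apply: CP; last by apply: bounded_by_le xM; rewrite le_max lexx.
  by apply: bounded_byN; apply: bounded_by_le (hM _ hB); rewrite le_max lexx orbT.
have hNi : filtration i (- h) by move=> j ji; rewrite mxE hi // oppr0.
have [f1 f2] := filtration_mul hNi xi.
move=> j; rewrite ltnS leq_eqVlt => /orP[/eqP ji|]; last exact: f1.
by rewrite f2 // mxE hx // mxE ji eqxx addNr.
Qed.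

Lemma reachable_unit_box : exists B, forall x, bounded_by 1 x -> reachable B x.
Proof.
have [B BP] := @reachable_filtration 1%N isT 1; exists B => x; apply: BP => j.
by rewrite ltnS leqn0 => /eqP j0; have := deg_ge1 G j; rewrite j0.
Qed.

End Reachability.

(** * Derivatives of polynomial expressions along curves *)

Section CurveCalculus.
Variable R : realType.

Lemma derive_integral_bound (F F' N : R -> R) (c l : R) :
  (forall t, is_derive (t : R) (1 : R) F (F' t)) -> continuous F' -> continuous N -> 0 <= c ->
  (forall t, 0 <= N t) -> (forall t, 0 <= t <= 1 -> `|F' t| <= c * N t) ->
  l = \int[lebesgue_measure]_(t in `[0, 1]) N t ->
  forall t, 0 <= t <= 1 -> `|F t - F 0| <= c * l.
Proof.
move=> dF cF' cN c0 N0 F'N lE t /andP[t0 t1].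
have l0 : 0 <= l by rewrite lE; apply: Rintegral_ge0.
move: t0; rewrite le_eqVlt => /orP[/eqP <-|t0]; first by rewrite subrr normr0 mulr_ge0.
have cF x : {for x, continuous F}.
  by apply/differentiable_continuous/derivable1_diffP; have [] := dF x.
have cont_within (f : R -> R) (A : set R) : continuous f -> {within A, continuous f}.
  by move=> cf; apply: continuous_subspaceT.
have int (f : R -> R) b : continuous f ->
    lebesgue_measure.-integrable (`[0, b] : set R) (EFin \o f).
  move=> cf; apply: continuous_compact_integrable; first exact: segment_compact.
  exact: cont_within.
have ftc : \int[lebesgue_measure]_(x in `[0, t]) F' x = F t - F 0.
  rewrite /Rintegral (@continuous_FTC2 _ F' F) //.
  - exact: cont_within.
  - split; first by move=> x _; have [] := dF x.
      by apply: cvg_at_right_filter; apply: cF.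
    by apply: cvg_at_left_filter; apply: cF.
  - by move=> x _; rewrite derive1E; have [_ ->] := dF x.
rewrite -ftc; apply: le_trans (le_normr_Rintegral _ (int _ t cF')) _; first exact: measurable_itv.
apply: (@le_trans _ _ (\int[lebesgue_measure]_(x in `[0, t]) (c * N x))).
  apply: le_Rintegral; first exact: measurable_itv.
  - by apply: int => x; apply: continuous_comp; [apply: cF'|apply: norm_continuous].
  - by apply: int => x; apply: cvgM; [exact: cvg_cst|exact: cN].
  - move=> x /=; rewrite in_itv /= => /andP[x0 xt]; apply: F'N.
    by rewrite x0 (le_trans xt).
rewrite RintegralZl ?measurable_itv //; last exact: int.
rewrite ler_wpM2l // lE -lee_fin /Rintegral !fineK; last 2 first.
- exact: integrable_fin_num (int N 1 cN).
- exact: integrable_fin_num (int N t cN).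
apply: ge0_subset_integral; try exact: measurable_itv.
- by have /integrableP[] := int N 1 cN.
- by move=> x _; rewrite lee_fin.
by move=> x /=; rewrite !in_itv /= => /andP[-> xt]; apply: le_trans t1.
Qed.

Lemma derivable_coord n (f : R -> 'rV[R]_n) t : derivable f t 1 ->
  forall j, is_derive (t : R) (1 : R) (fun s => f s 0 j) (('D_1 f t) 0 j).
Proof.
move=> df j.
have h : (fun h => h^-1 *: (((fun s => f s 0 j) \o shift t) (h *: (1:R)) - f t 0 j)) @ 0^' -->
    ('D_1 f t) 0 j.
  have cj := @coord_continuous R 1 n 0 j ('D_1 f t).
  have h1 := continuous_cvg _ cj df.
  apply: cvg_trans; last exact: (h1 _).
  by apply: near_eq_cvg; near=> z; rewrite /= !mxE.
split; first by apply/cvg_ex; exists (('D_1 f t) 0 j).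
exact: cvg_lim h.
Unshelve. all: by end_near. Qed.

Variable N : nat.
Implicit Types f g : ('I_N -> R) -> R.

Definition curve_continuous f := forall (z : R -> 'I_N -> R) t,
  (forall i, {for t, continuous (fun s => z s i)}) -> {for t, continuous (fun s => f (z s))}.

(** The chain rule is built into the definition, so that it passes through sums and products without
    differentials of functions of several variables. *)
Definition curve_differentiable f := exists grad : 'I_N -> ('I_N -> R) -> R,
  (forall i, curve_continuous (grad i)) /\ forall (z : R -> 'I_N -> R) t dz,
  (forall i, is_derive (t : R) (1 : R) (fun s => z s i) (dz i)) ->
  is_derive (t : R) (1 : R) (fun s => f (z s)) (\sum_i grad i (z t) * dz i).

Lemma curve_continuous_cst c : curve_continuous (fun=> c).
Proof. by move=> z t _; apply: cst_continuous. Qed.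

Lemma curve_continuous_coord i : curve_continuous (fun x => x i).
Proof. by move=> z t; apply. Qed.

Lemma curve_continuousD f g : curve_continuous f -> curve_continuous g ->
  curve_continuous (fun x => f x + g x).
Proof. by move=> cf cg z t zt; apply: cvgD; [apply: cf|apply: cg]. Qed.

Lemma curve_continuousM f g : curve_continuous f -> curve_continuous g ->
  curve_continuous (fun x => f x * g x).
Proof. by move=> cf cg z t zt; apply: cvgM; [apply: cf|apply: cg]. Qed.

Lemma curve_differentiable_cst c : curve_differentiable (fun=> c).
Proof.
exists (fun _ _ => 0); split=> [i|z t dz _]; first exact: curve_continuous_cst.
by rewrite big1 => [|i _]; rewrite ?mul0r //; apply: is_derive_cst.
Qed.

Lemma curve_differentiable_coord i : curve_differentiable (fun x => x i).
Proof.
exists (fun k _ => (k == i)%:R); split=> [k|z t dz dzP]; first exact: curve_continuous_cst.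
rewrite (bigD1 i) //= eqxx mul1r big1 ?addr0 //.
by move=> k /negbTE ->; rewrite mul0r.
Qed.

Lemma curve_differentiableD f g : curve_differentiable f -> curve_differentiable g ->
  curve_differentiable (fun x => f x + g x).
Proof.
move=> [df [cf hf]] [dg [cg hg]]; exists (fun i x => df i x + dg i x); split=> [i|z t dz dzP].
  exact: curve_continuousD.
under eq_bigr do rewrite mulrDl.
by rewrite big_split; exact: is_deriveD (hf z t dz dzP) (hg z t dz dzP).
Qed.

Lemma curve_differentiableM f g : curve_continuous f -> curve_continuous g ->
  curve_differentiable f -> curve_differentiable g -> curve_differentiable (fun x => f x * g x).
Proof.
move=> fc gc [df [cf hf]] [dg [cg hg]].
exists (fun i x => f x * dg i x + g x * df i x); split=> [i|z t dz dzP].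
  by apply: curve_continuousD; apply: curve_continuousM.
under eq_bigr do rewrite mulrDl -!mulrA.
by rewrite big_split -!mulr_sumr; exact: is_deriveM (hf z t dz dzP) (hg z t dz dzP).
Qed.

Lemma mono_sum_curve (p : mpoly N R) P :
  curve_continuous (mono_sum p P) /\ curve_differentiable (mono_sum p P).
Proof.
apply: (@mono_sum_ind _ _ _ (fun f => curve_continuous f /\ curve_differentiable f)) => [c|i||].
- by split; [apply: curve_continuous_cst|apply: curve_differentiable_cst].
- by split; [apply: curve_continuous_coord|apply: curve_differentiable_coord].
- by move=> f g [f1 f2] [g1 g2]; split; [apply: curve_continuousD|apply: curve_differentiableD].
by move=> f g [f1 f2] [g1 g2]; split; [apply: curve_continuousM|apply: curve_differentiableM].
Qed.

End CurveCalculus.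

Section HorizontalNorm.
Variables (R : realType) (n : nat) (deg : 'I_n -> nat) (ip : 'rV[R]_n -> 'rV[R]_n -> R).
Hypothesis ip_inner : inner_product_on (layer deg 1) ip.
Implicit Types u v w : 'rV[R]_n.

(** A basis of the first layer padded by zeros, so that sums and matrices keep the index type
    ['I_n]. *)
Let E j : 'rV[R]_n := if deg j == 1%N then delta_mx 0 j else 0.

Let E_layer j : layer deg 1 (E j).
Proof.
move=> k k1; rewrite /E; case: ifP => [/eqP j1|_]; rewrite mxE //=.
by case: eqP => // kj; rewrite kj j1 in k1.
Qed.

Let sum_E u : layer deg 1 u -> u = \sum_j u 0 j *: E j.
Proof.
move=> u1; rewrite {1}[u]row_sum_delta; apply: eq_bigr => j _; rewrite /E.
by case: ifPn => // j1; rewrite u1 // !scale0r.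
Qed.

Let ipC u v : layer deg 1 u -> layer deg 1 v -> ip u v = ip v u.
Proof. by have [h _ _] := ip_inner; apply: h. Qed.

Let lay0 : layer deg 1 (0 : 'rV[R]_n). Proof. by move=> j _; rewrite mxE. Qed.

Let ip0 w : layer deg 1 w -> ip 0 w = 0.
Proof.
move=> w1; have [_ h _] := ip_inner; have := h 1 0 0 w lay0 lay0 w1.
rewrite scaler0 addr0; lra.
Qed.

Let layD c u v : layer deg 1 u -> layer deg 1 v -> layer deg 1 (c *: u + v).
Proof. by move=> u1 v1 j j1; rewrite !mxE u1 // v1 // mulr0 addr0. Qed.

Let lay_sum (r : seq 'I_n) (a : 'I_n -> R) : layer deg 1 (\sum_(j <- r) a j *: E j).
Proof.
elim: r => [|j r IH]; first by rewrite big_nil; apply: lay0.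
by rewrite big_cons; apply: layD.
Qed.

Lemma ip_suml (r : seq 'I_n) (a : 'I_n -> R) w : layer deg 1 w ->
  ip (\sum_(j <- r) a j *: E j) w = \sum_(j <- r) a j * ip (E j) w.
Proof.
move=> w1; have [_ h _] := ip_inner; elim: r => [|j r IH]; first by rewrite !big_nil ip0.
by rewrite !big_cons h // IH.
Qed.

Definition gram j k := ip (E j) (E k).

Lemma ip_gram u v : layer deg 1 u -> layer deg 1 v ->
  ip u v = \sum_j \sum_k u 0 j * v 0 k * gram j k.
Proof.
move=> u1 v1; rewrite {1}(sum_E u1) ip_suml //; apply: eq_bigr => j _.
rewrite ipC // {1}(sum_E v1) ip_suml // mulr_sumr; apply: eq_bigr => k _.
by rewrite ipC // mulrA.
Qed.

Lemma ip_ge0 u : layer deg 1 u -> 0 <= ip u u.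
Proof.
move=> u1; have [->|u0] := eqVneq u 0; first by rewrite ip0.
by have [_ _ h] := ip_inner; apply/ltW/h.
Qed.

Lemma horizontal_norm_le : exists C, 0 <= C /\ forall u M, layer deg 1 u ->
  (forall j, `|u 0 j| <= M) -> 0 <= M -> Num.sqrt (ip u u) <= C * M.
Proof.
exists (Num.sqrt (\sum_j \sum_k `|gram j k|)); split; first exact: sqrtr_ge0.
move=> u M u1 uM M0.
rewrite -[X in _ <= _ * X]ger0_norm // -sqrtr_sqr -sqrtrM; last first.
  by apply: sumr_ge0 => j _; apply: sumr_ge0.
rewrite ler_wsqrtr // ip_gram // mulr_suml; apply: ler_sum => j _.
rewrite mulr_suml; apply: ler_sum => k _.
apply: le_trans (ler_norm _) _; rewrite !normrM mulrC ler_wpM2l // expr2.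
by rewrite ler_pM.
Qed.

Lemma ip_cauchy u w : layer deg 1 u -> layer deg 1 w ->
  `|ip u w| <= Num.sqrt (ip u u) * Num.sqrt (ip w w).
Proof.
move=> u1 w1; rewrite -sqrtrM ?ip_ge0 // -sqrtr_sqr ler_wsqrtr //.
have [->|w0] := eqVneq w 0; first by rewrite ipC // ip0 // expr0n /= ip0 // mulr0.
have [_ lin pos] := ip_inner; have pw := pos w w1 w0.
pose t := ip u w / ip w w.
have v1 : layer deg 1 (- t *: w + u) by apply: layD.
have := ip_ge0 v1; rewrite lin // [ip w _]ipC // [ip u (_ + _)]ipC // !lin // [ip w u]ipC //.
have tE : t * ip w w = ip u w by rewrite divfK // gt_eqF.
move=> h; have {}h : 0 <= ip u u - t * ip u w by move: h; rewrite -{1 2 3}tE; nra.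
have := mulr_ge0 (ltW pw) h; rewrite -tE; nra.
Qed.

(* The coordinates of u are recovered from its products with the basis of the
   first layer, by inverting the Gram matrix. *)
Lemma horizontal_coord_le : exists C, 0 <= C /\ forall u, layer deg 1 u ->
  forall j, `|u 0 j| <= C * Num.sqrt (ip u u).
Proof.
(* The Gram matrix is completed by the identity on the coordinates outside the first layer; [qA]
   shows that the resulting form is positive definite, hence the matrix is invertible. *)
pose A : 'M[R]_n := \matrix_(j, k) (gram j k + ((j == k) && (deg j != 1%N))%:R).
have qA (w : 'rV[R]_n) : (w *m A *m w^T) 0 0 =
    ip (\sum_j w 0 j *: E j) (\sum_j w 0 j *: E j) + \sum_(j | deg j != 1%N) w 0 j ^+ 2.
  transitivity (\sum_k \sum_j (w 0 j * gram j k * w 0 k +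
      w 0 j * ((j == k) && (deg j != 1%N))%:R * w 0 k)).
    rewrite mxE; apply: eq_bigr => k _; rewrite mxE [w^T _ _]mxE mulr_suml.
    by apply: eq_bigr => j _; rewrite mxE; ring.
  under eq_bigr do rewrite big_split /=.
  rewrite big_split /=; congr (_ + _).
    rewrite ip_suml ?lay_sum // exchange_big /=; apply: eq_bigr => j _.
    rewrite ipC ?lay_sum // ip_suml // mulr_sumr; apply: eq_bigr => k _.
    by rewrite /gram (ipC (E_layer j) (E_layer k)); ring.
  rewrite [RHS]big_mkcond; apply: eq_bigr => k _; rewrite (bigD1 k) //= eqxx big1 ?addr0 /=.
    by case: ifP => _; rewrite ?mulr1 ?mulr0 ?mul0r // expr2.
  by move=> j /negbTE ->; rewrite mulr0 mul0r.
have Aunit : A \in unitmx.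
  rewrite -row_free_unit; apply: inj_row_free => w wA.
  have := qA w; rewrite wA mul0mx mxE => /esym/eqP.
  have s0 : 0 <= \sum_(j | deg j != 1%N) w 0 j ^+ 2 by apply: sumr_ge0 => j _; apply: sqr_ge0.
  rewrite paddr_eq0 ?ip_ge0 ?lay_sum // => /andP[/eqP ip_v0].
  rewrite psumr_eq0 => [/allP h|j _]; last exact: sqr_ge0.
  have [_ _ pos] := ip_inner.
  have v0 : \sum_j w 0 j *: E j = 0.
    apply/eqP; apply: contraT => /(pos _ (lay_sum _ _)); by rewrite ip_v0 ltxx.
  apply/rowP => j; rewrite [RHS]mxE; have [j1|j1] := eqVneq (deg j) 1%N.
    have := congr1 (fun z : 'rV[R]_n => z 0 j) v0; rewrite summxE [RHS]mxE.
    rewrite (bigD1 j) //= big1 ?addr0.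
      by rewrite /E j1 eqxx !mxE !eqxx mulr1.
    by move=> k kj; rewrite /E; case: ifP => _; rewrite !mxE ?eqxx /= ?(eq_sym j) ?(negbTE kj) mulr0.
  by have := h j (mem_index_enum j); rewrite j1 /= sqrf_eq0 => /eqP.
exists (\sum_k \sum_j Num.sqrt (gram k k) * `|invmx A k j|); split.
  by apply: sumr_ge0 => k _; apply: sumr_ge0 => j _; rewrite mulr_ge0 ?sqrtr_ge0.
move=> u u1 j.
have uA k : (u *m A) 0 k = ip u (E k).
  rewrite {2}(sum_E u1) ip_suml // mxE; apply: eq_bigr => i _; rewrite mxE mulrDr.
  have [->|ik] := eqVneq i k; last by rewrite mulr0 addr0.
  by have [k1|k1] := eqVneq (deg k) 1%N; rewrite ?mulr0 ?addr0 // u1 // !mul0r addr0.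
rewrite -{1}(mulmxK Aunit u) mxE mulr_suml; apply: le_trans (ler_norm_sum _ _ _) _.
apply: ler_sum => k _; rewrite uA normrM.
apply: (@le_trans _ _ (Num.sqrt (gram k k) * `|invmx A k j| * Num.sqrt (ip u u))).
  by rewrite mulrAC ler_wpM2r // mulrC ip_cauchy.
rewrite ler_wpM2r ?sqrtr_ge0 // (bigD1 j) //= lerDl; apply: sumr_ge0 => i _.
by rewrite mulr_ge0 ?sqrtr_ge0.
Qed.

End HorizontalNorm.

(** * Two-sided comparison of the Carnot distance with boxes *)

Section BallBox.
Variables (R : realType) (n s : nat) (deg : 'I_n -> nat) (pol : 'I_n -> mpoly (n + n) R).
Hypothesis G : carnot deg pol s.
Variable ip : 'rV[R]_n -> 'rV[R]_n -> R.
Hypothesis ip_inner : inner_product_on (layer deg 1) ip.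
Implicit Types x y z u v w g h o : 'rV[R]_n.
Local Notation "x ** y" := (gmul pol x y) (at level 40, left associativity).
Local Notation P j := (pair_eval (pol j)).
Local Notation bip j := (bipart (pol j)).
Local Notation K := (hom_bound pol).
Local Notation lfp := (left_field_part pol).

Lemma translated_line_derive x u t :
  derivable (fun s : R => x ** (s *: u)) t 1 /\
  'D_1 (fun s : R => x ** (s *: u)) t = left_field pol u (x ** (t *: u)).
Proof.
have [dG _] := gmul_derive pol u (x ** (t *: u)).
have e : (fun h : R => h^-1 *: (((fun s : R => x ** (s *: u)) \o shift t) (h *: (1 : R)) -
    (fun s : R => x ** (s *: u)) t)) =
    (fun h : R => h^-1 *: ((gmul pol (x ** (t *: u)) \o shift 0) (h *: u) - gmul pol (x ** (t *: u)) 0)).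
  apply/funext => h /=; rewrite addr0 (gmul0r G) -(gmulA G) (carnot_lines G).
  by rewrite /GRing.scale /= mulr1 [t + h]addrC.
by split; rewrite /derivable /left_field /derive e.
Qed.

Lemma poly_fun_translated_line x u j : poly_fun (fun t : R => (x ** (t *: u)) 0 j).
Proof.
under eq_fun do rewrite gmulE.
apply: poly_funD; first apply: poly_funD; first exact: poly_fun_cst.
  by under eq_fun do rewrite mxE; apply: poly_funM; [exact: poly_fun_id|exact: poly_fun_cst].
rewrite /pair_eval; under eq_fun do rewrite meval_mono_sum.
apply: poly_fun_mono_sum => i; case: (split_ordP i) => k ->.
  by under eq_fun do rewrite row_mxEl; exact: poly_fun_cst.
under eq_fun do rewrite row_mxEr mxE.
by apply: poly_funM; [exact: poly_fun_id|exact: poly_fun_cst].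
Qed.

Lemma continuous_poly_row (f : R -> 'rV[R]_n) :
  (forall j, poly_fun (fun t => f t 0 j)) -> continuous f.
Proof.
move=> fP t; apply: row_cvg => j; have [p pP] := fP j.
have -> : (fun t0 : R => f t0 0 j) = horner p by apply/funext.
by rewrite pP; apply: continuous_horner.
Qed.

Lemma horizontal_arc_line x u : layer deg 1 u ->
  horizontal_arc deg pol ip x (x ** u) (Num.sqrt (ip u u)).
Proof.
move=> u1; exists (fun t => x ** (t *: u)), (fun=> u); split.
- split=> [t|]; first by have [] := translated_line_derive x u t.
  have -> : derive1 (fun t => x ** (t *: u)) = fun t => left_field pol u (x ** (t *: u)).
    by apply/funext => t; rewrite derive1E; have [_ ->] := translated_line_derive x u t.
  apply: continuous_poly_row => j; under eq_fun do rewrite left_fieldE.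
  apply: poly_funD; first exact: poly_fun_cst.
  apply: poly_fun_sum => a _; apply: poly_fun_bipart => k.
    exact: poly_fun_translated_line.
  exact: poly_fun_cst.
- by rewrite scale0r scale1r (gmul0r G).
- by move=> t _; split; [exact: u1|rewrite derive1E; exact: (translated_line_derive x u t).2].
- rewrite Rintegral_cst; last exact: measurable_itv.
  have m1 := @lebesgue_measure_itv R `[0, 1]%R.
  rewrite /= lte_fin ltr01 sube0 in m1.
  rewrite -[LHS]mulr1; congr (_ * _); exact: (esym (congr1 fine m1)).
Qed.

Lemma gprod_dilation r us : r != 0 -> (forall u, u \in us -> layer deg 1 u) ->
  dilation deg r (gprod pol us) = gprod pol [seq r *: u | u <- us].
Proof.
move=> r0; elim: us => [|u us IH] usP /=; first by apply/rowP => j; rewrite !mxE mulr0.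
rewrite (gmul_dilation G) // IH; last by move=> v vus; apply: usP; rewrite in_cons vus orbT.
by rewrite (dilation_layer r (usP u (mem_head _ _))) expr1.
Qed.

Lemma horizontal_path_gprod us x : (forall u, u \in us -> layer deg 1 u) ->
  horizontal_path deg pol ip x (x ** gprod pol us) (\sum_(u <- us) Num.sqrt (ip u u)).
Proof.
elim: us x => [|u us IH] x usP /=.
  by rewrite big_nil (gmul0r G); apply: horizontal_path_nil.
rewrite big_cons (gmulA G); apply: horizontal_path_cons.
  by apply: horizontal_arc_line; apply: usP; rewrite mem_head.
by apply: IH => v vus; apply: usP; rewrite in_cons vus orbT.
Qed.

Lemma carnot_dist_lt : exists c : R, 0 < c /\ forall r x y, 0 < r ->
  (forall j, `|((- x) ** y) 0 j| <= (c * r) ^+ deg j) ->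
  (carnot_dist deg pol ip x y < r%:E)%E.
Proof.
have [B BP] := reachable_unit_box G.
have B0 : 0 <= B.
  by apply: reachable_ge0 (BP 0 _) => j; rewrite mxE normr0.
have [C [C0 CP]] := horizontal_norm_le ip_inner.
(* After rescaling by rho = c r at most B factors are used, each of length at most C rho B. The
   total C B B rho is below r thanks to the added 1. *)
pose c : R := (C * B * B + 1)^-1.
have D0 : 0 < C * B * B + 1 by rewrite ltr_wpDl ?mulr_ge0.
have c0 : 0 < c by rewrite invr_gt0.
exists c; split=> // r x y r0 xy; pose rho := c * r.
have rho0 : 0 < rho by rewrite mulr_gt0.
have [us [usB usP usE]] : reachable deg pol B (dilation deg rho^-1 ((- x) ** y)).
  apply: BP => j; rewrite mxE normrM ger0_norm ?exprn_ge0 ?invr_ge0 ?(ltW rho0) //.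
  by rewrite exprVn [_^-1 * _]mulrC ler_pdivrMr ?exprn_gt0 // mul1r.
have yE : y = x ** gprod pol [seq rho *: u | u <- us].
  rewrite -gprod_dilation ?gt_eqF // => [|u /usP[] //].
  rewrite -usE -dilationM mulfV ?gt_eqF // dilation1.
  by rewrite (gmulNK G).
apply: (@le_lt_trans _ _ ((\sum_(u <- [seq rho *: u | u <- us]) Num.sqrt (ip u u))%:E)).
  apply: ereal_inf_lbound; eexists; last reflexivity.
  rewrite {1}yE; apply: horizontal_path_gprod => _ /mapP[u uus ->].
  by apply: layerZ; have [] := usP u uus.
rewrite lte_fin big_map; apply: (@le_lt_trans _ _ (\sum_(u <- us) C * (rho * B))).
  rewrite big_seq [leRHS]big_seq; apply: ler_sum => u uus; have [u1 uB] := usP u uus.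
  apply: CP; [exact: layerZ| |by rewrite mulr_ge0 // ltW].
  by move=> j; rewrite mxE normrM gtr0_norm // ler_wpM2l // ltW.
rewrite big_const_seq count_predT iter_addr_0 -mulr_natl.
apply: (@le_lt_trans _ _ (B * (C * (rho * B)))).
  by rewrite ler_wpM2r // mulr_ge0 // mulr_ge0 // ltW.
have -> : B * (C * (rho * B)) = (C * B * B) / (C * B * B + 1) * r.
  by rewrite /rho /c; ring.
by rewrite gtr_pMl // ltr_pdivrMr // mul1r ltrDl.
Qed.

Lemma lfp_lower j x x' u : (forall k, (deg k < deg j)%N -> x 0 k = x' 0 k) ->
  lfp j x u = lfp j x' u.
Proof. by move=> xx'; apply: eq_bigr => a _; apply: (mono_lower G). Qed.

Lemma lfp_deg1 j x u : deg j = 1%N -> lfp j x u = 0.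
Proof.
move=> j1; apply: big1 => a _.
(* No coordinate has degree below 1, so the arguments can be changed freely; linearity in the second
   one then gives 0. *)
have -> : bip j a 1 x u = bip j a 1 (1 *: x) (0 *: u).
  apply: (mono_lower G) => k; rewrite j1 ltnS leqn0 => /eqP k0;
  by have := deg_ge1 G k; rewrite k0.
by rewrite bipartZ expr1 mulr0 mul0r.
Qed.

(** The coefficients of h in [P_dilation] at (x, h u) are compared. The horizontal vector u takes
    one factor A, which leaves weight deg j - 1 in x. *)
Lemma lfp_dilation j A x u : A != 0 -> layer deg 1 u ->
  lfp j (dilation deg A x) u = A ^+ (deg j).-1 * lfp j x u.
Proof.
move=> A0 u1; pose c b := \sum_(a < K) (bip j a b (dilation deg A x) u * A ^+ b -
  A ^+ deg j * bip j a b x u).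
have /(_ 1%N isT) : forall b, (b < K)%N -> c b = 0.
  apply: coef_eq0 => h; have := P_dilation G j x (h *: u) A0.
  rewrite dilationZ (dilation_layer A u1) expr1 scalerA.
  rewrite -[dilation deg A x]scale1r -[x in P j x (h *: u)]scale1r !P_bipZ => /eqP.
  rewrite -subr_eq0 => /eqP e; rewrite -[RHS]e mulr_sumr -sumrB /c.
  under eq_bigr do rewrite mulr_suml.
  rewrite exchange_big /=; apply: eq_bigr => a _; rewrite mulr_sumr -sumrB.
  by apply: eq_bigr => b _; rewrite expr1n exprMn; ring.
rewrite /c sumrB -mulr_suml -mulr_sumr expr1 => /eqP; rewrite subr_eq0 => /eqP h.
apply: (mulIf A0); rewrite h mulrAC -exprSr prednK // (deg_ge1 G).
by [].
Qed.

Lemma lfp_bounded j (M : R) : exists B, 0 <= B /\ forall x u m,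
  bounded_by M x -> bounded_by m u -> 0 <= m -> `|lfp j x u| <= B * m.
Proof.
have lip : loc_lipschitz (fun z : 'I_(n + n) -> R => \sum_(a < K) mono_sum (pol j)
    (fun m => (left_degree m == a) && (right_degree m == 1)%N) z).
  by apply: loc_lipschitz_sum => a _; apply: loc_lipschitz_mono_sum.
have [C CP] := lip (`|M| + 1).
exists (\sum_(k < n) `|C|); split; first exact: sumr_ge0.
move=> x u m xM um m0.
have -> : lfp j x u = \sum_k u 0 k * lfp j x (delta_mx 0 k).
  rewrite {1}[u]row_sum_delta; elim: (index_enum _) => [|k r IH].
    rewrite !big_nil; have := left_field_partZ pol j x 1 0 0.
    by rewrite scaler0 addr0 mul1r => /eqP; rewrite -subr_eq0 opprD addrA subrr sub0r oppr_eq0 => /eqP.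
  by rewrite !big_cons left_field_partZ IH.
apply: le_trans (ler_norm_sum _ _ _) _; rewrite mulr_suml; apply: ler_sum => k _.
rewrite normrM mulrC ler_pM //.
have xb i : `|(row_mx x (delta_mx 0 k) : 'rV[R]_(n + n)) 0 i| <= `|M| + 1.
  case: (split_ordP i) => l ->; rewrite ?row_mxEl ?row_mxEr.
    by apply: le_trans (xM l) (le_trans (ler_norm _) _); rewrite lerDl.
  have M0 : 0 <= `|M| by [].
  by rewrite mxE eqxx /=; case: (_ == _); rewrite ?mulr1n ?mulr0n ?normr1 ?normr0; lra.
have x0 i : `|(row_mx x (delta_mx 0 k) : 'rV[R]_(n + n)) 0 i -
   (row_mx x (delta_mx 0 k) : 'rV[R]_(n + n)) 0 i| <= 0 by rewrite subrr normr0.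
have [h _] := CP _ _ 0 xb xb (lexx _) x0.
by apply: le_trans h (ler_norm _).
Qed.

Lemma left_field_bound j (C : R) : exists B, 0 <= B /\ forall A w u m, 0 < A ->
  layer deg 1 u -> bounded_by m u -> 0 <= m ->
  (forall k, (deg k < deg j)%N -> `|w 0 k| <= C * A ^+ deg k) ->
  `|left_field pol u w 0 j| <= B * A ^+ (deg j).-1 * m.
Proof.
have [B [B0 BP]] := lfp_bounded j `|C|; exists (B + 1); split; first exact: addr_ge0.
move=> A w u m A0 u1 um m0 wC; rewrite left_fieldE.
(* Only coordinates of lower degree are controlled, and only they enter [lfp j]; the others are set
   to 0 before rescaling to bounded size. *)
pose w0 : 'rV[R]_n := \row_k (if (deg k < deg j)%N then w 0 k else 0).
pose x := dilation deg A^-1 w0.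
have -> : lfp j w u = A ^+ (deg j).-1 * lfp j x u.
  rewrite -(lfp_dilation j x (lt0r_neq0 A0) u1) /x -dilationM mulfV ?gt_eqF // dilation1.
  by apply: lfp_lower => k kj; rewrite mxE kj.
have xC : bounded_by `|C| x.
  move=> k; rewrite !mxE; case: ifP => [kj|_]; last by rewrite mulr0 normr0.
  rewrite normrM ger0_norm ?exprn_ge0 ?invr_ge0 ?(ltW A0) //.
  rewrite exprVn [_^-1 * _]mulrC ler_pdivrMr ?exprn_gt0 //.
  by apply: le_trans (wC k kj) _; rewrite ler_wpM2r ?ler_norm // exprn_ge0 // ltW.
have Ad : 0 <= A ^+ (deg j).-1 by rewrite exprn_ge0 // ltW.
apply: le_trans (ler_normD _ _) _; rewrite addrC 2!mulrDl mul1r lerD //.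
  by rewrite normrM (ger0_norm Ad) -mulrA mulrCA ler_wpM2l // BP.
have [j1|j1] := eqVneq (deg j) 1%N; first by rewrite j1 expr0 mul1r.
by rewrite u1 // normr0 mulr_ge0.
Qed.

(** [D y dy] is coordinate j of the differential at y of the left translation by o. Its continuity
    makes the fundamental theorem of calculus available. *)
Lemma gmul_chain o j : exists D : 'rV[R]_n -> 'rV[R]_n -> R,
  (forall (y : R -> 'rV[R]_n) (t : R) (dy : 'rV[R]_n),
    (forall k, is_derive (t : R) (1 : R) (fun s => y s 0 k) (dy 0 k)) ->
    is_derive (t : R) (1 : R) (fun s => (o ** y s) 0 j) (D (y t) dy)) /\
  (forall (y dy : R -> 'rV[R]_n) (t : R), (forall k, {for t, continuous (fun s => y s 0 k)}) ->
    (forall k, {for t, continuous (fun s => dy s 0 k)}) -> {for t, continuous (fun s => D (y s) (dy s))}).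
Proof.
have [grad [gradc gradP]] := (mono_sum_curve (pol j) xpredT).2.
pose dr (dy : 'rV[R]_n) (i : 'I_(n + n)) := (row_mx 0 dy : 'rV[R]_(n + n)) 0 i.
exists (fun y (dy : 'rV[R]_n) => dy 0 j + \sum_i grad i (fun i => (row_mx o y : 'rV[R]_(n + n)) 0 i) * dr dy i).
split=> [y t dy dyP|y dy t yc dyc].
  under eq_fun do rewrite gmulE /pair_eval meval_mono_sum.
  have d1 : is_derive (t : R) (1 : R) (fun s => o 0 j + y s 0 j) (dy 0 j).
    by have := is_deriveD (is_derive_cst (o 0 j) t 1) (dyP j); rewrite add0r.
  apply: is_deriveD d1 (gradP (fun s i => (row_mx o (y s) : 'rV[R]_(n + n)) 0 i) t (dr dy) _) => i.
  rewrite /dr; case: (split_ordP i) => k ->.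
    by rewrite row_mxEl mxE; under eq_fun do rewrite row_mxEl; apply: is_derive_cst.
  by rewrite row_mxEr; under eq_fun do rewrite row_mxEr; apply: dyP.
apply: cvgD; first exact: dyc.
apply: (@cvg_sum_seq R R^o) => i; apply: cvgM.
  apply: (gradc i (fun s i => (row_mx o (y s) : 'rV[R]_(n + n)) 0 i)) => l.
  case: (split_ordP l) => k ->.
    have -> : (fun s => (row_mx o (y s) : 'rV[R]_(n + n)) 0 (lshift n k)) = fun=> o 0 k.
      by apply/funext => s'; rewrite row_mxEl.
    exact: cst_continuous.
  have -> : (fun s => (row_mx o (y s) : 'rV[R]_(n + n)) 0 (rshift n k)) = fun s => y s 0 k.
    by apply/funext => s'; rewrite row_mxEr.
  exact: yc.
rewrite /dr; case: (split_ordP i) => k ->.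
  have -> : (fun s => (row_mx 0 (dy s) : 'rV[R]_(n + n)) 0 (lshift n k)) = fun=> 0.
    by apply/funext => s'; rewrite row_mxEl mxE.
  by rewrite row_mxEl mxE; apply: cvg_cst.
have -> : (fun s => (row_mx 0 (dy s) : 'rV[R]_(n + n)) 0 (rshift n k)) = fun s => dy s 0 k.
  by apply/funext => s'; rewrite row_mxEr.
by rewrite row_mxEr; apply: dyc.
Qed.

(** Left invariance of the fields: the two sides of o ** (y ** (t u)) = (o ** y) ** (t u) are
    differentiated at t = 0. *)
Lemma gmul_chain_left_field o j D :
  (forall (y : R -> 'rV[R]_n) (t : R) (dy : 'rV[R]_n),
    (forall k, is_derive (t : R) (1 : R) (fun s => y s 0 k) (dy 0 k)) ->
    is_derive (t : R) (1 : R) (fun s => (o ** y s) 0 j) (D (y t) dy)) ->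
  forall y u, D y (left_field pol u y) = left_field pol u (o ** y) 0 j.
Proof.
move=> DP y u.
have line z k : is_derive (0 : R) (1 : R) (fun s : R => (z ** (s *: u)) 0 k) (left_field pol u z 0 k).
  have [d1 d2] := translated_line_derive z u 0.
  by have := derivable_coord d1 k; rewrite d2 scale0r (gmul0r G).
pose F (t : R) := (o ** (y ** (t *: u))) 0 j.
pose F' (t : R) := ((o ** y) ** (t *: u)) 0 j.
have FF' : F = F' by apply/funext => t; rewrite /F (gmulA G).
have y0 : y ** (0 *: u) = y by rewrite scale0r (gmul0r G).
have d1 : is_derive (0 : R) (1 : R) F (D (y ** (0 *: u)) (left_field pol u y)).
  exact: DP (fun s : R => y ** (s *: u)) 0 (left_field pol u y) (line y).
have d2 : is_derive (0 : R) (1 : R) F' (left_field pol u (o ** y) 0 j) by exact: line.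
clearbody F F'; subst F'; rewrite y0 in d1.
by case: d1 => _ <-; case: d2 => _ <-.
Qed.

(* By homogeneity the coordinate of degree d grows at speed O(a^(d-1)) along a unit
   speed curve in the box of size a, so the bound kappa a^d persists when a is
   increased by the length travelled. *)
Lemma arc_bound d : exists kappa : nat -> R, (forall i, 0 <= kappa i) /\
  forall o (gamma u : R -> 'rV[R]_n) (a l : R),
  (forall t, derivable gamma t 1) -> continuous (derive1 gamma) ->
  (forall t, 0 <= t <= 1 -> layer deg 1 (u t) /\ derive1 gamma t = left_field pol (u t) (gamma t)) ->
  l = \int[lebesgue_measure]_(t in `[0, 1]) Num.sqrt (ip (u t) (u t)) -> 0 < a ->
  (forall j, (deg j <= d)%N -> `|(o ** gamma 0) 0 j| <= kappa (deg j) * a ^+ deg j) ->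
  forall t, 0 <= t <= 1 ->
  forall j, (deg j <= d)%N -> `|(o ** gamma t) 0 j| <= kappa (deg j) * (a + l) ^+ deg j.
Proof.
elim: d => [|d [kappa [k0 IH]]].
  exists (fun=> 0); split=> // o gamma u a l _ _ _ _ _ _ t _ j; rewrite leqn0 => /eqP j0.
  by have := deg_ge1 G j; rewrite j0.
have [Cip [Cip0 CipP]] := horizontal_coord_le ip_inner.
pose Cl := \sum_(i < d.+1) kappa i.
have Cl_ge i : (i <= d)%N -> kappa i <= Cl.
  rewrite -ltnS => id; rewrite /Cl (bigD1 (Ordinal id)) //= lerDl; exact: sumr_ge0.
have [B BP] := choice (fun j => left_field_bound j Cl).
pose kd := \sum_j B j * Cip.
have kd_ge j : B j * Cip <= kd.
  rewrite /kd (bigD1 j) //= lerDl; apply: sumr_ge0 => k _.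
  by rewrite mulr_ge0 //; have [] := BP k.
exists (fun i => if (i <= d)%N then kappa i else kd); split.
  move=> i; case: ifP => // _; apply: sumr_ge0 => k _.
  by rewrite mulr_ge0 //; have [] := BP k.
move=> o gamma u a l dg cg hu lE a0 init t t01 j.
have l0 : 0 <= l by rewrite lE; apply: Rintegral_ge0 => x _; apply: sqrtr_ge0.
have al : 0 < a + l by rewrite ltr_wpDr.
have low : forall t, 0 <= t <= 1 -> forall k, (deg k <= d)%N ->
    `|(o ** gamma t) 0 k| <= kappa (deg k) * (a + l) ^+ deg k.
  apply: (IH o gamma u a l) => // k kd'; have := init k (leqW kd'); by rewrite kd'.
rewrite leq_eqVlt => /orP[/eqP jd|]; last first.
  by rewrite ltnS => jd; rewrite jd; apply: low.
rewrite jd ltnn.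
have gk q k : is_derive (q : R) (1 : R) (fun t => gamma t 0 k) (derive1 gamma q 0 k).
  by rewrite derive1E; apply: derivable_coord.
have gc q k : {for q, continuous (fun t => gamma t 0 k)}.
  by apply/differentiable_continuous/derivable1_diffP; have [] := gk q k.
have dgc q k : {for q, continuous (fun t => derive1 gamma t 0 k)}.
  exact: continuous_cvg _ (@coord_continuous R 1 n 0 k _) (cg q).
have [D [DP Dc]] := gmul_chain o j.
(* The velocity [u] need not be continuous, but on [0, 1] it coincides with the first layer part of
   the derivative of gamma, which is continuous on the whole line. *)
pose U s := layer_proj deg 1 (derive1 gamma s).
pose N s := Num.sqrt (ip (U s) (U s)).
have UE q : 0 <= q <= 1 -> U q = u q.
  move=> q01; have [u1 gE] := hu q q01; apply/rowP => k; rewrite mxE gE left_fieldE.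
  by have [k1|k1] := eqVneq (deg k) 1%N; rewrite ?lfp_deg1 ?addr0 // u1.
have Uc q k : {for q, continuous (fun t => U t 0 k)}.
  have [k1|k1] := eqVneq (deg k) 1%N.
    by have -> : (fun t => U t 0 k) = (fun t => derive1 gamma t 0 k) by apply/funext => t'; rewrite mxE k1.
  have -> : (fun t => U t 0 k) = (fun=> 0) by apply/funext => t'; rewrite mxE (negbTE k1).
  exact: cst_continuous.
have ipc : continuous (fun q => ip (U q) (U q)).
  have -> : (fun q => ip (U q) (U q)) = fun q => \sum_k \sum_k' U q 0 k * U q 0 k' * gram deg ip k k'.
    by apply/funext => q; rewrite (ip_gram ip_inner) //; apply: layer_projP.
  move=> q; apply: (@cvg_sum_seq R R^o) => k; apply: (@cvg_sum_seq R R^o) => k'.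
  by apply: cvgM; [apply: cvgM; apply: Uc|exact: cvg_cst].
have Nc : continuous N.
  by move=> q; apply: (continuous_comp (ipc q)); exact: sqrt_continuous.
have lN : l = \int[lebesgue_measure]_(s in `[0, 1]) N s.
  rewrite lE; apply: eq_Rintegral => q /set_mem /=; rewrite in_itv /= => q01.
  by rewrite /N UE.
have cj0 : 0 <= B j * (a + l) ^+ d * Cip.
  by rewrite mulr_ge0 // mulr_ge0 ?exprn_ge0 ?(ltW al) //; have [] := BP j.
have bnd := derive_integral_bound (F := fun s => (o ** gamma s) 0 j)
  (F' := fun s => D (gamma s) (derive1 gamma s)) (fun s => DP gamma s _ (gk s))
  (fun s => Dc gamma (derive1 gamma) s (gc s) (dgc s)) Nc cj0 (fun s => sqrtr_ge0 _) _ lN t01.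
have {}bnd : `|(o ** gamma t) 0 j - (o ** gamma 0) 0 j| <= B j * (a + l) ^+ d * Cip * l.
  apply: bnd => q s01; have [u1 gE] := hu q s01.
  rewrite gE (gmul_chain_left_field DP) -mulrA.
  have [B0 Bj] := BP j; have Bjq := Bj (a + l) (o ** gamma q) (u q) (Cip * N q) al u1.
  rewrite jd /= in Bjq; apply: le_trans (Bjq _ _ _) _; last by rewrite !mulrA.
  - by move=> k; rewrite /N UE //; apply: CipP.
  - by rewrite mulr_ge0 ?sqrtr_ge0.
  - move=> k; rewrite ltnS => kd'; apply: le_trans (low q s01 k kd') _.
    by rewrite ler_wpM2r ?Cl_ge // exprn_ge0 // ltW.
have i0 := init j; rewrite jd ltnn leqnn in i0; have {}i0 := i0 isT.
have kd0 : 0 <= kd by apply: le_trans (kd_ge j); rewrite mulr_ge0 //; have [] := BP j.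
(* The bound closes because a^(d+1) + (a + l)^d l <= (a + l)^(d+1). *)
apply: (@le_trans _ _ (kd * a ^+ d.+1 + kd * ((a + l) ^+ d * l))).
  rewrite -[X in `|X|](subrK ((o ** gamma 0) 0 j)) addrC.
  apply: le_trans (ler_normD _ _) _; apply: lerD => //; apply: le_trans bnd _.
  have -> : B j * (a + l) ^+ d * Cip * l = B j * Cip * ((a + l) ^+ d * l) by ring.
  rewrite ler_wpM2r //.
  by rewrite mulr_ge0 ?exprn_ge0 // ltW.
rewrite -mulrDr ler_wpM2l // [leRHS]exprSr mulrDr lerD2r exprSr.
by rewrite ler_wpM2r ?lerXn2r ?nnegrE ?(ltW a0) ?(ltW al) // lerDl.
Qed.

Lemma carnot_dist_coord : exists C : R, 1 <= C /\ forall r x y,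
  (carnot_dist deg pol ip x y < r%:E)%E ->
  forall j, `|((- x) ** y) 0 j| <= (C * r) ^+ deg j.
Proof.
have [kappa [k0 kP]] := arc_bound s.
pose C := 1 + \sum_(i < s.+1) kappa i.
have C1 : 1 <= C by rewrite lerDl sumr_ge0.
exists C; split=> // r x y /ereal_inf_lt [_ [l xyl <-]]; rewrite lte_fin => lr.
have path o x' y' l' a : horizontal_path deg pol ip x' y' l' -> 0 < a ->
    (forall j, `|(o ** x') 0 j| <= kappa (deg j) * a ^+ deg j) ->
    0 <= l' /\ forall j, `|(o ** y') 0 j| <= kappa (deg j) * (a + l') ^+ deg j.
  move=> p; elim: p a => [z|z1 z2 z3 l1 l2 arc p IH] a a0 init.
    by split=> // j; rewrite addr0.
  have [gamma [u [[dg cg] [g0 g1] hu lE]]] := arc.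
  have l10 : 0 <= l1 by rewrite lE; apply: Rintegral_ge0 => t _; apply: sqrtr_ge0.
  have js j : (deg j <= s)%N by have /andP[] := carnot_deg G j.
  have := kP o gamma u a l1 dg cg hu lE a0; rewrite g0 => /(_ (fun j _ => init j) 1).
  rewrite ler01 lexx g1 => /(_ isT) h.
  have [l20 h2] := IH (a + l1) (ltr_wpDr l10 a0) (fun j => h j (js j)).
  by split; [exact: addr_ge0|move=> j; rewrite addrA].
have init j a : 0 < a -> `|((- x) ** x) 0 j| <= kappa (deg j) * a ^+ deg j.
  by move=> a0; rewrite (gmulNr G) mxE normr0 mulr_ge0 // exprn_ge0 // ltW.
(* The translated path starts at 0, so any positive initial box size is allowed; r - l makes the
   final size exactly r. *)
have rl : 0 < r - l by rewrite subr_gt0.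
have [l0 h] := path (- x) x y l (r - l) xyl rl (fun j => init j _ rl).
move=> j; apply: le_trans (h j) _; rewrite subrK exprMn.
have r0 : 0 <= r by apply: le_trans l0 (ltW lr).
have /andP[d1 ds] := carnot_deg G j.
rewrite ler_wpM2r ?exprn_ge0 //; apply: (@le_trans _ _ C).
  rewrite /C (bigD1 (Ordinal (ds : (deg j < s.+1)%N))) //= addrCA lerDl addr_ge0 //.
  exact: sumr_ge0.
by rewrite -[leLHS]expr1 ler_weXn2l.
Qed.

End BallBox.

(** * Sampling on a grid *)

Section IntegerLattice.
Variables (R : realType) (n s : nat) (deg : 'I_n -> nat) (pol : 'I_n -> mpoly (n + n) R).
Hypothesis G : carnot deg pol s.
Hypothesis G_rational : integral_coefficients pol.
Implicit Types x y z : 'rV[R]_n.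
Local Notation "x ** y" := (gmul pol x y) (at level 40, left associativity).
Local Notation P j := (pair_eval (pol j)).

Definition int_point (x : 'rV[int]_n) : 'rV[R]_n := map_mx intr x.

Lemma int_pointP x : integer_points x -> exists a, x = int_point a.
Proof.
move=> xi; exists (\row_j Num.floor (x 0 j)); apply/rowP => j; rewrite !mxE.
by have := xi j; rewrite intrEfloor => /eqP ->.
Qed.

Lemma integer_int_point a : integer_points (int_point a).
Proof. by move=> j; rewrite mxE; apply: intr_int. Qed.

Lemma int_point_inj : injective int_point.
Proof. by move=> a b /rowP ab; apply/rowP => j; have := ab j; rewrite !mxE => /intr_inj. Qed.

Lemma integer_P j x y : integer_points x -> integer_points y -> P j x y \is a Num.int.
Proof.
move=> xi yi; rewrite /pair_eval mevalE; apply: rpred_sum => m _.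
apply: rpredM; first exact: G_rational.
apply: rpred_prod => i _; apply: rpredX.
by rewrite -(splitK i); case: (fintype.split i) => k; rewrite /= ?row_mxEl ?row_mxEr.
Qed.

Lemma integer_gmul x y : integer_points x -> integer_points y -> integer_points (x ** y).
Proof. by move=> xi yi j; rewrite gmulE !rpredD // integer_P. Qed.

Lemma integerN x : integer_points x -> integer_points (- x).
Proof. by move=> xi j; rewrite mxE rpredN. Qed.

Lemma integer_dilation m x : integer_points x -> integer_points (dilation deg m%:R x).
Proof. by move=> xi j; rewrite mxE rpredM // rpredX // natr_int. Qed.

Lemma integer_dilationV (m : nat) (a : 'rV[int]_n) : (0 < m)%N ->
  integer_points (dilation deg m%:R^-1 (int_point a)) <->
  forall j, dvdn (m ^ deg j) (absz (a 0 j)).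
Proof.
move=> m0; have md j : (m ^ deg j)%N%:R != 0 :> R by rewrite pnatr_eq0 expn_eq0 negb_and -lt0n m0.
split=> h j; last first.
  have /dvdzP [t at_] : dvdz (m ^ deg j)%N%:Z (a 0 j) by rewrite /dvdz absz_nat.
  by rewrite !mxE at_ intrM exprVn -natrX mulrC -pmulrn mulfK // intr_int.
have := h j; rewrite !mxE exprVn -natrX => /intrP [t /(canRL (mulVKf (md j)))].
rewrite pmulrn -intrM => /intr_inj ->.
by rewrite abszM absz_nat dvdn_mulr.
Qed.

Lemma dilationN r x : dilation deg r (- x) = - dilation deg r x.
Proof. by apply/rowP => j; rewrite !mxE mulrN. Qed.

Lemma dilation0 r : dilation deg r (0 : 'rV[R]_n) = 0.
Proof. by apply/rowP => j; rewrite !mxE mulr0. Qed.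

(** Membership of a b^(-1) in the image of the integer lattice under the dilation by m. This is a
    subgroup because the coefficients are integral and dilations are automorphisms. *)
Definition lattice_rel (m : nat) : rel 'rV[int]_n := fun a b =>
  `[< integer_points (dilation deg m%:R^-1 (int_point a ** - int_point b)) >].

Let mV_neq0 m : (0 < m)%N -> m%:R^-1 != 0 :> R.
Proof. by move=> m0; rewrite invr_eq0 pnatr_eq0 -lt0n. Qed.

Lemma lattice_rel_refl m a : (0 < m)%N -> lattice_rel m a a.
Proof.
move=> m0; apply/asboolP; rewrite (gmulrN G) dilation0 => j; rewrite mxE; exact: rpred0.
Qed.

Lemma lattice_rel_sym m a b : (0 < m)%N -> lattice_rel m a b -> lattice_rel m b a.
Proof.
move=> m0 /asboolP h; apply/asboolP.
by rewrite -[int_point b]opprK -(gmulN G) dilationN; apply: integerN.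
Qed.

Lemma lattice_rel_trans m a b c : (0 < m)%N ->
  lattice_rel m a b -> lattice_rel m b c -> lattice_rel m a c.
Proof.
move=> m0 /asboolP h /asboolP h'; apply/asboolP.
have -> : int_point a ** - int_point c =
    (int_point a ** - int_point b) ** (int_point b ** - int_point c).
  by rewrite (gmulA G) (gmulVK G).
by rewrite (gmul_dilation G) ?mV_neq0 //; apply: integer_gmul.
Qed.

Lemma lattice_rel_dvd m m' a b : (0 < m)%N -> (m' %| m)%N -> lattice_rel m a b -> lattice_rel m' a b.
Proof.
move=> m0 /dvdnP [k mk] /asboolP h; apply/asboolP.
have k0 : k%:R != 0 :> R.
  by rewrite pnatr_eq0; apply: contraTneq m0 => k0; rewrite mk k0.
have -> : m'%:R^-1 = k%:R * m%:R^-1 :> R by rewrite mk natrM invfM mulrA mulfV // mul1r.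
by rewrite dilationM; apply: integer_dilation.
Qed.

(** Coordinate by coordinate this says that powers commute with the lcm, obtained by splitting off
    the gcd and using that powers of coprime numbers are coprime. *)
Lemma lattice_rel_lcm m m' a b : (0 < m)%N -> (0 < m')%N ->
  lattice_rel m a b -> lattice_rel m' a b -> lattice_rel (lcmn m m') a b.
Proof.
move=> m0 m'0 /asboolP h /asboolP h'; apply/asboolP.
have [z zE] : exists z : 'rV[int]_n, int_point a ** - int_point b = int_point z.
  by apply: int_pointP; apply: integer_gmul; [|apply: integerN]; apply: integer_int_point.
move: h h'; rewrite zE !integer_dilationV ?lcmn_gt0 ?m0 // => h h' j.
move: (h j) (h' j); move: (absz _) (deg j) => k d.
have g0 : (0 < gcdn m m')%N by rewrite gcdn_gt0 m0.
have [u mu] := dvdnP (dvdn_gcdl m m'); have [u' mu'] := dvdnP (dvdn_gcdr m m').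
have cop : coprime u u'.
  by rewrite /coprime -(eqn_pmul2r g0) muln_gcdl -mu -mu' mul1n.
have -> : lcmn m m' = (u * u' * gcdn m m')%N.
  apply/eqP; rewrite -(eqn_pmul2r g0) muln_lcm_gcd -mulnA -mulnA [(u' * _)%N]mulnCA -mu' mulnA -mu.
  by [].
have -> : (m ^ d = u ^ d * gcdn m m' ^ d)%N by rewrite -expnMn -mu.
have -> : (m' ^ d = u' ^ d * gcdn m m' ^ d)%N by rewrite -expnMn -mu'.
rewrite !expnMn.
have gd0 : (0 < gcdn m m' ^ d)%N by rewrite expn_gt0 g0.
move=> hu hu'; have /dvdnP [k1 kE] := dvdn_trans (dvdn_mull _ (dvdnn _)) hu.
move: hu hu'; rewrite kE !dvdn_pmul2r // => hu hu'.
by rewrite Gauss_dvd ?coprimeXl ?coprimeXr // hu.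
Qed.

(** By induction on the degree: once the lower coordinates agree, the correction term is that of a
    line, hence 0. Then a_j - b_j is divisible by m^(deg j) and smaller than it. *)
Lemma lattice_rel_uniq m a b : (0 < m)%N -> lattice_rel m a b ->
  (forall j, `|a 0 j - b 0 j| < (m ^ deg j)%:Z) -> a = b.
Proof.
move=> m0 /asboolP h ab.
suff eqd d j : (deg j < d)%N -> a 0 j = b 0 j by apply/rowP => j; apply: (eqd (deg j).+1).
elim: d j => // d IH j; rewrite ltnS leq_eqVlt => /orP[/eqP jd|]; last exact: IH.
have Pj : P j (int_point a) (- int_point b) = 0.
  rewrite -(P_line G j (int_point a) 1 (-1)) scale1r scaleN1r.
  by apply: (P_lower G) => // k; rewrite jd => /IH kb; rewrite !mxE kb.
have [z zE] : exists z : 'rV[int]_n, int_point a ** - int_point b = int_point z.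
  by apply: int_pointP; apply: integer_gmul; [|apply: integerN]; apply: integer_int_point.
have zj : z 0 j = a 0 j - b 0 j.
  have /rowP/(_ j) := zE; rewrite gmulE Pj addr0 !mxE -rmorphB => /intr_inj ->.
  by [].
move: h; rewrite zE integer_dilationV // => /(_ j); rewrite zj => dv.
have := ab j; move: (a 0 j) (b 0 j) dv => u w dv uw.
case: (posnP (absz (u - w))) => [|pos]; first by lia.
by have := dvdn_leq pos dv; lia.
Qed.

(** The coordinates are adjusted degree by degree. Left multiplication by a dilated lattice point
    supported in degree d preserves the lower coordinates and shifts those of degree d by multiples
    of m^d. *)
Lemma lattice_rel_exists m a (lo : 'I_n -> int) : (0 < m)%N ->
  exists b, lattice_rel m b a /\ forall j, lo j <= b 0 j < lo j + (m ^ deg j)%:Z.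
Proof.
move=> m0.
suff [b [ba bP]] : exists b, lattice_rel m b a /\
    forall j, (deg j < s.+1)%N -> lo j <= b 0 j < lo j + (m ^ deg j)%:Z.
  by exists b; split=> // j; apply: bP; have /andP[] := carnot_deg G j.
elim: s.+1 => [|d [b [ba bP]]]; first by exists a; split; [exact: lattice_rel_refl|].
pose c : 'rV[int]_n := \row_j
  (if deg j == d then - divz (b 0 j - lo j) (m ^ deg j)%:Z else 0).
pose y := dilation deg m%:R (int_point c).
have yi : integer_points y by apply/integer_dilation/integer_int_point.
have [b' b'E] : exists b', y ** int_point b = int_point b'.
  by apply: int_pointP; apply: integer_gmul => //; apply: integer_int_point.
have mR : m%:R != 0 :> R by rewrite pnatr_eq0 -lt0n.
exists b'; split.
  apply: (lattice_rel_trans m0 _ ba); apply/asboolP; rewrite -b'E (gmulK G).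
  by rewrite /y -dilationM mulVf // dilation1; apply: integer_int_point.
move=> j; rewrite ltnS => jd.
have Pj : P j y (int_point b) = 0.
  rewrite -(P0l G j (int_point b)); apply: (P_lower G) => // k kj; rewrite !mxE ifF ?mulr0 //.
  by apply: ltn_eqF; apply: leq_trans kj jd.
have b'j : b' 0 j = (m ^ deg j)%:Z * c 0 j + b 0 j.
  have /rowP/(_ j) := b'E; rewrite gmulE Pj addr0 !mxE -natrX -[_%:R]/((m ^ deg j)%N%:~R).
  by rewrite -intrM -intrD => /intr_inj ->.
rewrite b'j mxE; case: eqP => jd'; last first.
  by rewrite mulr0 add0r; apply: bP; rewrite ltn_neqAle jd andbT; apply/eqP.
have M0 : (m ^ deg j)%:Z != 0 by rewrite eqz_nat expn_eq0 negb_and -lt0n m0.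
pose D := (m ^ deg j)%:Z; pose r := modz (b 0 j - lo j) D.
have e1 : b 0 j - lo j = divz (b 0 j - lo j) D * D + r by exact: divz_eq.
have e2 : 0 <= r by exact: modz_ge0.
have e3 : r < `|D| by exact: ltz_mod.
have D0 : 0 <= D by [].
rewrite -/D mulrN [D * _]mulrC; clearbody r D; move: e1; move: (divz _ _ * D) => A; lia.
Qed.

Lemma lattice_rel_congruence : congruence_family deg lattice_rel.
Proof.
split; [exact: lattice_rel_refl|exact: lattice_rel_sym|exact: lattice_rel_trans|
  exact: lattice_rel_dvd|exact: lattice_rel_lcm|exact: lattice_rel_uniq|exact: lattice_rel_exists].
Qed.

End IntegerLattice.

Section GridDeviation.
Variables (R : realType) (n s : nat) (deg : 'I_n -> nat) (pol : 'I_n -> mpoly (n + n) R).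
Hypothesis G : carnot deg pol s.
Hypothesis G_rational : integral_coefficients pol.
Hypothesis n_gt0 : (0 < n)%N.
Let Q := (\sum_j deg j)%N.

Let deg_gt0 j : (0 < deg j)%N. Proof. exact: (deg_ge1 G). Qed.

Lemma sum_deg_gt0 : (0 < \sum_j deg j)%N.
Proof. by rewrite (bigD1 (Ordinal n_gt0)) //= addn_gt0 deg_gt0. Qed.

Definition root_inv (q : nat) : R := q%:R `^ (- (\sum_j deg j)%N%:R^-1).

Lemma root_inv_gt0 q : (0 < q)%N -> 0 < root_inv q.
Proof. by move=> q0; rewrite powR_gt0 // ltr0n. Qed.

Lemma root_invE q : (0 < q)%N -> root_inv q ^+ (\sum_j deg j)%N = q%:R^-1.
Proof.
move=> q0; rewrite -powR_mulrn ?ltW ?root_inv_gt0 // -powRrM mulNr mulVf.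
  by rewrite powR_inv1.
by rewrite pnatr_eq0 -lt0n sum_deg_gt0.
Qed.

Lemma root_inv_ge q : (0 < q)%N -> q%:R^-1 <= root_inv q.
Proof.
move=> q0; rewrite -root_invE // -[leRHS]expr1.
by rewrite ler_wiXn2l ?sum_deg_gt0 ?(root_inv_le1 sum_deg_gt0 root_inv_gt0 root_invE) ?ltW ?root_inv_gt0.
Qed.

(** The box of size c q^(-alpha), with q^(-alpha) = v_q / q, becomes of size c (L/q) v_q under the
    dilation by L. *)
Definition hit_radius (c : R) (L q : nat) (j : 'I_n) : nat :=
  Num.truncn ((c * ((L %/ q)%N%:R * root_inv q)) ^+ deg j).

Definition grid_hits (c : R) (L T : nat) (x : 'rV[int]_n) : R :=
  hits R (lattice_rel deg pol) L T (hit_radius c L) x.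

(** The largeness of L makes the size u at least 1, since v_q >= 1/q. Truncation is then harmless:
    u^d <= 2 floor(u^d) + 1 <= 3 u^d. *)
Lemma hit_density_bounds c L q : 0 < c -> (0 < q)%N -> (q %| L)%N -> q%:R ^+ 2 / c <= L%:R ->
  (0 < L)%N ->
  c ^+ Q / q%:R <= hit_density R deg L (hit_radius c L) q <= 3 ^+ n * c ^+ Q / q%:R.
Proof.
move=> c0 q0 qL Lq L0; pose M := (L %/ q)%N; pose u := c * (M%:R * root_inv q).
have M0 : (0 < M)%N by rewrite divn_gt0 // dvdn_leq.
have qR : 0 < q%:R :> R by rewrite ltr0n.
have LE : L%:R = M%:R * q%:R :> R by rewrite -natrM divnK.
have u1 : 1 <= u.
  have h : c * (M%:R * q%:R^-1) <= u by rewrite ler_pM2l // ler_pM2l ?ltr0n // root_inv_ge.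
  apply: le_trans h; move: Lq; rewrite ler_pdivrMr // LE => h.
  rewrite mulrA ler_pdivlMr // mul1r -(ler_pM2r qR) -expr2.
  by apply: (le_trans h); rewrite mulrAC [M%:R * c]mulrC.
have MQ : 0 < (M ^ Q)%N%:R :> R by rewrite ltr0n expn_gt0 M0.
have uQ : \prod_j u ^+ deg j = c ^+ Q / q%:R * (M ^ Q)%N%:R.
  rewrite -expr_sum /u -/Q exprMn exprMn root_invE // natrX; ring.
rewrite /hit_density -/M -/Q natr_prod ler_pdivlMr // ler_pdivrMr //.
have -> : 3 ^+ n * c ^+ Q / q%:R * (M ^ Q)%N%:R = \prod_(j < n) (3 * u ^+ deg j).
  by rewrite big_split /= prodr_const card_ord uQ !mulrA.
rewrite -uQ.
have tP j : u ^+ deg j <= (2 * hit_radius c L q j).+1%:R <= 3 * u ^+ deg j.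
  have t1 : 1 <= u ^+ deg j by exact: exprn_ege1.
  have /andP[] := truncn_itv (le_trans ler01 t1); rewrite -/(hit_radius c L q j).
  have e : (2 * hit_radius c L q j).+1%:R = 2 * (hit_radius c L q j)%:R + 1 :> R by rewrite -natr1 natrM.
  rewrite e -[(hit_radius c L q j).+1%:R]natr1; have := ler0n R (hit_radius c L q j); lra.
apply/andP; split; apply: ler_prod => j _; have /andP[h1 h2] := tP j.
  by rewrite h1 andbT exprn_ge0 // (le_trans ler01 u1).
by rewrite h2 andbT.
Qed.

Lemma grid_deviation c : 0 < c -> exists K k k' : R, [/\ 0 <= K, 0 < k, 0 <= k' &
  forall i a, exists L0, forall L, (L0 <= L)%N -> (0 < L)%N ->
    (forall q, (0 < q < 2 ^ 16 ^ i)%N -> (q %| L)%N) ->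
    (count (fun x => ~~ (k * 16 ^+ i <= grid_hits c L (2 ^ 16 ^ i) x <= k' * 16 ^+ i))
      (sample_box deg L a))%:R <= (L ^ Q)%N%:R * (K / 4 ^+ i)].
Proof.
move=> c0; pose c1 := c ^+ Q; pose c2 := 3 ^+ n * c ^+ Q; pose A := (1 + c) ^+ Q.
pose K0 := 8 * c2 * ((2 * (2 * A)) ^+ n * (1 + Q%:R) + 1) / c1 ^+ 2 + 9 * c2 / c1.
have c10 : 0 < c1 by exact: exprn_gt0.
have c20 : 0 < c2 by rewrite mulr_gt0 ?exprn_gt0.
have A1 : 1 <= A by rewrite exprn_ege1 // lerDl ltW.
have K00 : 0 <= K0.
  have A0 : 0 <= 2 * (2 * A) by lra.
  have B0 : 0 <= (2 * (2 * A)) ^+ n * (1 + Q%:R) + 1.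
    by rewrite addr_ge0 // mulr_ge0 ?exprn_ge0 // addr_ge0.
  have c2' := ltW c20; have c1' := ltW c10.
  have h1 : 0 <= 8 * c2 * ((2 * (2 * A)) ^+ n * (1 + Q%:R) + 1) by rewrite mulr_ge0 // mulr_ge0.
  have h2 : 0 <= 9 * c2 by rewrite mulr_ge0.
  exact: addr_ge0 (divr_ge0 h1 (exprn_ge0 2 c1')) (divr_ge0 h2 c1').
(* The harmonic sum H lies between 16^i / 2 and 16^i. So m / 2 and 3 m give the last two constants,
   and with M0 = 4^i the sum M0 / H + 1 / M0 is at most 3 / 4^i. *)
exists (K0 * 3), (c1 / 4), (3 * c2); split.
- exact: mulr_ge0.
- exact: divr_gt0.
- exact: mulr_ge0 (ltW c20).
move=> i a; pose T := (2 ^ 16 ^ i)%N; exists (Num.bound (T%:R ^+ 2 / c)) => L LL0 L0 L_dvd.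
have T1 : (1 < T)%N by rewrite -{1}(expn0 2) ltn_exp2l // expn_gt0.
have Lc : T%:R ^+ 2 / c <= L%:R.
  apply: le_trans (_ : (Num.bound (T%:R ^+ 2 / c))%:R <= _); last by rewrite ler_nat.
  by apply/ltW/archi_boundP; apply: divr_ge0 (ltW c0); apply: exprn_ge0.
have dens q : (0 < q < T)%N ->
    c1 / q%:R <= hit_density R deg L (hit_radius c L) q <= c2 / q%:R.
  move=> /andP[q0 qT]; apply: hit_density_bounds => //; first by apply: L_dvd; rewrite q0.
  apply: le_trans Lc; rewrite ler_pM2r ?invr_gt0 //.
  by rewrite lerXn2r ?nnegrE // ler_nat ltnW.
have rdecr q k j : (0 < q <= k)%N -> (k < T)%N -> (hit_radius c L k j <= hit_radius c L q j)%N.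
  move=> qk _; apply: le_truncn; have /andP[q0 qk'] := qk.
  have vk : 0 <= root_inv k by apply/ltW/root_inv_gt0/(leq_trans q0).
  rewrite lerXn2r ?nnegrE ?mulr_ge0 ?(ltW c0) ?(ltW (root_inv_gt0 q0)) //.
  rewrite ler_pM2l // ler_pM // ?ler_nat ?leq_div2l //.
  exact: (root_inv_decr sum_deg_gt0 root_inv_gt0 root_invE qk).
have rad_le q j : (0 < q < T)%N ->
    (hit_radius c L q j)%:R <= A * ((L %/ q)%N%:R * root_inv q) ^+ deg j.
  move=> /andP[q0 _]; have v0 := ltW (root_inv_gt0 q0).
  have u0 : 0 <= (L %/ q)%N%:R * root_inv q by rewrite mulr_ge0.
  have t0 : 0 <= (c * ((L %/ q)%N%:R * root_inv q)) ^+ deg j by rewrite exprn_ge0 // mulr_ge0 // ltW.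
  apply: (@le_trans _ _ ((c * ((L %/ q)%N%:R * root_inv q)) ^+ deg j)); first by rewrite truncn_le.
  rewrite exprMn ler_wpM2r ?exprn_ge0 // /A.
  apply: (@le_trans _ _ ((1 + c) ^+ deg j)).
    by rewrite lerXn2r ?nnegrE ?addr_ge0 ?(ltW c0) // lerDr.
  rewrite ler_weXn2l ?lerDl ?(ltW c0) // /Q (bigD1 j) //=; exact: leq_addr.
have M00 : (0 < 4 ^ i)%N by rewrite expn_gt0.
have dge q : (0 < q < T)%N -> c1 / q%:R <= hit_density R deg L (hit_radius c L) q.
  by move=> /dens/andP[].
have dle q : (0 < q < T)%N -> hit_density R deg L (hit_radius c L) q <= c2 / q%:R.
  by move=> /dens/andP[].
have := hits_deviation n_gt0 deg_gt0 root_inv_gt0 root_invE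
  (lattice_rel_congruence G G_rational) a L0 M00 T1 L_dvd rdecr c10 A1 rad_le dge dle.
rewrite -/Q -/K0; set m := \sum_(q < T | _) _ => dev.
have /andP[mH Hm] : c1 * harmonic_sum R T <= m <= c2 * harmonic_sum R T.
  exact: hits_mean_bounds dge dle.
have [H1 H2] := harmonic_sum_pow2 R (16 ^ i)%N; rewrite -/T natrX in H1 H2.
have e16 : 0 < 16 ^+ i :> R by rewrite exprn_gt0.
have e4 : 0 < 4 ^+ i :> R by rewrite exprn_gt0.
have e164 : 16 ^+ i = 4 ^+ i * 4 ^+ i :> R by rewrite -exprMn; congr (_ ^+ _); lra.
apply: le_trans (le_trans dev _).
  rewrite ler_nat; apply: sub_count => x; apply: contra; rewrite /grid_hits => /andP[x1 x2].
  have c1H := ler_wpM2l (ltW c10) H1; have c2H := ler_wpM2l (ltW c20) H2.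
  apply/andP; split; [apply: le_trans x1 | apply: (le_trans x2)]; lra.
rewrite ler_wpM2l // -mulrA ler_wpM2l //.
have H0 : 0 < harmonic_sum R T by apply: lt_le_trans H1; rewrite mulr_gt0 // invr_gt0.
have h : (4 ^ i)%N%:R / harmonic_sum R T <= 2 / 4 ^+ i.
  rewrite natrX ler_pdivrMr // mulrAC ler_pdivlMr // -e164.
  by move: H1; rewrite ler_pdivrMr // mulrC.
by rewrite natrX; move: h; rewrite !mulrDl natrX; lra.
Qed.

End GridDeviation.

Lemma finite_pos_lower_bound (R : realFieldType) (I : finType) (t : I -> R) :
  (forall i, 0 < t i) -> exists m, 0 < m /\ forall i, m <= t i.
Proof.
move=> t0; have S0 : 0 <= \sum_i (t i)^-1 by apply: sumr_ge0 => i _; rewrite invr_ge0 ltW.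
have S1 : 0 < 1 + \sum_i (t i)^-1 by rewrite ltr_wpDr.
exists (1 + \sum_i (t i)^-1)^-1; split=> [|i]; first by rewrite invr_gt0.
rewrite -[leRHS]invrK lef_pV2 ?posrE ?invr_gt0 // (bigD1 i) //= addrCA lerDl addr_ge0 //.
by apply: sumr_ge0 => k _; rewrite invr_ge0 ltW.
Qed.

Section FiniteCounting.
Variables (T : choiceType) (U : eqType) (S : set T) (l : seq U) (r : T -> U -> Prop).

Lemma card_rel_le (u0 : U) : (forall x, S x -> exists2 u, u \in l & r x u) ->
  (forall x x' u, r x u -> r x' u -> x = x') -> finite_set S /\ (#|` fset_set S| <= size l)%N.
Proof.
move=> Sl r_inj.
have /choice [f fP] : forall x, exists u, S x -> u \in l /\ r x u.
  by move=> x; have [/Sl [u ul xu]|nSx] := pselect (S x); [exists u|exists u0].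
have f_inj x x' : S x -> S x' -> f x = f x' -> x = x'.
  by move=> /fP [_ h] /fP [_ h'] e; apply: r_inj h _; rewrite e.
have finS : finite_set S.
  have [[y Sy]|S0] := pselect (exists x, S x); last first.
    rewrite (_ : S = classical_sets.set0); first exact: finite_set0.
    by apply/seteqP; split=> // x Sx; apply: S0; exists x.
  have /choice [g gP] : forall u, exists x, (exists2 x', S x' & f x' = u) -> S x /\ f x = u.
    move=> u; have [[x Sx fx]|h] := pselect (exists2 x', S x' & f x' = u); first by exists x.
    by exists y.
  apply: (@sub_finite_set _ _ [set g u | u in [set` l]]); last exact/finite_image/finite_seq.
  move=> x Sx; exists (f x); first by have [] := fP x Sx.
  by have [Sg gf] := gP (f x) (ex_intro2 _ _ x Sx erefl); apply: f_inj.
split=> //; rewrite -(size_map f); apply: uniq_leq_size.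
  rewrite map_inj_in_uniq ?fset_uniq // => x x'; rewrite !in_fset_set //.
  by move=> /set_mem Sx /set_mem Sx'; apply: f_inj.
by move=> u /mapP [x]; rewrite in_fset_set // => /set_mem /fP [ul _] ->.
Qed.

Lemma card_rel_ge : finite_set S -> uniq l -> (forall u, u \in l -> exists2 x, S x & r x u) ->
  (forall x u u', r x u -> r x u' -> u = u') -> (size l <= #|` fset_set S|)%N.
Proof.
move=> finS ul lS r_inj; case: l ul lS => [|u0 l'] ul lS; first exact: leq0n.
have [x0 _ _] := lS u0 (mem_head _ _).
have /choice [f fP] : forall u, exists x, u \in u0 :: l' -> S x /\ r x u.
  move=> u; have [/lS [x Sx xu]|nl] := boolP (u \in u0 :: l'); first by exists x.
  by exists x0.
rewrite -(size_map f); apply: uniq_leq_size.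
  rewrite map_inj_in_uniq // => u u' /fP [_ h] /fP [_ h'] e.
  by apply: r_inj h _; rewrite e.
by move=> x /mapP [u /fP [Su _] ->]; rewrite in_fset_set //; apply: mem_set.
Qed.

End FiniteCounting.

(** * From solutions near a grid point to hits *)

Section Approximation.
Variables (R : realType) (n s : nat) (deg : 'I_n -> nat) (pol : 'I_n -> mpoly (n + n) R).
Hypothesis G : carnot deg pol s.
Hypothesis G_rational : integral_coefficients pol.
Hypothesis n_gt0 : (0 < n)%N.
Variable ip : 'rV[R]_n -> 'rV[R]_n -> R.
Hypothesis ip_inner : inner_product_on (layer deg 1) ip.
Implicit Types g p : 'rV[R]_n.
Local Notation "x ** y" := (gmul pol x y) (at level 40, left associativity).
Local Notation v := (root_inv R deg).
Local Notation dil r := (dilation deg r).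
Local Notation iota_ := (@int_point R n).
Local Notation E := (lattice_rel deg pol).
Local Notation rad := (@hit_radius R n deg).

(** Up to constants, the approximation condition after the dilation by q, which turns the radius
    q^(-alpha) into v_q. *)
Definition near (c : R) q g p := forall j, `|(- dil q%:R g ** p) 0 j| <= (c * v q) ^+ deg j.

(** Replacing g by g' multiplies the compared element on the left by a small e. It then moves by at
    most [tau], the least allowed size, and t^d + t^d <= (2 t)^d for d >= 1. *)
Lemma near_perturb1 c q (M : R) : 0 < c -> (0 < q)%N -> exists eta : R, 0 < eta /\
  forall g g' p, bounded_by M g -> bounded_by M g' -> bounded_by eta (g - g') ->
  near c q g p -> near (2 * c) q g' p.
Proof.
move=> c0 q0; have cv0 : 0 < c * v q by rewrite mulr_gt0 // root_inv_gt0.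
have [tau [tau0 tauP]] := finite_pos_lower_bound (fun j : 'I_n => exprn_gt0 (deg j) cv0).
have [C [C0 CP]] := gmul_lipschitz pol M.
pose E0 := q%:R ^+ s * C; have E00 : 0 <= E0 by rewrite mulr_ge0 ?exprn_ge0.
pose W := \sum_j (c * v q) ^+ deg j.
have W0 : 0 <= W by apply: sumr_ge0 => j _; rewrite exprn_ge0 // ltW.
have [C1 [C10 C1P]] := gmul_lipschitz pol (W + E0).
have CE0 : 0 <= C1 * E0 by rewrite mulr_ge0.
pose eta := tau / (tau + C1 * E0 + 1); have den0 : 0 < tau + C1 * E0 + 1 by lra.
have eta0 : 0 < eta by rewrite divr_gt0.
have eta1 : eta <= 1 by rewrite ler_pdivrMr //; lra.
have etaP : C1 * (E0 * eta) <= tau.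
  have -> : C1 * (E0 * eta) = C1 * E0 / (tau + C1 * E0 + 1) * tau by rewrite /eta; ring.
  rewrite ler_piMl ?(ltW tau0) // ler_pdivrMr //; lra.
exists eta; split=> // g g' p gM g'M gg' nearp j.
have qR : q%:R != 0 :> R by rewrite pnatr_eq0 -lt0n.
set w := - dil q%:R g ** p; pose e := dil q%:R (- g' ** g).
have -> : - dil q%:R g' ** p = e ** w.
  by rewrite /e (gmul_dilation G) // dilationN -(gmulA G) (gmulNK G).
have eb : bounded_by (E0 * eta) e.
  move=> k; rewrite mxE normrM normrX normr_nat /E0 -mulrA.
  have d1 : bounded_by eta (- g' - - g) by rewrite opprK addrC.
  have d2 : bounded_by eta (g - g) by rewrite subrr => i; rewrite mxE normr0 ltW.
  have [_ /(_ k)] := CP (- g') g (- g) g eta (bounded_byN g'M) gM (bounded_byN gM) gM (ltW eta0) d1 d2.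
  rewrite (gmulNr G) subr0 => hk; apply: ler_pM; rewrite ?exprn_ge0 ?normr_ge0 //.
  by rewrite ler_weXn2l ?ler1n //; have /andP[] := carnot_deg G k.
have wW : bounded_by (W + E0) w.
  move=> k; apply: le_trans (nearp k) _; rewrite /W (bigD1 k) //= -addrA lerDl addr_ge0 //.
  by apply: sumr_ge0 => i _; rewrite exprn_ge0 // ltW.
have eW : bounded_by (W + E0) e.
  by apply: bounded_by_le eb; rewrite -[leLHS]add0r lerD // ler_piMr.
have zW : bounded_by (W + E0) (0 : 'rV[R]_n) by move=> k; rewrite mxE normr0 addr_ge0.
have D0 : 0 <= E0 * eta by rewrite mulr_ge0 // ltW.
have e0 : bounded_by (E0 * eta) (e - 0) by rewrite subr0.
have w0 : bounded_by (E0 * eta) (w - w) by rewrite subrr => k; rewrite mxE normr0.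
have [_ /(_ j)] := C1P e w 0 w (E0 * eta) eW wW zW wW D0 e0 w0.
have subE (a b : 'rV[R]_n) : (a - b) 0 j = a 0 j - b 0 j by rewrite !mxE.
rewrite (gmul0l G) subE => hj.
rewrite -[X in `|X|](subrK (w 0 j)); apply: le_trans (ler_normD _ _) _.
apply: le_trans (lerD (le_trans hj (le_trans etaP (tauP j))) (nearp j)) _.
rewrite -mulrA [leRHS]exprMn -mulr2n -[_ *+ 2]mulr_natl ler_wpM2r ?exprn_ge0 ?(ltW cv0) //.
by rewrite -[leLHS]expr1 ler_weXn2l ?ler1n // (deg_ge1 G).
Qed.

Lemma near_perturb c T (M : R) : 0 < c -> exists eta : R, 0 < eta /\
  forall q g g' p, (0 < q < T)%N -> bounded_by M g -> bounded_by M g' -> bounded_by eta (g - g') ->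
  near c q g p -> near (2 * c) q g' p.
Proof.
move=> c0; have /choice [f fP] : forall q, exists eta : R, 0 < eta /\ ((0 < q)%N ->
  forall g g' p, bounded_by M g -> bounded_by M g' -> bounded_by eta (g - g') ->
  near c q g p -> near (2 * c) q g' p).
  case=> [|q]; first by exists 1.
  by have [eta [e0 eP]] := near_perturb1 M c0 (ltn0Sn q); exists eta.
have [eta [e0 eP]] := finite_pos_lower_bound (fun q : 'I_T => proj1 (fP q)).
exists eta; split=> // q g g' p /andP[q0 qT] gM g'M gg'.
have [_ h] := fP q; apply: (h q0) => //; apply: bounded_by_le gg'.
exact: (eP (Ordinal qT)).
Qed.

(** After a further dilation by L/q the compared element z is an integer point, and b is its inverse
    -z. *)
Lemma near_grid c L q x p : 0 < c -> (0 < q)%N -> (q %| L)%N -> (0 < L)%N -> integer_points p ->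
  near c q (dil L%:R^-1 (iota_ x)) p <->
  exists2 b, b \in target_box (rad c L) q & dil (L %/ q)%:R p = iota_ x ** - iota_ b.
Proof.
move=> c0 q0 qL L0 pi; set M := (L %/ q)%N.
have M0 : (0 < M)%N by rewrite divn_gt0 // dvdn_leq.
have MR : 0 < M%:R :> R by rewrite ltr0n.
have qR : 0 < q%:R :> R by rewrite ltr0n.
have LE : L%:R = M%:R * q%:R :> R by rewrite -natrM divnK.
have cv0 : 0 <= c * v q by rewrite mulr_ge0 ?(ltW c0) // ltW // root_inv_gt0.
pose z := - iota_ x ** dil M%:R p.
have zE : z = dil M%:R (- dil q%:R (dil L%:R^-1 (iota_ x)) ** p).
  rewrite (gmul_dilation G) ?gt_eqF // dilationN -!dilationM ?mulrA -LE.
  by rewrite mulfV ?dilation1 // pnatr_eq0 -lt0n.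
have nearE : near c q (dil L%:R^-1 (iota_ x)) p <->
    forall j, `|z 0 j| <= (c * (M%:R * v q)) ^+ deg j.
  have dilE (r : R) (y : 'rV[R]_n) j : dil r y 0 j = r ^+ deg j * y 0 j by rewrite mxE.
  split=> h j; have := h j; rewrite zE dilE normrM normrX normr_nat [c * (M%:R * _)]mulrCA (exprMn _ M%:R) ler_pM2l //;
    exact: exprn_gt0.
have rP (k : int) j : (`|k%:~R| <= (c * (M%:R * v q)) ^+ deg j) = (absz k <= rad c L q j)%N.
  rewrite truncn_ge_nat; first by rewrite -intr_norm -abszE.
  by rewrite exprn_ge0 // mulrCA mulr_ge0 // ltW.
have boxE b : (b \in target_box (rad c L) q) = [forall j, leq (absz (b 0 j)) (rad c L q j)].
  rewrite mem_int_box; apply: eq_forallb => j; move: (b 0 j) (rad c L q j) => k t.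
  by apply/idP/idP; lia.
have [z' z'E] : exists z', z = iota_ z'.
  apply: int_pointP; apply: (integer_gmul G_rational); first exact/integerN/integer_int_point.
  exact: integer_dilation.
rewrite nearE; split=> [h|[b]].
  exists (- z').
    rewrite boxE; apply/forallP => j; rewrite mxE abszN -rP.
    by have := h j; rewrite z'E mxE.
  have -> : iota_ (- z') = - z by rewrite z'E; apply/rowP => j; rewrite !mxE rmorphN.
  by rewrite opprK /z (gmulNK G).
rewrite boxE => /forallP bP pE j; rewrite /z pE (gmulKN G) !mxE normrN rP.
exact: bP.
Qed.

Definition hit_seq (L T : nat) (rad : nat -> 'I_n -> nat) (x : 'rV[int]_n) :
    seq (nat * 'rV[int]_n) :=
  [seq qb <- [seq (q, b) | q <- [seq q <- iota 0 T | (0 < q)%N], b <- target_box rad q]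
    | E (L %/ qb.1)%N x qb.2].

Lemma size_hit_seq L T rad x : (size (hit_seq L T rad x))%:R = hits R E L T rad x.
Proof.
rewrite /hit_seq size_filter -sum1_count natr_sum big_mkcond big_allpairs_dep /=.
rewrite big_filter -{1}[T]subn0 -/(index_iota 0 T) big_mkord; apply: eq_bigr => q _.
by apply: eq_bigr => b _; case: ifP.
Qed.

Lemma mem_hit_seq L T rad x q b : ((q, b) \in hit_seq L T rad x) =
  [&& (0 < q < T)%N, b \in target_box rad q & E (L %/ q)%N x b].
Proof.
rewrite mem_filter /= andbC andbA; congr (_ && _).
apply/allpairsPdep/idP => [[q' [b' []]]|/andP[qT bq]].
  by rewrite mem_filter mem_iota /= add0n => qT bq [-> ->]; rewrite qT.
by exists q, b; split=> //; rewrite mem_filter mem_iota.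
Qed.

Lemma hit_seq_uniq L T rad x : uniq (hit_seq L T rad x).
Proof.
apply/filter_uniq/allpairs_uniq_dep => [||[q b] [q' b'] _ _ /= [-> ->] //].
  exact/filter_uniq/iota_uniq.
by move=> q _; apply: int_box_uniq.
Qed.

Let d := carnot_dist deg pol ip.
Let Q : R := (\sum_j deg j)%N%:R.

Lemma powR_root_inv q : (0 < q)%N -> q%:R `^ (- ((Q + 1) / Q)) = v q / q%:R.
Proof.
move=> q0; have Q0 : Q != 0 by rewrite pnatr_eq0 -lt0n (sum_deg_gt0 G n_gt0).
rewrite mulrDl mulfV // mul1r opprD addrC powRD; last by rewrite pnatr_eq0 -lt0n q0 implybT.
by rewrite powR_inv1.
Qed.

Lemma near_dilate c q g p : (0 < q)%N -> near c q g p <->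
  forall j, `|(- g ** dil q%:R^-1 p) 0 j| <= (c * (v q / q%:R)) ^+ deg j.
Proof.
move=> q0; have qR : 0 < q%:R :> R by rewrite ltr0n.
have -> : - g ** dil q%:R^-1 p = dil q%:R^-1 (- dil q%:R g ** p).
  rewrite (gmul_dilation G) ?invr_eq0 ?gt_eqF // dilationN -dilationM mulVf ?gt_eqF //.
  by rewrite dilation1.
have dilE (r : R) (y : 'rV[R]_n) j : dil r y 0 j = r ^+ deg j * y 0 j by rewrite mxE.
split=> h j; have := h j; rewrite dilE normrM normrX ger0_norm ?invr_ge0 //;
  rewrite mulrA [_ / q%:R]mulrC (exprMn _ q%:R^-1) ler_pM2l //; rewrite exprn_gt0 // invr_gt0 //.
Qed.

Lemma solutions_hits : exists c1 c2 : R, [/\ 0 < c1, 0 < c2 & forall T (M : R),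
  exists eta : R, 0 < eta /\ forall L x g, (0 < L)%N -> (forall q, (0 < q < T)%N -> (q %| L)%N) ->
  bounded_by M g -> bounded_by M (dil L%:R^-1 (iota_ x)) ->
  bounded_by eta (g - dil L%:R^-1 (iota_ x)) ->
  let S := solutions deg d ((Q + 1) / Q) g T%:R in
  finite_set S /\ grid_hits deg pol c1 L T x <= #|` fset_set S|%:R <= grid_hits deg pol c2 L T x].
Proof.
have [c [c0 cP]] := carnot_dist_lt G ip_inner.
have [C [C1 CP]] := carnot_dist_coord G ip_inner; have C0 : 0 < C by lra.
(* Moving between g and its grid point doubles the constant: hits with c / 2 yield solutions at g,
   and solutions at g yield hits with 2 C. *)
exists (c / 2), (2 * C); split; rewrite ?mulr_gt0 // => T M.
have c20 : 0 < c / 2 by rewrite divr_gt0.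
have [e1 [e10 e1P]] := near_perturb T M c20; have [e2 [e20 e2P]] := near_perturb T M C0.
exists (Num.min e1 e2); split=> [|L x g L0 L_dvd gM g'M gg']; first by rewrite lt_min e10.
have gg1 : bounded_by e1 (dil L%:R^-1 (iota_ x) - g).
  rewrite -opprB; apply/bounded_byN; apply: bounded_by_le gg'; by rewrite ge_min lexx.
have gg2 : bounded_by e2 (g - dil L%:R^-1 (iota_ x)).
  by apply: bounded_by_le gg'; rewrite ge_min lexx orbT.
pose r (pq : 'rV[R]_n * nat) (qb : nat * 'rV[int]_n) := [/\ (0 < pq.2 < T)%N, pq.2 = qb.1 &
  dil (L %/ pq.2)%:R pq.1 = iota_ x ** - iota_ qb.2].
have M0 q : (0 < q < T)%N -> (L %/ q)%:R != 0 :> R.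
  move=> qT; have /andP[q0 _] := qT.
  by rewrite pnatr_eq0 -lt0n divn_gt0 //; apply: dvdn_leq L0 (L_dvd q qT).
have EP q b p : (0 < q < T)%N -> integer_points p -> dil (L %/ q)%:R p = iota_ x ** - iota_ b ->
    E (L %/ q)%N x b.
  by move=> qT pi pE; apply/asboolP; rewrite -pE -dilationM mulVf ?M0 // dilation1.
have vq q : (0 < q)%N -> 0 < v q / q%:R by move=> q0; rewrite divr_gt0 ?ltr0n ?root_inv_gt0.
move=> S.
have [finS le2] : finite_set S /\ (#|` fset_set S| <= size (hit_seq L T (rad (2 * C) L) x))%N.
  apply: (@card_rel_le _ _ S _ r (0%N, 0)).
    move=> [p q] [/= pi q0]; rewrite ltr_nat powR_root_inv // => qT dist.
    have qT' : (0 < q < T)%N by rewrite q0.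
    have /(e2P _ _ _ _ qT' gM g'M gg2) : near C q g p by apply/(near_dilate _ _ _ q0)/CP.
    move=> /(near_grid _ _ q0 (L_dvd _ qT') L0 pi) [|b bq pE]; first by rewrite mulr_gt0.
    exists (q, b); last by [].
    by rewrite mem_hit_seq qT' bq (EP q b p).
  move=> [p q] [p' q'] [q1 b] [/= qT qE pE] [/= _ q'E p'E]; subst q q'.
  congr (_, _); rewrite -(dilation1 deg p) -(dilation1 deg p') -(mulVf (M0 _ qT)) !dilationM.
  by rewrite pE p'E.
have le1 : (size (hit_seq L T (rad (c / 2) L) x) <= #|` fset_set S|)%N.
  apply: (@card_rel_ge _ _ S _ r finS) => [||[p q] [q1 b] [q2 b'] [/= qT <- pE] [/= _ <-]].
  - exact: hit_seq_uniq.
  - move=> [q b]; rewrite mem_hit_seq => /and3P[qT bq /asboolP pi].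
    have /andP[q0 qT'] := qT.
    pose p := dil (L %/ q)%:R^-1 (iota_ x ** - iota_ b).
    have pE : dil (L %/ q)%:R p = iota_ x ** - iota_ b by rewrite -dilationM mulfV ?M0 // dilation1.
    exists (p, q); last by [].
    have nearp : near (2 * (c / 2)) q g p.
      apply: (e1P _ _ _ _ qT g'M gM gg1); apply/near_grid => //; first exact: L_dvd.
      by exists b.
    rewrite mulrC divfK // in nearp.
    split; rewrite ?ltr_nat //= powR_root_inv //; apply: cP; first exact: vq.
    exact: (proj1 (near_dilate c g p q0) nearp).
  rewrite pE => /(congr1 (fun y => - iota_ x ** y)); rewrite !(gmulKN G) => /oppr_inj /int_point_inj ->.
  by [].
split=> //; apply/andP; split; rewrite /grid_hits -size_hit_seq ler_nat //.
Qed.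

End Approximation.

(** * Almost every point *)

Section CountableCovers.
Variables (R : realType) (n : nat).
Hypothesis n_gt0 : (0 < n)%N.
Implicit Types A : set 'rV[R]_n.

Lemma box_volume_ge0 (a b : 'rV[R]_n) : 0 <= box_volume a b.
Proof. by apply: prodr_ge0 => j _; rewrite le_max lexx. Qed.

Lemma box_volume_xx (a : 'rV[R]_n) : box_volume a a = 0.
Proof. by rewrite /box_volume (bigD1 (Ordinal n_gt0)) //= subrr maxxx mul0r. Qed.

Lemma lebesgue_outer_ge0 A : (0 <= lebesgue_outer A)%E.
Proof.
apply: le_ereal_inf_tmp => _ [a [b [_ ->]]]; apply: nneseries_ge0 => k _ _.
by rewrite lee_fin box_volume_ge0.
Qed.

Lemma nneseries_le_bound (F : nat -> \bar R) (c : \bar R) : (forall i, 0 <= F i)%E ->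
  (forall N, \sum_(0 <= i < N) F i <= c)%E -> (\sum_(0 <= i <oo) F i <= c)%E.
Proof.
move=> F0 h; apply: lime_le; first by apply: is_cvg_nneseries => i _ _.
by apply: nearW.
Qed.

Lemma sum_nth_le (U : Type) (u0 : U) (F : U -> R) (l : seq U) N : (forall u, 0 <= F u) -> F u0 = 0 ->
  \sum_(0 <= i < N) F (nth u0 l i) <= \sum_(u <- l) F u.
Proof.
move=> F0 Fu0; elim: l N => [|u l IH] N.
  by rewrite big_nil big1 // => i _; rewrite nth_nil.
case: N => [|N]; first by rewrite big_geq // sumr_ge0.
by rewrite big_nat_recl //= big_cons lerD2l.
Qed.

Lemma sum_tail_le (W : R) k N : 0 <= W ->
  \sum_(0 <= i < N) (if (k <= i)%N then W / 2 ^+ i else 0) <= 2 * W / 2 ^+ k.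
Proof.
move=> W0.
suff : \sum_(0 <= i < N) (if (k <= i)%N then W / 2 ^+ i else 0) <=
    2 * W / 2 ^+ k - 2 * W / 2 ^+ maxn N k.
  by move/le_trans; apply; rewrite gerBl divr_ge0 ?mulr_ge0 ?exprn_ge0.
elim: N => [|N IH]; first by rewrite big_geq // max0n subrr.
rewrite big_nat_recr //=; case: (leqP k N) => kN; last first.
  by move: IH; rewrite addr0 (maxn_idPr kN) (maxn_idPr (ltnW kN)).
move: IH; rewrite (maxn_idPl kN) (maxn_idPl (leqW kN)) exprS invfM => IH.
by have := ltW (exprn_gt0 N (ltr0Sn R 1)); lra.
Qed.

(** For every k the boxes of all stages i >= k form one cover of [A], of total volume at most 2 W /
    2^k. *)
Lemma borel_cantelli A (U : nat -> seq ('rV[R]_n * 'rV[R]_n)) (W : R) :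
  (forall i, \sum_(ab <- U i) box_volume ab.1 ab.2 <= W / 2 ^+ i) ->
  (forall k g, A g -> exists2 i, (k <= i)%N & exists2 ab, ab \in U i & box ab.1 ab.2 g) ->
  lebesgue_outer A = 0%E.
Proof.
move=> volU AU; pose vol (ab : 'rV[R]_n * 'rV[R]_n) := box_volume ab.1 ab.2.
have vol0 ab : 0 <= vol ab by exact: box_volume_ge0.
have W0 : 0 <= W.
  have := volU 0%N; rewrite expr0 divr1; apply: le_trans; apply: sumr_ge0 => ab _.
  exact: vol0.
have /card_set_bijP [f f_bij] : ([set: nat] #= [set: nat * nat])%card.
  by rewrite card_eq_sym card_nat2.
suff bound k : (lebesgue_outer A <= (2 * W / 2 ^+ k)%:E)%E.
  apply/eqP; rewrite eq_le lebesgue_outer_ge0 andbT; apply/lee_addgt0Pr => e e0.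
  rewrite add0e; have W1 : 0 <= 2 * W / e by rewrite divr_ge0 ?mulr_ge0 // ltW.
  apply: le_trans (bound (Num.bound (2 * W / e))) _; rewrite lee_fin.
  rewrite ler_pdivrMr ?exprn_gt0 // [e * _]mulrC -ler_pdivrMr //; apply: (le_trans (ltW (archi_boundP W1))).
  by rewrite -natrX ler_nat ltnW // ltn_expl.
(* Earlier stages and indices past the end of a list are filled with the degenerate box at 0, whose
   volume is 0 because n > 0. This gives a family over all pairs of naturals, which the bijection
   [f] turns into a sequence. *)
pose F i l := if (k <= i)%N then vol (nth (0, 0) (U i) l) else 0.
pose c i l := if (k <= i)%N then nth (0, 0) (U i) l else (0, 0).
have Fc i l : vol (c i l) = F i l by rewrite /c /F; case: ifP => // _; apply: box_volume_xx.
have F0 i l : (0 <= (F i l)%:E)%E by rewrite lee_fin -Fc.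
pose a m := (c (f m).1 (f m).2).1; pose b m := (c (f m).1 (f m).2).2.
apply: (@le_trans _ _ (\sum_(0 <= m <oo) (box_volume (a m) (b m))%:E)%E).
  apply: ereal_inf_lbound; exists a, b; split=> // g /(AU k) [i ki [ab abU gab]].
  have [m _ fm] : exists2 m, [set: nat] m & f m = (i, index ab (U i)).
    by have [_ _ /(_ (i, index ab (U i)) I) [m _ fm]] := f_bij; exists m.
  by exists m => //; rewrite /a /b fm /c ki nth_index.
have -> : (\sum_(0 <= m <oo) (box_volume (a m) (b m))%:E)%E =
    (\sum_(0 <= i <oo) \sum_(0 <= l <oo) (F i l)%:E)%E.
  have pt : [set x : nat | xpredT x] = [set: nat] by apply/seteqP; split.
  have -> : (fun N => \sum_(0 <= m < N) (box_volume (a m) (b m))%:E)%E =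
      (fun N => \sum_(0 <= m < N) (F (f m).1 (f m).2)%:E)%E.
    by apply/funext => N; apply: eq_bigr => m _; rewrite -Fc.
  rewrite nneseries_esum // nneseries_esum; last by move=> i _; apply: nneseries_ge0.
  rewrite pt.
  have -> : \esum_(i in [set: nat]) (\sum_(0 <= l <oo) (F i l)%:E)%E =
      \esum_(i in [set: nat]) \esum_(l in [set: nat]) (F i l)%:E.
    by apply: eq_esum => i _; rewrite nneseries_esum // pt.
  rewrite esum_esum //.
  have -> : ([set: nat] `*`` (fun=> [set: nat])) = [set: nat * nat] by apply/seteqP; split.
  by rewrite (@reindex_esum R _ _ _ _ f (fun p => (F p.1 p.2)%:E) f_bij).
apply: nneseries_le_bound => [i|N]; first exact: nneseries_ge0.
apply: (@le_trans _ _ (\sum_(0 <= i < N) (if (k <= i)%N then W / 2 ^+ i else 0)%:E)%E); last first.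
  by rewrite sumEFin lee_fin sum_tail_le.
apply: lee_sum => i _; apply: nneseries_le_bound => // N'; rewrite sumEFin lee_fin /F.
case: ifP => _; last by rewrite big1.
by apply: le_trans (volU i); apply: sum_nth_le => //; apply: box_volume_xx.
Qed.

End CountableCovers.

Section Counting.
Variables (R : realType) (n s : nat) (deg : 'I_n -> nat) (pol : 'I_n -> mpoly (n + n) R).
Hypothesis G : carnot deg pol s.
Hypothesis G_rational : integral_coefficients pol.
Hypothesis n_gt0 : (0 < n)%N.
Variable ip : 'rV[R]_n -> 'rV[R]_n -> R.
Hypothesis ip_inner : inner_product_on (layer deg 1) ip.
Local Notation dil r := (dilation deg r).
Local Notation iota_ := (@int_point R n).
Let Q := (\sum_j deg j)%N.
Let S := solutions deg (carnot_dist deg pol ip) ((Q%:R + 1) / Q%:R).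

Definition cell L (x : 'rV[int]_n) : 'rV[R]_n * 'rV[R]_n :=
  (dil L%:R^-1 (iota_ x), dil L%:R^-1 (iota_ (x + const_mx 1))).

Lemma cell_volume L x : (0 < L)%N -> box_volume (cell L x).1 (cell L x).2 = (L ^ Q)%N%:R^-1.
Proof.
move=> L0; rewrite natrX -exprVn /Q expr_sum; apply: eq_bigr => j _.
have L1 : 0 <= (L%:R^-1 : R) ^+ deg j by rewrite exprn_ge0 // invr_ge0.
by rewrite !mxE rmorphD /= -mulrBr addrC addKr mulr1; apply/max_idPr.
Qed.

Lemma sample_cell (a : 'I_n -> int) (g : 'rV[R]_n) L : (0 < L)%N ->
  (forall j, (a j)%:~R <= g 0 j < (a j)%:~R + 1) ->
  exists2 x, x \in sample_box deg L a &
    box (cell L x).1 (cell L x).2 g /\ bounded_by L%:R^-1 (g - dil L%:R^-1 (iota_ x)).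
Proof.
move=> L0 ga; have LR : 0 < L%:R :> R by rewrite ltr0n.
pose x : 'rV[int]_n := \row_j Num.floor (L%:R ^+ deg j * g 0 j).
have gx j : (x 0 j)%:~R <= L%:R ^+ deg j * g 0 j < (x 0 j)%:~R + 1.
  by rewrite !mxE -[1]/(1%:~R) -intrD floor_itv.
have Lj j : 0 < L%:R ^+ deg j :> R by rewrite exprn_gt0.
exists x.
  rewrite mem_int_box; apply/forallP => j; rewrite mxE.
  have /andP[ga1 ga2] := ga j.
  have LE : (L ^ deg j)%N%:~R = L%:R ^+ deg j :> R by rewrite -natrX.
  rewrite floor_ge_int floor_lt_int intrD !intrM !LE.
  rewrite mulrC ler_pM2l // ga1 /= -[X in _ + X]mulr1 -mulrDr ltr_pM2l //.
have subE (u w : 'rV[R]_n) j : (u - w) 0 j = u 0 j - w 0 j by rewrite !mxE.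
have dilE (r : R) (y : 'rV[R]_n) j : dil r y 0 j = r ^+ deg j * y 0 j by rewrite mxE.
have iotaE y j : iota_ y 0 j = (y 0 j)%:~R by rewrite mxE.
have x1E (y : 'rV[int]_n) j : (y + const_mx 1) 0 j = y 0 j + 1 by rewrite !mxE.
split=> j; have /andP[h1 h2] := gx j; rewrite /= ?subE.
  rewrite !dilE !iotaE x1E exprVn mulrC ler_pdivrMr // mulrC h1 /= mulrC ler_pdivlMr // mulrC.
  by rewrite intrD ltW.
have -> : g 0 j - dil L%:R^-1 (iota_ x) 0 j = (L%:R ^+ deg j)^-1 * (L%:R ^+ deg j * g 0 j - (x 0 j)%:~R).
  by rewrite !mxE exprVn mulrBr mulKf // gt_eqF.
rewrite normrM ger0_norm ?invr_ge0 ?(ltW (Lj j)) // ger0_norm ?subr_ge0 //.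
apply: (@le_trans _ _ (L%:R ^+ deg j)^-1).
  by rewrite ler_piMr ?invr_ge0 ?(ltW (Lj j)) // lerBlDl ltW // addrC.
by rewrite lef_pV2 ?posrE // -[leLHS]expr1 ler_weXn2l ?ler1n // (deg_ge1 G).
Qed.

(* The bound K / 4^i stays summable after taking i + 1 unit boxes at stage i, which
   eventually reaches every unit box. *)
Lemma solutions_stage : exists K k1 k2 : R, [/\ 0 <= K, 0 < k1, 0 <= k2 & forall i (a : 'rV[int]_n),
  exists U : seq ('rV[R]_n * 'rV[R]_n),
    \sum_(ab <- U) box_volume ab.1 ab.2 <= K / 4 ^+ i /\
    forall g : 'rV[R]_n, (forall j, (a 0 j)%:~R <= g 0 j < (a 0 j)%:~R + 1) ->
    (exists2 ab, ab \in U & box ab.1 ab.2 g) \/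
    finite_set (S g (2 ^ 16 ^ i)%N%:R) /\
    k1 * 16 ^+ i <= #|` fset_set (S g (2 ^ 16 ^ i)%N%:R)|%:R <= k2 * 16 ^+ i].
Proof.
have [c1 [c2 [c10 c20 cP]]] := solutions_hits G G_rational n_gt0 ip_inner.
have [K1 [k1 [k1' [K10 k10 _ dev1]]]] := grid_deviation G G_rational n_gt0 c10.
have [K2 [k2' [k2 [K20 _ k20 dev2]]]] := grid_deviation G G_rational n_gt0 c20.
exists (K1 + K2), k1, k2; split=> //; first exact: addr_ge0.
move=> i a; pose T := (2 ^ 16 ^ i)%N.
pose M := \sum_j `|(a 0 j)%:~R : R| + 2.
have [eta [eta0 etaP]] := cP T M.
have [L1 L1P] := dev1 i (fun j => a 0 j); have [L2 L2P] := dev2 i (fun j => a 0 j).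
(* The factorial makes L divisible by all q < T; the other factor makes it large enough for both
   deviation bounds and the cells smaller than eta. *)
pose L3 := (L1 + L2 + Num.bound eta^-1).+1; pose L := (T`! * L3)%N.
have LL3 : (L3 <= L)%N by rewrite leq_pmull // fact_gt0.
have L0 : (0 < L)%N by apply: leq_trans LL3.
have L_dvd q : (0 < q < T)%N -> (q %| L)%N.
  by move=> /andP[q0 qT]; rewrite dvdn_mulr // dvdn_fact // q0 ltnW.
have LL1 : (L1 <= L)%N by apply: leq_trans LL3; rewrite /L3; lia.
have LL2 : (L2 <= L)%N by apply: leq_trans LL3; rewrite /L3; lia.
have Leta : L%:R^-1 <= eta.
  rewrite -[leRHS]invrK lef_pV2 ?posrE ?invr_gt0 ?ltr0n //.
  apply: (le_trans (ltW (archi_boundP _))); first by rewrite invr_ge0 ltW.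
  by rewrite ler_nat; apply: leq_trans LL3; rewrite /L3; lia.
have L1' : L%:R^-1 <= 1 :> R by rewrite invf_le1 ?ltr0n // ler1n.
(* Outside the cells of bad points the first counting supplies the lower bound on the solutions and
   the second the upper bound. *)
pose bad1 x := ~~ (k1 * 16 ^+ i <= grid_hits deg pol c1 L T x <= k1' * 16 ^+ i).
pose bad2 x := ~~ (k2' * 16 ^+ i <= grid_hits deg pol c2 L T x <= k2 * 16 ^+ i).
pose Z := sample_box deg L (fun j => a 0 j).
exists [seq cell L x | x <- Z & bad1 x || bad2 x]; split.
  rewrite big_map big_filter (eq_bigr (fun=> (L ^ Q)%N%:R^-1)); last by move=> x _; apply: cell_volume.
  rewrite big_const_seq iter_addr_0 -[_ *+ _]mulr_natr.
  have LQ : 0 < (L ^ Q)%N%:R :> R by rewrite ltr0n expn_gt0 L0.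
  rewrite mulrC ler_pdivrMr // mulrC.
  apply: (@le_trans _ _ ((count bad1 Z)%:R + (count bad2 Z)%:R)).
    by rewrite -natrD ler_nat -count_predUI leq_addr.
  by rewrite mulrDl mulrDr lerD ?L1P ?L2P.
move=> g ga; have [x xZ [gx gg']] := sample_cell L0 ga.
case: (boolP (bad1 x || bad2 x)) => [bx|].
  by left; exists (cell L x) => //; apply: map_f; rewrite mem_filter bx.
rewrite negb_or !negbK => /andP[/andP[g1 _] /andP[_ g2]]; right.
have gM : bounded_by (M - 1) g.
  move=> j; have /andP[h1 h2] := ga j.
  have h3 : `|(a 0 j)%:~R : R| <= \sum_j `|(a 0 j)%:~R : R|.
    by rewrite (bigD1 j) //= lerDl sumr_ge0.
  rewrite /M; apply: (@le_trans _ _ (`|(a 0 j)%:~R : R| + 1)); last by lra.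
  by have := ler_norm ((a 0 j)%:~R : R); have := ler_norm (- ((a 0 j)%:~R : R));
    rewrite normrN ler_norml; lra.
have g'M : bounded_by M (dil L%:R^-1 (iota_ x)).
  move=> j; have := gg' j; have := gM j.
  have -> : (g - dil L%:R^-1 (iota_ x)) 0 j = g 0 j - dil L%:R^-1 (iota_ x) 0 j by rewrite !mxE.
  move: (dil _ _ 0 j) => y; rewrite !ler_norml; lra.
have gM' : bounded_by M g by apply: bounded_by_le gM; lra.
have := etaP L x g L0 L_dvd gM' g'M (bounded_by_le Leta gg').
move=> [finS /andP[h1 h2]]; split=> //.
by rewrite (le_trans g1 h1) (le_trans h2 g2).
Qed.

Lemma solutions_sub (g : 'rV[R]_n) (q q' : R) : q <= q' -> S g q `<=` S g q'.
Proof. by move=> qq' pq [h1 h2 h3 h4]; split=> //; apply: lt_le_trans qq'. Qed.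

Lemma solutions_card_le (g : 'rV[R]_n) (q q' : R) : q <= q' -> finite_set (S g q') ->
  finite_set (S g q) /\ (#|` fset_set (S g q)| <= #|` fset_set (S g q')|)%N.
Proof.
move=> qq' fin'; have fin : finite_set (S g q) by apply: sub_finite_set fin'; apply: solutions_sub.
by split=> //; apply/fsubset_leq_card; rewrite -fset_set_sub //; apply: solutions_sub.
Qed.

Lemma ln_stage i : ln (2 ^ 16 ^ i)%N%:R = 16 ^+ i * ln 2 :> R.
Proof. by rewrite natrX lnXn // -[ln 2 *+ _]mulr_natl natrX. Qed.

Lemma solutions_asymptotics : exists C : R, 0 < C /\
  almost_every (fun g : 'rV[R]_n => \forall q0 \near +oo,
    finite_set (S g q0) /\ C^-1 * ln q0 <= #|` fset_set (S g q0)|%:R <= C * ln q0).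
Proof.
have [K [k1 [k2 [K0 k10 k20 stage]]]] := solutions_stage.
have ln2 : 0 < ln 2 :> R by rewrite ln_gt0 // ltr1n.
(* The factors 16 come from comparing q0 with the two neighbouring stages, whose logarithms differ
   by that ratio. *)
pose C := 1 + 16 * ln 2 / k1 + 16 * k2 / ln 2.
have C1 : 0 <= 16 * ln 2 / k1 by rewrite divr_ge0 ?mulr_ge0 ?(ltW ln2) ?(ltW k10).
have C2 : 0 <= 16 * k2 / ln 2 by rewrite divr_ge0 ?mulr_ge0 ?(ltW ln2).
have C0 : 0 < C by rewrite /C; lra.
exists C; split=> //.
have /choice [U UP] : forall i, exists U : 'rV[int]_n -> seq ('rV[R]_n * 'rV[R]_n), forall a,
    \sum_(ab <- U a) box_volume ab.1 ab.2 <= K / 4 ^+ i /\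
    forall g : 'rV[R]_n, (forall j, (a 0 j)%:~R <= g 0 j < (a 0 j)%:~R + 1) ->
    (exists2 ab, ab \in U a & box ab.1 ab.2 g) \/
    finite_set (S g (2 ^ 16 ^ i)%N%:R) /\
    k1 * 16 ^+ i <= #|` fset_set (S g (2 ^ 16 ^ i)%N%:R)|%:R <= k2 * 16 ^+ i.
  by move=> i; have /choice [Ui UiP] := stage i; exists Ui.
pose T i := (2 ^ 16 ^ i)%N.
(* Stage i treats the unit boxes whose corner has a code at most i. *)
pose V i := flatten [seq U i a | a <- pmap (@choice.unpickle 'rV[int]_n) (iota 0 i.+1)].
apply: (@borel_cantelli R n n_gt0 _ V K) => [i|k g bad].
  rewrite big_flatten big_map.
  apply: (@le_trans _ _ (\sum_(a <- pmap (@choice.unpickle 'rV[int]_n) (iota 0 i.+1)) K / 4 ^+ i)).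
    by apply: ler_sum => a _; have [] := UP i a.
  rewrite big_const_seq count_predT iter_addr_0 -[_ *+ _]mulr_natr.
  (* One factor 2^i pays for the at most i + 1 <= 2^i unit boxes, the other one keeps the volumes
     summable. *)
  have e4 : 4 ^+ i = 2 ^+ i * 2 ^+ i :> R by rewrite -exprMn; congr (_ ^+ _); lra.
  rewrite e4 invfM mulrA -[leRHS]mulr1 -mulrA ler_wpM2l ?divr_ge0 ?exprn_ge0 //.
  rewrite mulrC ler_pdivrMr ?exprn_gt0 // mul1r -natrX ler_nat.
  rewrite size_pmap; apply: (leq_trans (count_size _ _)); rewrite size_iota.
  exact: ltn_expl.
apply: contrapT => noU; apply: bad.
pose a : 'rV[int]_n := \row_j Num.floor (g 0 j).
have ga j : (a 0 j)%:~R <= g 0 j < (a 0 j)%:~R + 1.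
  by rewrite mxE -[1]/(1%:~R) -intrD floor_itv.
(* From this stage on, the unit box of g is among those treated and g lies in no exceptional box. *)
pose i0 := maxn k (choice.pickle a).
have good i : (i0 <= i)%N -> finite_set (S g (T i)%:R) /\
    k1 * 16 ^+ i <= #|` fset_set (S g (T i)%:R)|%:R <= k2 * 16 ^+ i.
  rewrite geq_max => /andP[ki ai]; have [_ /(_ g ga) [[ab abU gab]|//]] := UP i a.
  exfalso; apply: noU; exists i => //; exists ab => //; apply/flattenP; exists (U i a) => //.
  apply: map_f; rewrite mem_pmap; apply/mapP; exists (choice.pickle a); last by rewrite choice.pickleK.
  by rewrite mem_iota add0n ltnS.
have Tmono i i' : (i <= i')%N -> (T i <= T i')%N.
  by move=> ii; rewrite leq_exp2l // leq_exp2l.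
exists (T i0)%:R; split=> // q0 Tq0.
have ex : exists N, q0 < (T N)%:R.
  have q00 : 0 <= q0 by apply: le_trans (ltW Tq0).
  exists (Num.bound q0); apply: (lt_trans (archi_boundP q00)); rewrite ltr_nat.
  by apply: ltn_trans (ltn_expl _ _) (ltn_expl _ _).
(* The least stage above q0 and the one before it enclose q0, and the counts are monotone in q0. *)
have [N qN Nmin] := ex_minnP ex.
have i0N : (i0 < N)%N.
  by rewrite ltnNge; apply/negP => /Tmono; rewrite -(ler_nat R) => h; move: (lt_trans Tq0 qN); lra.
case: N i0N qN Nmin => // i; rewrite ltnS => i0i qi imin.
have iq : (T i)%:R <= q0 by rewrite leNgt; apply/negP => /imin; rewrite ltnn.
have [fin_i /andP[lo _]] := good i i0i; have [fin_i1 /andP[_ hi]] := good i.+1 (leqW i0i).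
have [fin le1] := solutions_card_le (ltW qi) fin_i1; have [_ le2] := solutions_card_le iq fin.
have q0_gt0 : 0 < q0 by apply: lt_le_trans iq; rewrite ltr0n expn_gt0.
have T0 m : 0 < (T m)%:R :> R by rewrite ltr0n expn_gt0.
have ln1 : 16 ^+ i * ln 2 <= ln q0 by rewrite -ln_stage ler_ln // posrE.
have ln1' : ln q0 <= 16 * 16 ^+ i * ln 2.
  by rewrite -exprS -ln_stage ler_ln ?posrE // ltW.
have e16 : 0 < 16 ^+ i :> R by rewrite exprn_gt0.
split=> //; apply/andP; split.
  apply: le_trans (le_trans lo _); last by rewrite ler_nat.
  rewrite mulrC ler_pdivrMr //; apply: (le_trans ln1').
  have -> : 16 * 16 ^+ i * ln 2 = k1 * 16 ^+ i * (16 * ln 2 / k1).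
    by field; rewrite gt_eqF.
  by rewrite ler_wpM2l ?mulr_ge0 ?(ltW k10) ?(ltW e16) // /C; lra.
apply: (@le_trans _ _ (k2 * 16 ^+ i.+1)); first by apply: le_trans hi; rewrite ler_nat.
apply: (@le_trans _ _ (C * (16 ^+ i * ln 2))); last by rewrite ler_wpM2l // ltW.
have -> : k2 * 16 ^+ i.+1 = 16 * k2 / ln 2 * (16 ^+ i * ln 2).
  by rewrite exprS; field; rewrite gt_eqF.
by rewrite ler_wpM2r ?mulr_ge0 ?(ltW e16) ?(ltW ln2) // /C; lra.
Qed.

End Counting.

Lemma hausdorff_dimE (n s : nat) (deg : 'I_n -> nat) : (forall j, 1 <= deg j <= s)%N ->
  hausdorff_dim deg s = (\sum_j deg j)%N.
Proof.
move=> degs; rewrite /hausdorff_dim /layer_dim.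
under eq_bigr do rewrite -sum1_card big_distrr /=.
under eq_bigr do rewrite big_mkcond /=.
rewrite exchange_big /=; apply: eq_bigr => j _.
rewrite (bigD1_seq (deg j)) ?iota_uniq //=; last by rewrite mem_index_iota ltnS.
rewrite inE eqxx muln1 big1 ?addn0 // => i ij.
by rewrite inE eq_sym (negbTE ij).
Qed.

Theorem theorem1p2 (R : realType) (n s : nat) (n_gt0 : (0 < n)%N)
    (deg : 'I_n -> nat) (pol : 'I_n -> mpoly (n + n) R)
    (G_carnot : carnot deg pol s) (G_rational : integral_coefficients pol)
    (ip : 'rV[R]_n -> 'rV[R]_n -> R)
    (ip_inner : inner_product_on (layer deg 1) ip) :
  let d := carnot_dist deg pol ip in
  let Q : R := (hausdorff_dim deg s)%:R in
  let alpha : R := (Q + 1) / Q in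
  exists C : R, 0 < C /\
    almost_every (fun g : 'rV[R]_n =>
      \forall q0 \near +oo,
        let S := solutions deg d alpha g q0 in
        finite_set S /\
        C^-1 * ln q0 <= #|` fset_set S|%:R <= C * ln q0).
Proof.
rewrite (hausdorff_dimE (carnot_deg G_carnot)) => d Q alpha.
exact: (solutions_asymptotics G_carnot G_rational n_gt0 ip_inner).
Qed.
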